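(* Let $X$ be a one-dimensional Lévy process with triplet $(a,b,\nu)$, where $\nu$ is supported on $\mathbb{R}_+=[0,\infty)$ and $\nu[x,\infty)=c\,x^\beta e^{-\lambda\log^\gamma x}$ for all sufficiently large $x$, with constants $c>0$, $\beta\in\mathbb{R}$, $\lambda>0$, $\gamma>1$. Put $r(\log x)=\lambda\log^\gamma x-\log(cx^\beta)$, so that $\nu[x,\infty)=\exp(-r(\log x))$ for large $x$, and for $n\ge1$, $t\in[0,1]$ let $\bar X_n(t)=\frac1n\big(X(nt)-bnt-nt\int_{|x|\ge1}x\,\nu(dx)\big)$. Then $\{\bar X_n\}_{n\ge1}$ does not satisfy an LDP with speed $r(\log n)$ on $(\mathbb{D},d_{M_1'})$. In particular, there exists a measurable set $F\subseteq\mathbb{D}$ such that $$\limsup_{n\to\infty}\frac{\log P(\bar X_n\in F)}{r(\log n)}>-\inf_{\xi\in\bar F}I^{M_1'}(\xi),$$ where $\bar F$ is the closure of $F$ with respect to $d_{M_1'}$. Moreover, $\{\bar X_n\}_{n\ge1}$ does not satisfy an LDP with speed $r(\log n)$ on $(\mathbb{D},d_{J_1})$ either.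
   Context: Notation: $\log^\gamma x=(\log x)^\gamma$. Lévy process with triplet $(a,b,\nu)$: $X(t)=bt+aB(t)+\int_{|x|<1}x\big(\hat N([0,t]\times dx)-t\nu(dx)\big)+\int_{|x|\ge1}x\,\hat N([0,t]\times dx)$, where $a,b\in\mathbb{R}$, $B$ is a standard Brownian motion, $\nu$ is a Lévy measure ($\sigma$-finite on $\mathbb{R}\setminus\{0\}$ with $\int\min(1,|x|^2)\nu(dx)<\infty$), and $\hat N$ is an independent Poisson random measure on $[0,\infty)\times(0,\infty)$ with mean measure $\mathrm{Leb}\times\nu$. $\mathbb{D}$ is the space of real-valued càdlàg functions on $[0,1]$, with convention $\xi(0-)=0$ (so $\xi(0)\ne0$ counts as a jump at time $0$). The $J_1$ metric is $d_{J_1}(\xi,\zeta)=\inf_{\lambda\in\Lambda}\max(\|\lambda-e\|,\|\xi\circ\lambda-\zeta\|)$, with $\|\cdot\|$ the sup norm, $\Lambda$ the non-decreasing homeomorphisms of $[0,1]$, $e$ the identity map. $M_1'$ metric: the extended completed graph of $\xi\in\mathbb{D}$ is $\Gamma(\xi)=\{(y,t)\in\mathbb{R}\times[0,1]:y\in[\xi(t-)\wedge\xi(t),\xi(t-)\vee\xi(t)]\}$. Order it by $(y_1,t_1)\prec(y_2,t_2)$ if $t_1<t_2$, or $t_1=t_2$ and $|\xi(t_1-)-y_1|<|\xi(t_2-)-y_2|$. A parametrization of $\Gamma(\xi)$ is a continuous, non-decreasing (w.r.t. $\prec$), surjective map $(u,r):[0,1]\to\Gamma(\xi)$; $\Pi(\xi)$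 is the set of parametrizations. Then $d_{M_1'}(\xi,\zeta)=\inf\{\max(\|u_1-u_2\|,\|r_1-r_2\|):(u_1,r_1)\in\Pi(\xi),(u_2,r_2)\in\Pi(\zeta)\}$. $I^{M_1'}(\xi)=\sum_{t\in[0,1]}\mathbf 1\{\xi(t)\ne\xi(t-)\}$ if $\xi\in\hat{\mathbb{D}}_{<\infty}$ and $I^{M_1'}(\xi)=\infty$ otherwise, where $\hat{\mathbb{D}}_{<\infty}$ is the set of $\xi=\sum_{i=1}^jz_i\mathbf 1_{[t_i,1]}$ with $j\ge0$, $z_i>0$ and distinct $t_i\in[0,1]$. LDP (standard): random elements $Y_n$ of a metric space $(S,d)$ satisfy an LDP with speed $a_n\to\infty$ if there is a lower semicontinuous $I:S\to[0,\infty]$ such that $\liminf_n a_n^{-1}\log P(Y_n\in G)\ge-\inf_GI$ for all open $G$ and $\limsup_na_n^{-1}\log P(Y_n\in F)\le-\inf_FI$ for all closed $F$. *)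

(* Defs.v *)
From HB Require Import structures.
From mathcomp Require Import all_boot all_order all_algebra.
From mathcomp Require Import all_classical all_reals all_analysis.
From mathcomp Require Import measurable_realfun.

Set Implicit Arguments.
Unset Strict Implicit.
Unset Printing Implicit Defensive.

Import Order.TTheory GRing.Theory Num.Theory.
Import numFieldNormedType.Exports.

Local Open Scope classical_set_scope.
Local Open Scope ring_scope.

(* [metric_space dist] is a copy of [S] whose open sets are the sets that
   contain an open [dist]-ball around each of their points.  No axiom on
   [dist] is needed for this to be a topology; when [dist] is a metric it is
   the usual metric topology. *)
Definition metric_space (R : realType) (S : choiceType)
  (dist : S -> S -> \bar R) : Type := S.

Section metric_topology.
Context (R : realType) (S : choiceType) (dist : S -> S -> \bar R).

Definition metric_open (G : set (metric_space dist)) : Prop :=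
  forall x, G x -> exists2 e : R, 0 < e &
    forall y, (dist x y < e%:E)%E -> G y.

Lemma metric_openT : metric_open setT.
Proof. by move=> x _; exists 1. Qed.

Lemma metric_openI : setI_closed metric_open.
Proof.
move=> A B oA oB x [/oA[e e0 eA] /oB[f f0 fB]].
exists (Num.min e f); first by rewrite lt_min e0.
by move=> y; rewrite EFin_min lt_min => /andP[/eA Ay /fB By].
Qed.

Lemma metric_open_bigU (I : Type) (f : I -> set (metric_space dist)) :
  (forall i, metric_open (f i)) -> metric_open (\bigcup_i f i).
Proof.
move=> of_ x [i _ /of_[e e0 ef]].
by exists e => // y /ef fy; exists i.
Qed.

HB.instance Definition _ := Choice.copy (metric_space dist) S.
HB.instance Definition _ := isOpenTopological.Build (metric_space dist)
  metric_openT metric_openI metric_open_bigU.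

End metric_topology.

(* The requirement that the speed [a] tend to infinity is left to the user of
   the definition, so that the negation of [LDP] is never due to its failure. *)
Definition LDP (d : measure_display) (Omega : measurableType d) (R : realType)
    (P : probability Omega R) (T : topologicalType) (Y : nat -> Omega -> T)
    (a : nat -> R) : Prop :=
  exists I : T -> \bar R,
    [/\ (forall x, (0 <= I x)%E),
        lower_semicontinuous I,
        (forall G : set T, open G ->
          (- ereal_inf (I @` G) <=
           limn_einf (fun n => ((a n)^-1)%:E * lne (P (Y n @^-1` G))))%E) &
        (forall F : set T, closed F ->
          (limn_esup (fun n => ((a n)^-1)%:E * lne (P (Y n @^-1` F))) <=
           - ereal_inf (I @` F))%E)].

(* A function on [0, 1] is extended by 0 to the real line.  The extension to
   the left of 0 implements the convention xi(0-) = 0; the one to the right of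
   1 makes equality of paths coincide with equality on [0, 1]. *)
Definition cadlag01 (R : realType) (f : R -> R) : Prop :=
  [/\ forall t, 0 <= t < 1 -> f x @[x --> t^'+] --> f t,
      forall t, 0 < t <= 1 -> cvg (f x @[x --> t^'-]) &
      forall t, t \notin `[0, 1] -> f t = 0].

Definition skorokhod (R : realType) := set_type [set f : R -> R | cadlag01 f].

HB.instance Definition _ (R : realType) := Choice.on (skorokhod R).

Definition sample_path (R : realType) (xi : skorokhod R) : R -> R := set_val xi.

Definition left_limit (R : realType) (xi : skorokhod R) (t : R) : R :=
  lim (sample_path xi x @[x --> t^'-]).

Section skorokhod_metrics.
Context {R : realType}.
Implicit Types (xi zeta : skorokhod R).

Definition sup_norm01 (f : R -> R) : \bar R :=
  ereal_sup [set `|f t|%:E | t in `[0, 1]].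

Definition increasing_homeo01 (lam : R -> R) : Prop :=
  {in `[0, 1] &, {homo lam : x y / x <= y}} /\
  exists mu : R -> R,
    [/\ set_fun `[0, 1] `[0, 1] lam, set_fun `[0, 1] `[0, 1] mu,
        {in `[0, 1], cancel lam mu} /\ {in `[0, 1], cancel mu lam},
        {within `[0, 1], continuous lam} & {within `[0, 1], continuous mu}].

Definition dist_J1 xi zeta : \bar R :=
  ereal_inf [set maxe (sup_norm01 (fun t => lam t - t))
                      (sup_norm01 (fun t => sample_path xi (lam t) - sample_path zeta t))
            | lam in increasing_homeo01].

Definition extended_graph xi : set (R * R) :=
  [set p | p.2 \in `[0, 1] /\
    Num.min (left_limit xi p.2) (sample_path xi p.2) <= p.1 <=
    Num.max (left_limit xi p.2) (sample_path xi p.2)].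

Definition graph_lt xi (p q : R * R) : Prop :=
  p.2 < q.2 \/
  (p.2 = q.2 /\
   `|left_limit xi p.2 - p.1| < `|left_limit xi q.2 - q.1|).

Definition parametrization xi (u r : R -> R) : Prop :=
  [/\ {within `[0, 1], continuous u}, {within `[0, 1], continuous r},
      {in `[0, 1] &, forall s s', s <= s' ->
         graph_lt xi (u s, r s) (u s', r s') \/
         (u s, r s) = (u s', r s')} &
      [set (u s, r s) | s in `[0, 1]] = extended_graph xi].

Definition dist_M1' xi zeta : \bar R :=
  ereal_inf [set l | exists u1 r1 u2 r2,
    [/\ parametrization xi u1 r1, parametrization zeta u2 r2 &
        l = maxe (sup_norm01 (fun s => u1 s - u2 s))
                 (sup_norm01 (fun s => r1 s - r2 s))]].

Definition positive_step xi : Prop :=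
  exists (j : nat) (z t : 'I_j -> R),
    [/\ forall i, 0 < z i, injective t, forall i, t i \in `[0, 1] &
        forall s, sample_path xi s = \sum_(i < j) z i * \1_(`[t i, 1]) s].

Definition rate_M1' xi : \bar R :=
  if `[< positive_step xi >]
  then \esum_(t in `[0, 1]) (sample_path xi t != left_limit xi t)%:R%:E
  else +oo%E.

End skorokhod_metrics.

Notation D_J1 R := (metric_space (@dist_J1 R)).
Notation D_M1' R := (metric_space (@dist_M1' R)).

Section processes.
Context (d : measure_display) (Omega : measurableType d) (R : realType).
Variable P : probability Omega R.

(* Taking [E i = setT] for some indices gives the product rule for every
   subfamily. *)
Definition mutually_independent (d' : measure_display)
    (T : measurableType d') (I : finType) (Y : I -> Omega -> T) : Prop :=
  forall E : I -> set T, (forall i, measurable (E i)) ->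
    P (\bigcap_i (Y i @^-1` E i)) = (\prod_(i : I) P (Y i @^-1` E i))%E.

Definition generated_by (d' : measure_display) (T : measurableType d')
    (I : Type) (D : set I) (Y : I -> Omega -> T) : set (set Omega) :=
  <<s [set A | exists i E, [/\ D i, measurable E & A = Y i @^-1` E]] >>.

Definition independent_sigma (F G : set (set Omega)) : Prop :=
  forall A B, F A -> G B -> P (A `&` B) = (P A * P B)%E.

Definition brownian_motion (B : R -> {RV P >-> R}) : Prop :=
  [/\ {ae P, forall w, B 0 w = 0},
      forall w, {within `[0, +oo[, continuous (fun t => B t w)},
      forall (n : nat) (t : nat -> R), 0 <= t 0%N ->
        {homo t : i j / (i <= j)%N >-> i <= j} ->
        mutually_independent (fun (i : 'I_n) w => B (t i.+1) w - B (t i) w) &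
      forall s t, 0 <= s < t -> forall E, measurable E ->
        P [set w | E (B t w - B s w)] = normal_prob 0 (Num.sqrt (t - s)) E].

Definition levy_measure
    (nu : {sigma_finite_measure set (measurableTypeR R) -> \bar R}) : Prop :=
  nu [set 0] = 0%E /\ (\int[nu]_x (Num.min 1 (`|x| ^+ 2))%:E < +oo)%E.

(* Leb x nu on [0, oo) x R, as a measure on the plane carried by that set. *)
Definition jump_intensity
    (nu : {sigma_finite_measure set (measurableTypeR R) -> \bar R})
    (A : set (measurableTypeR R * measurableTypeR R)) : \bar R :=
  ((@lebesgue_measure R) \x nu)%E (A `&` (`[0, +oo[ `*` setT)).

(* A random measure is a kernel from [Omega].  The second argument of
   [poisson_prob] is a dummy; [poisson_prob 0] is the Dirac mass at 0. *)
Definition poisson_random_measure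
    (mean : set (measurableTypeR R * measurableTypeR R) -> \bar R)
    (N : R.-ker Omega ~> (measurableTypeR R * measurableTypeR R)%type) : Prop :=
  [/\ forall A, measurable A -> (mean A < +oo)%E -> forall k : nat,
        P [set w | N w A = k%:R%:E] = poisson_prob (fine (mean A)) 0 [set k],
      forall A, measurable A -> mean A = +oo%E ->
        {ae P, forall w, N w A = +oo%E} &
      forall (n : nat) (A : 'I_n -> set _), (forall i, measurable (A i)) ->
        trivIset setT A -> mutually_independent (fun i w => N w (A i))].

(* int_{|x| < 1} x (N([0, t] x dx) - t nu(dx)), as the L^2 limit of the
   compensated integrals over e <= |x| < 1 when e decreases to 0. *)
Definition compensated_small_jumps
    (nu : {sigma_finite_measure set (measurableTypeR R) -> \bar R})
    (N : R.-ker Omega ~> (measurableTypeR R * measurableTypeR R)%type)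
    (t : R) (J : {RV P >-> R}) : Prop :=
  let small e := [set x : measurableTypeR R | e <= `|x| < 1] in
  (\int[P]_w (((\int[N w]_(z in `[0%R, t] `*` small e) z.2 -
                t * \int[nu]_(x in small e) x - J w) ^+ 2)%R)%:E)%E
    @[e --> 0^'+] --> 0%E.

Definition cadlag_halfline (f : R -> R) : Prop :=
  (forall t, 0 <= t -> f x @[x --> t^'+] --> f t) /\
  (forall t, 0 < t -> cvg (f x @[x --> t^'-])).

Definition levy_process (a b : R)
    (nu : {sigma_finite_measure set (measurableTypeR R) -> \bar R})
    (X : R -> {RV P >-> R}) : Prop :=
  [/\ levy_measure nu,
      forall w, cadlag_halfline (fun t => X t w) &
      exists (B : R -> {RV P >-> R})
        (N : R.-ker Omega ~> (measurableTypeR R * measurableTypeR R)%type)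
        (J : R -> {RV P >-> R}),
      [/\ brownian_motion B,
          poisson_random_measure (jump_intensity nu) N,
          independent_sigma
            (generated_by `[0, +oo[ B)
            (generated_by measurable (fun A w => N w A)),
          forall t, 0 <= t -> compensated_small_jumps nu N t (J t) &
          forall t, 0 <= t -> {ae P, forall w,
            X t w = b * t + a * B t w + J t w +
              \int[N w]_(z in `[0, t] `*` [set x | 1 <= `|x|]) z.2}]].

End processes.

Section scaled_process.
Context (d : measure_display) (Omega : measurableType d) (R : realType).
Variables (P : probability Omega R) (a b : R).
Variable nu : {sigma_finite_measure set (measurableTypeR R) -> \bar R}.
Variable X : R -> {RV P >-> R}.

Definition scaled_fun (n : nat) (w : Omega) (t : R) : R :=
  n%:R^-1 * (X (n%:R * t) w - b * n%:R * t
             - n%:R * t * \int[nu]_(x in [set x | 1 <= `|x|]) x).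

Hypothesis X_levy : levy_process a b nu X.

Lemma scaled_fun_cadlag n w : cadlag01 (scaled_fun n w \_ `[0, 1]).
Proof.
case: X_levy => _ /(_ w)[Xr Xl] _.
set m := \int[nu]_(x in [set x | 1 <= `|x|]) x.
have drift (F : set_system R) (t : R) : Filter F -> F --> t ->
    b * n%:R * x + n%:R * x * m @[x --> F] --> b * n%:R * t + n%:R * t * m.
  move=> FF Ft; apply: cvgD; first by apply: cvgM => //; exact: cvg_cst.
  by apply: cvgM; [apply: cvgM => //; exact: cvg_cst|exact: cvg_cst].
have sE x : scaled_fun n w x =
    n%:R^-1 * (X (n%:R * x) w - (b * n%:R * x + n%:R * x * m)).
  by rewrite /scaled_fun -/m opprD addrA.
split=> [t /andP[t0 t1]|t /andP[t0 t1]|t]; last first.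
- by rewrite patchE mem_setE => /negbTE ->.
- apply/cvg_ex; have [n0|n0] := posnP n.
    exists 0; apply: cvg_near_cst; near=> x.
    by rewrite patchE; case: ifP => // _; rewrite sE n0 invr0 mul0r.
  have np : 0 < n%:R :> R by rewrite ltr0n.
  have /cvg_ex[l Xl'] := Xl (n%:R * t) (mulr_gt0 np t0).
  exists (n%:R^-1 * (l - (b * n%:R * t + n%:R * t * m))).
  have : n%:R^-1 * (X (n%:R * x) w - (b * n%:R * x + n%:R * x * m))
      @[x --> t^'-] --> n%:R^-1 * (l - (b * n%:R * t + n%:R * t * m)).
    apply: cvgM; first exact: cvg_cst.
    apply: cvgB; last by apply: drift; exact: cvg_within.
    apply: (cvg_comp _ _ _ Xl') => A.
    rewrite /at_left /within /= => /nbhs_ballP[e /= e0 eA].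
    apply/nbhs_ballP; exists (e / n%:R); first by rewrite /= divr_gt0.
    move=> x; rewrite /ball /= => tx xt; apply: eA.
      by rewrite /ball /= -mulrBr normrM gtr0_norm// mulrC -ltr_pdivlMr.
    by rewrite ltr_pM2l.
  apply: cvg_trans; apply: near_eq_cvg; near=> x.
  rewrite -sE patchE ifT// mem_setE in_itv /=; apply/andP; split.
    by near: x; exact: nbhs_left_ge.
  by apply: ltW; apply: (lt_le_trans _ t1); near: x; exact: nbhs_left_lt.
- have [n0|n0] := posnP n.
    have s0 x : (scaled_fun n w \_ `[0, 1]) x = 0.
      by rewrite patchE; case: ifP => // _; rewrite sE n0 invr0 mul0r.
    by rewrite s0; apply: cvg_near_cst; near=> x; rewrite s0.
  have np : 0 < n%:R :> R by rewrite ltr0n.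
  have Xr' := Xr (n%:R * t) (mulr_ge0 (ltW np) t0).
  have -> : (scaled_fun n w \_ `[0, 1]) t = scaled_fun n w t.
    by rewrite patchE ifT// mem_setE in_itv /= t0 ltW.
  rewrite sE.
  have : n%:R^-1 * (X (n%:R * x) w - (b * n%:R * x + n%:R * x * m))
      @[x --> t^'+] -->
      n%:R^-1 * (X (n%:R * t) w - (b * n%:R * t + n%:R * t * m)).
    apply: cvgM; first exact: cvg_cst.
    apply: cvgB; last by apply: drift; exact: cvg_within.
    apply: (cvg_comp _ _ _ Xr') => A.
    rewrite /at_right /within /= => /nbhs_ballP[e /= e0 eA].
    apply/nbhs_ballP; exists (e / n%:R); first by rewrite /= divr_gt0.
    move=> x; rewrite /ball /= => tx xt; apply: eA.
      by rewrite /ball /= -mulrBr normrM gtr0_norm// mulrC -ltr_pdivlMr.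
    by rewrite ltr_pM2l.
  apply: cvg_trans; apply: near_eq_cvg; near=> x.
  rewrite -sE patchE ifT// mem_setE in_itv /=; apply/andP; split.
    by apply: (le_trans t0); near: x; exact: nbhs_right_ge.
  by near: x; exact: nbhs_right_le.
Unshelve. all: by end_near. Qed.

Definition scaled_process (n : nat) (w : Omega) : skorokhod R :=
  exist _ (scaled_fun n w \_ `[0, 1]) (mem_set (scaled_fun_cadlag n w)).

End scaled_process.

(* Main.v *)
(** The centered process X(t) - b t - t int_{|x| >= 1} x nu(dx) has no negative
    jumps, so by Chernoff's bound it lies below - delta t with a probability that
    is exponentially small in t.  Since r(log n) is of order log^gamma n, paths
    that are negative somewhere before time 1 have arbitrarily small
    neighbourhoods whose probabilities are negligible at speed r(log n): every
    rate function is infinite there.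

    A dip of depth of order 1/n is however free: at a suitable fixed time T the
    centered process is below some - kappa with a probability bounded away from
    0, because of its negative drift and as long as no jump of size at least 1
    has occurred.  A later jump of size 3 n^2, of probability about
    exp(- r(log (3 n^2))) >= exp(- A log^gamma n), then lifts the scaled path
    above n at time 1.  Thus the scaled process belongs to the set of paths such
    that inf xi <= - kappa / xi(1) and xi(1) >= 1 with a probability that is not
    negligible at speed r(log n).  This set is closed in both topologies and
    consists of paths of infinite rate, which contradicts the upper bound. *)

Require Import Defs.
From HB Require Import structures.
From mathcomp Require Import all_boot all_order all_algebra.
From mathcomp Require Import all_classical all_reals all_analysis.
From mathcomp Require Import measurable_realfun.
From mathcomp Require Import ring lra.

Set Implicit Arguments.
Unset Strict Implicit.
Unset Printing Implicit Defensive.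

Import Order.TTheory GRing.Theory Num.Theory.
Import numFieldNormedType.Exports.

Local Open Scope classical_set_scope.
Local Open Scope ring_scope.

(** * Paths and the two topologies *)

Section paths.
Context {R : realType}.
Implicit Types (xi zeta : skorokhod R).

(** The obstacle is that the event of no large jump before [T] and a huge one later has vanishing
    probability, so a fixed chance for the Gaussian part and the small jumps to spoil the dip cannot
    be subtracted from it. The Chernoff bounds therefore carry an event on the counts of disjoint
    jump regions and stay proportional to its probability; at the fixed time [T] they remove at most
    half of it. At time n an unconditional bound is enough, since exp(- c n) is negligible against
    exp(- A log^gamma n).

    Exponential moments are available only for finite sums of Poisson counts, whereas the
    compensated small jumps are an L^2 limit. Jump sizes are cut into k bins, where k also bounds
    the total count off a small event: passing from integrals to sums then costs only a constant in
    the exponent, and the L^2 error vanishes while the event stays fixed.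

    Any finite lower bound at the scale of the speed suffices, because the rate it contradicts is
    infinite. This is why a jump of quadratic size, which only multiplies log^gamma n by a constant,
    is affordable. *)

Lemma path_outside xi t : t \notin `[0, 1] -> sample_path xi t = 0.
Proof. by case: (set_valP xi) => _ _; exact. Qed.

(** At [t = 0] the limit is that of the zero extension, which realizes the convention xi(0-) = 0. *)
Lemma left_limit_cvg xi t : 0 <= t <= 1 ->
  sample_path xi x @[x --> t^'-] --> left_limit xi t.
Proof.
move=> /andP[t0 t1]; rewrite /left_limit.
move: t0; rewrite le_eqVlt => /predU1P[<-|t0]; last first.
  by case: (set_valP xi) => _ + _; apply; rewrite t0.
apply/cvg_ex; exists 0; apply: cvg_near_cst; near=> x.
rewrite path_outside// in_itv/= negb_and -ltNge; apply/orP; left.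
by near: x; exact: nbhs_left_lt.
Unshelve. all: by end_near. Qed.

(** The segment of the graph over time [p.2] is spanned by the left limit and the value, so a window
    to the left of [p.2] controls it. *)
Lemma graph_ge xi p l L : extended_graph xi p -> l < p.2 ->
  (forall x, l < x <= p.2 -> L <= sample_path xi x) -> L <= p.1.
Proof.
move=> [/[!in_itv]/= p01 /andP[p1 _]] lp xiL; apply: le_trans p1.
rewrite le_min xiL ?lp ?lexx// andbT.
rewrite /left_limit; apply: limr_ge.
  by apply/cvg_ex; exists (left_limit xi p.2); exact: left_limit_cvg.
near=> x; apply: xiL; apply/andP; split.
  by near: x; exact: nbhs_left_gt.
by near: x; exact: nbhs_left_le.
Unshelve. all: by end_near. Qed.

Lemma graph_le xi p l U : extended_graph xi p -> l < p.2 ->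
  (forall x, l < x <= p.2 -> sample_path xi x <= U) -> p.1 <= U.
Proof.
move=> [/[!in_itv]/= p01 /andP[_ p1]] lp xiU; apply: le_trans p1 _.
rewrite ge_max xiU ?lp ?lexx// andbT.
rewrite /left_limit; apply: limr_le.
  by apply/cvg_ex; exists (left_limit xi p.2); exact: left_limit_cvg.
near=> x; apply: xiU; apply/andP; split.
  by near: x; exact: nbhs_left_gt.
by near: x; exact: nbhs_left_le.
Unshelve. all: by end_near. Qed.

Lemma path_in_graph xi t : t \in `[0, 1] ->
  extended_graph xi (sample_path xi t, t).
Proof.
by move=> t01; split=> //=; rewrite ge_min le_max !lexx !orbT.
Qed.

(* The only property of the two metrics that is needed. *)
Definition graph_close (dist : skorokhod R -> skorokhod R -> \bar R) : Prop :=
  forall xi zeta (e : R), (dist xi zeta < e%:E)%E ->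
    `|sample_path xi 1 - sample_path zeta 1| < e /\
    forall s, s \in `[0, 1] -> exists p, [/\ extended_graph xi p,
      `|p.1 - sample_path zeta s| < e & `|p.2 - s| < e].

Lemma sup_norm01_lt (f : R -> R) (e : R) t :
  (sup_norm01 f < e%:E)%E -> t \in `[0, 1] -> `|f t| < e.
Proof.
move=> fe t01; rewrite -lte_fin; apply: le_lt_trans fe.
by apply: ereal_sup_ubound => /=; exists t.
Qed.

Lemma dist_J1_close : graph_close (@dist_J1 R).
Proof.
move=> xi zeta e /ereal_inf_lt[_ [lam [lamh [mu [lam01 mu01 [_ muK] _ _]]] <-]].
rewrite gt_max => /andP[lam_id lam_xi].
have i1 : (1 : R) \in `[0, 1] by rewrite in_itv/= ler01 lexx.
(* A nondecreasing map onto [0, 1] fixes 1: apply monotonicity to [mu 1 <= 1]. *)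
have lam1 : lam 1 = 1.
  have /[!in_itv]/= /andP[_ l1] : lam 1 \in `[0, 1] := lam01 1 i1.
  have m01 : mu 1 \in `[0, 1] := mu01 1 i1.
  apply/eqP; rewrite eq_le l1 -[leLHS](muK 1 i1) lamh//.
  by move: m01; rewrite in_itv/= => /andP[].
split=> [|s s01].
  by rewrite -[X in sample_path xi X]lam1 (sup_norm01_lt lam_xi).
exists (sample_path xi (lam s), lam s); split.
- exact/path_in_graph/lam01.
- exact: (sup_norm01_lt lam_xi).
- exact: (sup_norm01_lt lam_id).
Qed.

(** A parametrization ends at the largest point of the graph, and at time 1 the order measures the
    distance from the left limit, so this point is the far end of the segment. Hence M1' closeness
    controls the end values. *)
Lemma parametrization_end xi u r : parametrization xi u r ->
  u 1 = sample_path xi 1.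
Proof.
move=> [_ _ mono surj].
have i1 : (1 : R) \in `[0, 1] by rewrite in_itv/= ler01 lexx.
have : extended_graph xi (u 1, r 1) by rewrite -surj; exists 1.
move=> [/[!in_itv]/= /andP[_ r1] /andP[u1 u2]].
have [s s01 [us rs]] : [set (u s, r s) | s in `[0, 1]] (sample_path xi 1, 1).
  by rewrite surj; exact: path_in_graph.
have s1 : s <= 1 by move: s01; rewrite /= in_itv/= => /andP[].
case: (mono s 1 s01 i1 s1) => [[|[]]|[]]; rewrite /= ?us ?rs //.
  by rewrite ltNge r1.
move=> r11; rewrite -r11 => h.
move: h u1 u2; rewrite -r11.
set a := left_limit _ _; set b := sample_path _ _; set c := u 1.
case: (lerP a b) => ab h ca bc.
  by move: h; rewrite ler0_norm; lra.
by move: h; rewrite ger0_norm; lra.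
Qed.

Lemma dist_M1'_close : graph_close (@dist_M1' R).
Proof.
move=> xi zeta e /ereal_inf_lt[_ [u1 [r1 [u2 [r2 [p1 p2 ->]]]]]].
rewrite gt_max => /andP[ue re].
have i1 : (1 : R) \in `[0, 1] by rewrite in_itv/= ler01 lexx.
split=> [|s s01].
  rewrite -(parametrization_end p1) -(parametrization_end p2).
  exact: (sup_norm01_lt ue).
case: p1 p2 => [_ _ _ surj1] [_ _ _ surj2].
(* The point that the other parametrization reaches at this same parameter is the required
   neighbour. *)
have [x x01 [ux rx]] : [set (u2 s, r2 s) | s in `[0, 1]] (sample_path zeta s, s).
  by rewrite surj2; exact: path_in_graph.
exists (u1 x, r1 x); split; first by rewrite -surj1; exists x.
- by rewrite -ux; exact: (sup_norm01_lt ue).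
- by rewrite -[X in _ - X]rx; exact: (sup_norm01_lt re).
Qed.

(* Equivalently, inf xi <= - kappa / xi(1).  The required depth vanishes as the
   end point grows, so that a dip of order 1/n is enough for a path that ends
   above n, and the set is still closed. *)
Definition dips (kappa : R) : set (skorokhod R) :=
  [set xi | 1 <= sample_path xi 1 /\ forall e, 0 < e ->
     exists2 t, t \in `[0, 1] & sample_path xi t * sample_path xi 1 < e - kappa].

(* The set {xi : xi(t1) < - delta} is not open for M1'; the neighbourhood of t1
   makes this smaller set open. *)
Definition negative_around (t1 delta : R) : set (skorokhod R) :=
  [set xi | exists k : nat, forall s, `|s - t1| < k.+1%:R^-1 ->
     sample_path xi s <= - delta - k.+1%:R^-1].

Section close.
Variable dist : skorokhod R -> skorokhod R -> \bar R.
Hypothesis dist_close : graph_close dist.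

(** A path outside the set with end value at least 1 violates the product condition with a uniform
    margin [e], hence its whole graph lies above a level [L]. A nearby path stays above [L - h] and
    ends below [x + h], so its product can drop only by order [h]. *)
Lemma dips_closed kappa : 0 < kappa ->
  closed (dips kappa : set (metric_space dist)).
Proof.
move=> k0; rewrite -(setCK (dips kappa)); apply: open_closedC.
suff : metric_open (~` dips kappa : set (metric_space dist)) by [].
move=> xi /= /not_andP[/negP|].
  rewrite -ltNge => x1; exists (1 - sample_path xi 1); first by rewrite subr_gt0.
  move=> zeta /dist_close[+ _] [z1 _].
  rewrite ltr_norml => /andP[+ _]; lra.
move=> nx; have [x1|x1] := ltP (sample_path xi 1) 1.
  exists (1 - sample_path xi 1); first by rewrite subr_gt0.
  move=> zeta /dist_close[+ _] [z1 _].
  rewrite ltr_norml => /andP[+ _]; lra.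
move: nx => /existsNP[e0 /not_implyP[e00 /forall2NP nx]].
(* Capping [e] at [kappa] makes [L] nonpositive, so that the lower bound also holds outside [0, 1],
   where the path is 0. *)
pose e := Num.min e0 kappa.
have e_gt0 : 0 < e by rewrite lt_min e00.
have ek : e <= kappa by rewrite ge_min lexx orbT.
have xe t : t \in `[0, 1] -> e - kappa <= sample_path xi t * sample_path xi 1.
  move=> t01; case: (nx t) => // /negP; rewrite -leNgt => h.
  by apply: le_trans h; rewrite lerB// ge_min lexx.
set x := sample_path xi 1 in x1 xe *.
have x0 : 0 < x by lra.
pose L := (e - kappa) / x.
have L0 : L <= 0 by rewrite /L mulr_le0_ge0 ?invr_ge0; lra.
have Lx : L * x = e - kappa by rewrite /L mulfVK// gt_eqF.
have xiL t : L <= sample_path xi t.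
  have [/xe|/path_outside ->//] := boolP (t \in `[0, 1]).
  by rewrite -Lx ler_pM2r.
(* The change [L * h - h * x - h * h] of the product is at least - h (kappa + x + 1), hence at least
   - e / 2. *)
pose h := Num.min 1 (e / (2 * (kappa + x + 1))).
have den : 0 < 2 * (kappa + x + 1) by lra.
have h0 : 0 < h by rewrite lt_min ltr01 divr_gt0.
have h1 : h <= 1 by rewrite ge_min lexx.
have he : h * (2 * (kappa + x + 1)) <= e.
  by rewrite -ler_pdivlMr// ge_min lexx orbT.
exists h => // zeta /dist_close[xz1 near_graph] [z1 zd].
have e2 : 0 < e / 2 by rewrite divr_gt0.
have [t t01 zt] := zd _ e2.
have [p [gp pz _]] := near_graph t t01.
have p1 : L <= p.1 by apply: (graph_ge (l := p.2 - 1) gp) => [|//]; lra.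
move: pz; rewrite ltr_norml => /andP[_ pz].
move: xz1; rewrite ltr_norml -/x => /andP[xz1 _].
set z := sample_path zeta 1 in z1 zd zt xz1.
set y := sample_path zeta t in zt pz.
have yL : L - h < y by lra.
have zx : z < x + h by lra.
have Lk : - kappa <= L by nra.
have a1 : (L - h) * z <= y * z.
  by apply: ler_wpM2r; [exact: le_trans z1|exact: ltW].
have a2 : (L - h) * (x + h) <= (L - h) * z.
  by apply: ler_wnM2l; [rewrite subr_le0 (le_trans L0)// ltW|exact: ltW].
have a3 : (L - h) * (x + h) = e - kappa + L * h - h * x - h * h by rewrite -Lx; ring.
have a4 : h * h <= h by rewrite ler_piMr// ltW.
have a5 : - kappa * h <= L * h by rewrite ler_wpM2r// ltW.
nra.
Qed.

Lemma negative_around_open t1 delta : 0 < delta ->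
  open (negative_around t1 delta : set (metric_space dist)).
Proof.
move=> d0.
suff : metric_open (negative_around t1 delta : set (metric_space dist)) by [].
move=> xi [k xik].
pose rho : R := k.+1%:R^-1.
have r0 : 0 < rho by rewrite invr_gt0.
(* One index governs both the radius and the margin; the index 2 (k + 1) - 1 halves both and leaves
   the other halves to the perturbation in time and in space. *)
have E : (k.+1.*2.-1.+1)%:R^-1 = rho / 2.
  by rewrite prednK ?double_gt0// -muln2 natrM invfM mulrC.
exists (rho / 2); first by rewrite divr_gt0.
move=> zeta /dist_close[_ ng]; exists (k.+1.*2.-1) => s; rewrite E => st.
have s01 : s \in `[0, 1].
  apply: contraT => /path_outside xs0.
  have /xik : `|s - t1| < rho by lra.
  by rewrite xs0 -/rho; lra.
have [p [gp pz ps]] := ng s s01.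
have p1 : p.1 <= - delta - rho.
  apply: (graph_le (l := t1 - rho) gp).
    by move: ps st; rewrite !ltr_norml; lra.
  move=> x; move: ps st; rewrite !ltr_norml => ps st xp; apply: xik.
  by rewrite -/rho ltr_norml; lra.
by move: pz; rewrite ltr_norml; lra.
Qed.
End close.

(** A dip is a negative value before time 1, and right-continuity spreads it over an interval on its
    right. *)
Lemma dips_negative_around kappa xi : 0 < kappa -> dips kappa xi ->
  exists t1 delta, [/\ 0 < t1 < 1, 0 < delta & negative_around t1 delta xi].
Proof.
move=> k0 [x1 /(_ (kappa / 2) (divr_gt0 k0 _))[//|t t01 xt]].
have xt0 : sample_path xi t < 0 by rewrite ltNge; apply/negP => ?; nra.
have [t0 t1] : 0 <= t /\ t <= 1 by move: t01; rewrite in_itv/= => /andP.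
have tlt1 : t < 1.
  by rewrite lt_neqAle t1 andbT; apply/eqP => tE; move: xt0; rewrite tE; lra.
have right_cvg : sample_path xi x @[x --> t^'+] --> sample_path xi t.
  by case: (set_valP xi) => + _ _; apply; rewrite t0.
pose v := sample_path xi t.
have v0 : v < 0 := xt0.
have /right_cvg : nbhs v [set y | y < v / 2].
  by apply: lt_nbhsl; lra.
rewrite /at_right /within /= => /nbhs_ballP[e /= e0 eA].
pose h := Num.min e (1 - t).
have h0 : 0 < h by rewrite lt_min e0 subr_gt0.
have he : h <= e by rewrite ge_min lexx.
have ht : h <= 1 - t by rewrite ge_min lexx orbT.
pose r := Num.min (h / 2) (- v / 4).
have r0 : 0 < r by rewrite lt_min; apply/andP; split; lra.
have rh : r <= h / 2 by rewrite ge_min lexx.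
have rv : r <= - v / 4 by rewrite ge_min lexx orbT.
(* The centre is the middle of an interval starting at [t], hence in ]0, 1[. As [delta] is a quarter
   of [- v] and the margin is at most that, values below [v / 2] are low enough. *)
exists (t + h / 2), (- v / 4); split; [lra|lra|].
have [k _ /(_ k (leqnn k)) /= kr] := near_infty_natSinv_lt (PosNum r0).
have {kr} : k.+1%:R^-1 < r := kr.
set q := k.+1%:R^-1 => qr.
exists k => s; rewrite -/q ltr_norml => sk.
suff : sample_path xi s < v / 2 by lra.
apply: eA; last by lra.
by rewrite /ball /= ltr_norml; lra.
Qed.

Lemma positive_step_ge0 xi t : positive_step xi -> 0 <= sample_path xi t.
Proof.
move=> [j [z [s [z0 _ _ ->]]]]; apply: sumr_ge0 => i _.
by rewrite mulr_ge0// ltW.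
Qed.

Lemma dips_rate kappa xi : 0 < kappa -> dips kappa xi -> rate_M1' xi = +oo%E.
Proof.
move=> k0 /(dips_negative_around k0)[t [delta [_ d0 [k /(_ t)]]]].
rewrite subrr normr0 invr_gt0 ltr0n => /(_ isT) xt.
rewrite /rate_M1' ifF//; apply/asboolP => xistep.
have := positive_step_ge0 t xistep; apply/negP; rewrite -ltNge.
by rewrite (le_lt_trans xt)// subr_lt0 (lt_trans _ (_ : 0 < _))// oppr_lt0.
Qed.

End paths.

(** * Independence and Poisson random measures *)

Section measurable_sets.
Context {R : realType}.

Lemma measurable_ge (L : R) : measurable [set y : R | L <= y].
Proof.
rewrite (_ : [set y : R | L <= y] = `[L, +oo[%classic); first exact: measurable_itv.
by apply/seteqP; split=> x /=; rewrite in_itv/= andbT.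
Qed.

Lemma measurable_le (L : R) : measurable [set y : R | y <= L].
Proof.
rewrite (_ : [set y : R | y <= L] = `]-oo, L]%classic); first exact: measurable_itv.
by apply/seteqP; split=> x /=; rewrite in_itv.
Qed.

Lemma measurable_lt (L : R) : measurable [set y : R | y < L].
Proof.
rewrite (_ : [set y : R | y < L] = `]-oo, L[%classic); first exact: measurable_itv.
by apply/seteqP; split=> x /=; rewrite in_itv.
Qed.

Definition large (L : R) : set R := [set x | L <= `|x|].

Lemma measurable_large L : measurable (large L).
Proof.
rewrite (_ : large L = setT `&` Num.norm @^-1` [set y | L <= y]); last by rewrite setTI.
by apply: normr_measurable => //; exact: measurable_ge.
Qed.

End measurable_sets.

(** * Expectations of products of independent counts *)

Section independence.
Context (d : measure_display) (Omega : measurableType d) (R : realType).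
Variable P : probability Omega R.

(** Counts are values of a random measure, hence extended reals; they are natural numbers only
    almost surely. *)
Definition nat_valued (Y : Omega -> \bar R) : Prop :=
  P (~` \bigcup_k Y @^-1` [set k%:R%:E]) = 0%E.

Lemma integral_nat_valued (Y : Omega -> \bar R) (D : set Omega)
    (g : Omega -> \bar R) :
  measurable_fun setT Y -> nat_valued Y -> measurable D ->
  measurable_fun setT g -> (forall w, 0 <= g w)%E ->
  (\int[P]_(w in D) g w =
   \sum_(k <oo) \int[P]_(w in D `&` Y @^-1` [set k%:R%:E]) g w)%E.
Proof.
move=> mY Y1 mD mg g0.
have mYk k : measurable (Y @^-1` [set k%:R%:E]).
  by rewrite -[X in measurable X]setTI; exact: mY.
rewrite (ge0_negligible_integral _ _ _ _ Y1)//; last 2 first.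
- by apply: measurableC; exact: bigcupT_measurable.
- exact: measurable_funTS.
rewrite setDE setCK setI_bigcupr ge0_integral_bigcup//.
- by move=> k; exact: measurableI.
- exact: measurable_funTS.
- apply/trivIsetP => i j _ _ ij; rewrite setIACA setIid -preimage_setI.
  rewrite (_ : [set i%:R%:E] `&` _ = set0) ?preimage_set0 ?setI0//.
  apply/seteqP; split => // x [/= -> [/eqP]].
  by rewrite eqr_nat (negbTE ij).
Qed.

Section product.
Variables (J : finType) (Y : J -> Omega -> \bar R) (phi : J -> \bar R -> R).
Hypothesis mY : forall i, measurable_fun setT (Y i).
Hypothesis natY : forall i, nat_valued (Y i).
Hypothesis indepY : mutually_independent P Y.
Hypothesis mphi : forall i, measurable_fun setT (phi i).
Hypothesis phi0 : forall i y, 0 <= phi i y.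
Hypothesis phi_fin :
  forall i, (\int[P]_w (phi i (Y i w))%:E < +oo)%E.

Let mpY i : measurable_fun setT (fun w => (phi i (Y i w))%:E).
Proof. by apply/measurable_EFinP; exact: measurableT_comp. Qed.

Let mYE i E : measurable E -> measurable (Y i @^-1` E).
Proof. by move=> mE; rewrite -[X in measurable X]setTI; exact: mY. Qed.

(** The events [E] are arbitrary so that the induction on the factors goes through: on [Y j = k] the
    factor [phi j] is a constant, and the condition is absorbed by shrinking [E j]. Independence of
    events is then all that is used. *)
Let integral_seq (r : seq J) (E : J -> set (\bar R)) : uniq r ->
  (forall i, measurable (E i)) ->
  (\int[P]_(w in \bigcap_i (Y i @^-1` E i)) (\prod_(i <- r) phi i (Y i w))%:E =
   \prod_(i : J) (if i \in r then \int[P]_(w in Y i @^-1` E i) (phi i (Y i w))%:E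
                  else P (Y i @^-1` E i)))%E.
Proof.
elim: r E => [|j r IH] E.
  move=> _ mE; under eq_integral do rewrite big_nil.
  rewrite integral_cst; first by rewrite mul1e; exact: (indepY mE).
  by apply: fin_bigcap_measurable => // i _; exact: mYE.
move=> /= /andP[jr ur] mE.
have mcap F : (forall i, measurable (F i)) -> measurable (\bigcap_i (Y i @^-1` F i)).
  by move=> mF; apply: fin_bigcap_measurable => // i _; exact: mYE.
have mprod s : measurable_fun setT (fun w => (\prod_(i <- s) phi i (Y i w))%:E).
  apply/measurable_EFinP; apply: measurable_prod => i _.
  exact: measurableT_comp.
have prod0 s w : (0 <= (\prod_(i <- s) phi i (Y i w))%:E)%E.
  by rewrite lee_fin; apply: prodr_ge0.
rewrite (@integral_nat_valued (Y j))//; last exact: mcap.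
pose E' k i := if i == j then E j `&` [set k%:R%:E] else E i.
have mE' k i : measurable (E' k i).
  by rewrite /E'; case: ifP => // _; exact: measurableI.
pose c := (\prod_(i | i != j)
  (if i \in r then \int[P]_(w in Y i @^-1` E i) (phi i (Y i w))%:E
                  else P (Y i @^-1` E i)))%E.
have stepk k : (\int[P]_(w in \bigcap_i (Y i @^-1` E i) `&` Y j @^-1` [set k%:R%:E])
    (\prod_(i <- j :: r) phi i (Y i w))%:E =
    (phi j k%:R%:E)%:E * (P (Y j @^-1` (E j `&` [set k%:R%:E])) * c))%E.
  have -> : \bigcap_i (Y i @^-1` E i) `&` Y j @^-1` [set k%:R%:E] =
      \bigcap_i (Y i @^-1` E' k i).
    apply/seteqP; split=> [w [wE wk] i _|w wE].
      by rewrite /E' /=; case: eqP => [->|_]; [split => //; exact: wE|exact: wE].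
    split; last by have /(_ j I) := wE; rewrite /E' /= eqxx => -[].
    move=> i _; have /(_ i I) := wE.
    by rewrite /E' /=; case: eqP => [-> []|].
  under eq_integral => w.
    rewrite inE => /(_ j I); rewrite /E' /= eqxx => -[_ /= wk].
    rewrite big_cons wk EFinM; over.
  rewrite ge0_integralZl//; last 3 first.
  - exact: mcap.
  - exact: measurable_funTS.
  - by rewrite lee_fin.
  rewrite IH// (bigD1 j)//= (negbTE jr) /E' eqxx.
  congr (_ * (_ * _))%E; apply: eq_bigr => i ij; by rewrite (negbTE ij).
under eq_eseriesr do rewrite stepk.
rewrite [RHS](bigD1 j)//= mem_head.
have -> : (\prod_(i | i != j) (if i \in j :: r
    then \int[P]_(w in Y i @^-1` E i) (phi i (Y i w))%:E
    else P (Y i @^-1` E i)) = c)%E.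
  by apply: eq_bigr => i ij; rewrite in_cons (negbTE ij).
(* Finiteness allows [c] to be moved across the infinite series over k. *)
have cfin : c \is a fin_num.
  rewrite /c; elim/big_rec : _ => // i x ij xfin; apply: fin_numM => //.
  case: ifP => _; last by apply: fin_num_measure; exact: mYE.
  rewrite ge0_fin_numE; last by apply: integral_ge0 => w _; rewrite lee_fin.
  apply: le_lt_trans (phi_fin i); apply: ge0_subset_integral => //.
  - exact: mYE.
  - by move=> w _; rewrite lee_fin.
rewrite (@integral_nat_valued (Y j))//; last 2 first.
- exact: mYE.
- by move=> w; rewrite lee_fin.
rewrite -(fineK cfin) muleC -nneseriesZl; last first.
  by move=> k _; apply: integral_ge0 => w _; rewrite lee_fin.
apply: eq_eseriesr => k _; rewrite muleA [RHS]muleC fineK//; congr (_ * _)%E.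
rewrite preimage_setI.
under eq_integral => w do [rewrite inE => -[_ /= ->]].
rewrite integral_cst//; apply: measurableI; exact: mYE.
Qed.

Lemma integral_prod_independent :
  (\int[P]_w (\prod_i phi i (Y i w))%:E =
   \prod_i \int[P]_w (phi i (Y i w))%:E)%E.
Proof.
have := @integral_seq (index_enum J) (fun=> setT) (index_enum_uniq _) (fun=> measurableT).
rewrite (_ : \bigcap_i _ = setT); last by apply/seteqP; split.
by move=> ->; apply: eq_bigr => i _; rewrite mem_index_enum preimage_setT.
Qed.

End product.
End independence.

(** * Exponential moments of Poisson random measures *)

Section poisson.
Context (d : measure_display) (Omega : measurableType d) (R : realType).
Variable P : probability Omega R.
Local Notation plane := (measurableTypeR R * measurableTypeR R)%type.
Variable mean : set plane -> \bar R.
Variable N : R.-ker Omega ~> plane.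
Hypothesis mean0 : forall A, (0 <= mean A)%E.
Hypothesis NP : poisson_random_measure P mean N.

Let measN (A : set plane) : measurable A -> measurable_fun setT (fun w => N w A).
Proof. by move=> mA; exact: measurable_kernel. Qed.

Let measNE A E : measurable A -> measurable E ->
  measurable [set w | E (N w A)].
Proof.
by move=> mA mE; rewrite -[X in measurable X]setTI; exact: (measN mA).
Qed.

(** The usual formula also covers the Dirac mass at mean 0, thanks to 0^0 = 1. *)
Lemma poisson_prob1 (mu : R) k : 0 <= mu ->
  poisson_prob mu 0 [set k] = (mu ^+ k / k`!%:R * expR (- mu))%:E.
Proof.
rewrite le_eqVlt /poisson_prob => /predU1P[<-|mu0]; last first.
  by rewrite mu0 esum_set1 ?lee_fin ?poisson_pmf_ge0// /poisson_pmf mu0.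
rewrite ltxx diracE oppr0 expR0 mulr1; case: k => [|k].
  by rewrite mem_set// expr0 fact0 divr1.
by rewrite memNset// expr0n/= mul0r.
Qed.

Lemma prm_count A k : measurable A -> (mean A < +oo)%E ->
  P [set w | N w A = k%:R%:E] =
  ((fine (mean A)) ^+ k / k`!%:R * expR (- fine (mean A)))%:E.
Proof.
move=> mA Afin; case: NP => /(_ A mA Afin k) -> _ _.
by rewrite poisson_prob1// fine_ge0.
Qed.

Lemma prm_count0 A : measurable A -> (mean A < +oo)%E ->
  P [set w | N w A = 0%E] = (expR (- fine (mean A)))%:E.
Proof. by move=> mA /(prm_count 0 mA); rewrite expr0 fact0 divr1 mul1r. Qed.

Lemma expR_nneseries (x : R) : 0 <= x ->
  (\sum_(k <oo) (x ^+ k / k`!%:R)%:E = (expR x)%:E)%E.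
Proof.
move=> x0; rewrite expRE -EFin_lim; last first.
  rewrite /pseries/=; under eq_fun do rewrite mulrC.
  exact: is_cvg_series_exp_coeff.
apply/congr_lim/funext => n/=; rewrite /pseries/= /series/= -sumEFin//.
by under eq_bigr do rewrite mulrC.
Qed.

Lemma prm_nat_valued A : measurable A -> (mean A < +oo)%E ->
  nat_valued P (fun w => N w A).
Proof.
move=> mA Afin; rewrite /nat_valued.
have mk k : measurable ((fun w => N w A) @^-1` [set k%:R%:E]) by exact: measNE.
rewrite probability_setC; last exact: bigcupT_measurable.
have -> : P (\bigcup_k (fun w => N w A) @^-1` [set k%:R%:E]) =
    (\sum_(k <oo) P ((fun w => N w A) @^-1` [set k%:R%:E]))%E.
  apply: measure_semi_bigcup => //; last exact: bigcupT_measurable.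
  apply/trivIsetP => i j _ _ ij.
  rewrite -preimage_setI (_ : [set i%:R%:E] `&` _ = set0) ?preimage_set0//.
  apply/seteqP; split => // x [/= -> [/eqP]].
  by rewrite eqr_nat (negbTE ij).
under eq_eseriesr => k _.
  rewrite (prm_count k mA Afin) mulrC EFinM; over.
have f0 : 0 <= fine (mean A) by rewrite fine_ge0.
rewrite nneseriesZl; last first.
  by move=> k _; rewrite lee_fin divr_ge0// exprn_ge0.
by rewrite expR_nneseries// -EFinM expRN mulVf ?gt_eqF ?expR_gt0// subee.
Qed.

(** Centring removes the linear term, so the exponent is quadratic in [s] near 0. *)
Lemma prm_expR A (s : R) : measurable A -> (mean A < +oo)%E ->
  (\int[P]_w (expR (s * (fine (N w A) - fine (mean A))))%:E =
   (expR (fine (mean A) * (expR s - 1 - s)))%:E)%E.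
Proof.
move=> mA Afin; set mu := fine (mean A).
have mu0 : 0 <= mu by rewrite fine_ge0.
rewrite (integral_nat_valued (measN mA) (prm_nat_valued mA Afin))//; last first.
  apply/measurable_EFinP; apply: measurableT_comp => //.
  apply: measurable_funM => //; apply: measurable_funB => //.
  exact: measurableT_comp (measN mA).
transitivity (\sum_(k <oo) ((expR (- (s * mu) - mu))%:E *
    ((mu * expR s) ^+ k / k`!%:R)%:E))%E.
  apply: eq_eseriesr => k _; rewrite setTI.
  under eq_integral => w do [rewrite inE => /= ->; rewrite /=].
  rewrite integral_cst; last exact: measNE.
  rewrite [X in (_ * X)%E](prm_count k mA Afin) -!EFinM -/mu; congr EFin.
  rewrite mulrBr expRD mulrC [s * k%:R]mulrC expRM_natl exprMn expRB !expRN.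
  by field; rewrite ?gt_eqF ?expR_gt0 ?ltr0n ?fact_gt0.
rewrite nneseriesZl; last first.
  by move=> k _; rewrite lee_fin divr_ge0// exprn_ge0// mulr_ge0// expR_ge0.
rewrite expR_nneseries ?mulr_ge0 ?expR_ge0// -EFinM -expRD; congr (expR _)%:E.
by ring.
Qed.

(** Passing from ordinals to any finite type allows ['I_k + bool], which indexes the bins together
    with the regions of the event. *)
Lemma prm_independent (J : finType) (A : J -> set plane) :
  (forall j, measurable (A j)) -> trivIset setT A ->
  mutually_independent P (fun j w => N w (A j)).
Proof.
move=> mA tA E mE.
case: NP => _ _ /(_ #|J| (fun i => A (enum_val i))) h.
have {h} h := h (fun i => mA _) _ (fun i => E (enum_val i)) (fun i => mE _).
have tA' : trivIset setT (fun i : 'I_#|J| => A (enum_val i)).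
  apply/trivIsetP => i j _ _ ij; move/trivIsetP : tA; apply => //.
  by apply: contra ij => /eqP/enum_val_inj ->.
have {}h := h tA'; rewrite /= in h.
rewrite [RHS](reindex (enum_val : 'I_#|J| -> J))/=; last first.
  exact: (onW_bij _ (@enum_val_bij J)).
rewrite -h; congr (P _); apply/seteqP; split => w wE i _; first exact: wE.
by rewrite -(enum_rankK i); exact: wE.
Qed.

Section chernoff.
Variables (k : nat) (A : 'I_k -> set plane) (C : bool -> set plane).
Variable S : bool -> set (\bar R).
Hypotheses (mA : forall i, measurable (A i)) (mC : forall b, measurable (C b)).
Hypothesis mS : forall b, measurable (S b).
Hypotheses (A_fin : forall i, (mean (A i) < +oo)%E)
  (C_fin : forall b, (mean (C b) < +oo)%E).
Let AC (j : 'I_k + bool) := match j with inl i => A i | inr b => C b end.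
Hypothesis tAC : trivIset setT AC.

Let count (i : 'I_k) w := fine (N w (A i)) - fine (mean (A i)).
Let event := [set w | forall b, S b (N w (C b))].

Lemma measurable_count_event : measurable event.
Proof.
rewrite (_ : event = \bigcap_(b in setT) [set w | S b (N w (C b))]).
  by apply: fin_bigcap_measurable => // b _; exact: measNE.
by apply/seteqP; split=> w wS b; [move=> _|]; exact: wS.
Qed.

(* The counts of the regions C, disjoint from the A i, are carried along so that
   the bound remains proportional to the probability of the event they define. *)
Lemma prm_chernoff (x : 'I_k -> R) (u : R) :
  (P ([set w | (u <= \sum_i x i * count i w)%R] `&` event) <=
   (expR (- u + \sum_i fine (mean (A i)) * (expR (x i) - 1 - x i)))%R%:E * P event)%E.
Proof.
(* Exponentials for the bins and indicators for the regions of the event: the expectation of the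
   product then has [P event] as a factor. *)
pose phi (j : 'I_k + bool) (y : \bar R) : R :=
  match j with inl i => expR (x i * (fine y - fine (mean (A i))))
             | inr b => \1_(S b) y end.
have mAC j : measurable (AC j) by case: j => j /=.
have AC_fin j : (mean (AC j) < +oo)%E by case: j => j /=.
have mphi j : measurable_fun setT (phi j).
  case: j => [i|b] /=; last exact: measurable_indic.
  apply: measurableT_comp => //; apply: measurable_funM => //.
  by apply: measurable_funB => //; exact: fine_measurable.
have phi0 j y : 0 <= phi j y by case: j => [i|b] /=; rewrite ?expR_ge0.
have int_inl i : (\int[P]_w (phi (inl i) (N w (AC (inl i))))%:E =
    (expR (fine (mean (A i)) * (expR (x i) - 1 - x i)))%:E)%E.
  exact: prm_expR.
have int_inr b : (\int[P]_w (phi (inr b) (N w (AC (inr b))))%:E =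
    P [set w | S b (N w (C b))])%E.
  rewrite -[X in _ = P X]setIT -integral_indic//; exact: measNE.
have phi_fin j : (\int[P]_w (phi j (N w (AC j)))%:E < +oo)%E.
  case: j => [i|b]; first by rewrite int_inl ltry.
  by rewrite int_inr (le_lt_trans (probability_le1 _ _)) ?ltry//; exact: measNE.
have prodE := integral_prod_independent (fun j => measN (mAC j))
  (fun j => prm_nat_valued (mAC j) (AC_fin j)) (prm_independent mAC tAC)
  mphi phi0 phi_fin.
have mprod : measurable_fun setT (fun w => (\prod_j phi j (N w (AC j)))%:E).
  apply/measurable_EFinP; apply: measurable_prod => j _.
  exact: (measurableT_comp (mphi j) (measN (mAC j))).
have mU : measurable [set w | u <= \sum_i x i * count i w].
  rewrite -[X in measurable X]setTI; apply: measurable_fun_le => //.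
  apply: measurable_sum => i; apply: measurable_funM => //.
  by apply: measurable_funB => //; exact: measurableT_comp (measN (mA i)).
have P_event : P event = (\prod_(b : bool) P [set w | S b (N w (C b))])%E.
  have tC : trivIset setT C.
    apply/trivIsetP => b b' _ _ bb'; move/trivIsetP : tAC.
    by move=> /(_ (inr b) (inr b') Logic.I Logic.I); apply.
  have := prm_independent mC tC mS; rewrite /= => <-; congr (P _).
  by apply/seteqP; split=> w wS b; [move=> _|]; exact: wS.
(* Exponential Markov inequality: on the event the indicators are 1 and the other factors multiply
   to at least exp u. *)
apply: (@le_trans _ _ (\int[P]_w ((expR (- u))%:E * (\prod_j phi j (N w (AC j)))%R%:E))%E).
  rewrite -[X in P X]setIT -integral_indic//; last first.
    by apply: measurableI => //; exact: measurable_count_event.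
  apply: ge0_le_integral => //.
  - apply/measurable_EFinP; apply: measurable_indic.
    by apply: measurableI => //; exact: measurable_count_event.
  - exact: measurable_funeM.
  - move=> w _; rewrite -EFinM lee_fin big_sumType/= -expR_sum mulrA -expRD.
    have F0 : 0 <= expR (- u + \sum_i x i * count i w) * \prod_(b : bool) \1_(S b) (N w (C b)).
      by rewrite mulr_ge0 ?expR_ge0//; apply: prodr_ge0.
    rewrite indicE; have [|//] := boolP (w \in _).
    rewrite inE => -[/= uw wS] /=.
    rewrite [X in _ * X]big1 ?mulr1; last first.
      by move=> b _; rewrite indicE mem_set//; exact: wS.
    by rewrite -expR0 ler_expR addrC subr_ge0.
rewrite ge0_integralZl//; last by move=> w _; rewrite lee_fin; apply: prodr_ge0.
rewrite prodE big_sumType/= P_event; under eq_bigr do rewrite int_inl.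
under [X in (_ * (_ * X))%E]eq_bigr do rewrite int_inr.
rewrite prodEFin -expR_sum muleA -EFinM -expRD lexx//.
Qed.
End chernoff.

End poisson.

(** * Integrals compared with sums over bins of values *)

Section partition_sums.
Context (d : measure_display) (T : measurableType d) (R : realType).
Variable mu : {measure set T -> \bar R}.
Variables (k : nat) (F : 'I_k -> set T).
Hypotheses (mF : forall i, measurable (F i)) (tF : trivIset setT F).

Let integral_bins (g : T -> R) : measurable_fun setT g -> (forall y, 0 <= g y) ->
  (\int[mu]_(y in \bigcup_i F i) (g y)%:E =
  \sum_(i < k) \int[mu]_(y in F i) (g y)%:E)%E.
Proof.
move=> mg g0.
have -> : \bigcup_i F i = \big[setU/set0]_(i <- index_enum 'I_k) F i.
  rewrite -bigcup_seq; apply/seteqP; split=> y [i _ Fi]; exists i => //=.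
  by rewrite mem_index_enum.
rewrite ge0_integral_bigsetU//.
- exact: index_enum_uniq.
- exact: sub_trivIset tF.
- by apply/measurable_EFinP; exact: measurable_funTS.
- by move=> y _; rewrite lee_fin.
Qed.

Lemma measure_partition : mu (\bigcup_i F i) = (\sum_(i < k) mu (F i))%E.
Proof.
have mU : measurable (\bigcup_i F i) by exact: fin_bigcup_measurable.
rewrite -[LHS]mul1e -integral_cst// (_ : cst 1%E = fun=> 1%:E)//.
rewrite integral_bins//; apply: eq_bigr => i _.
by rewrite integral_cst// mul1e.
Qed.

Variable g : T -> R.
Hypotheses (mg : measurable_fun setT g) (g0 : forall y, 0 <= g y).

Lemma sum_le_integral (A : set T) (c : 'I_k -> R) : measurable A ->
  (forall i, F i `<=` A) -> (forall i, 0 <= c i) ->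
  (forall i y, F i y -> c i <= g y) ->
  (\sum_(i < k) (c i)%:E * mu (F i) <= \int[mu]_(y in A) (g y)%:E)%E.
Proof.
move=> mA FA c0 cg.
apply: (@le_trans _ _ (\int[mu]_(y in \bigcup_i F i) (g y)%:E)%E).
  rewrite integral_bins//; apply: lee_sum => i _; rewrite -integral_cst//.
  apply: ge0_le_integral => //.
  - by move=> y _; rewrite lee_fin.
  - by apply/measurable_EFinP; exact: measurable_funTS.
  - by move=> y Fy; rewrite lee_fin cg.
apply: ge0_subset_integral => //.
- by apply: fin_bigcup_measurable => //.
- by apply/measurable_EFinP; exact: measurable_funTS.
- by move=> y _; rewrite lee_fin.
- by move=> y [i _ /FA].
Qed.

Lemma integral_le_sum (A : set T) (c : 'I_k -> R) :
  A = \bigcup_i F i -> (forall i y, F i y -> g y <= c i) ->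
  (\int[mu]_(y in A) (g y)%:E <= \sum_(i < k) (c i)%:E * mu (F i))%E.
Proof.
move=> -> gc; rewrite integral_bins//; apply: lee_sum => i _.
rewrite -integral_cst//; apply: ge0_le_integral => //.
- by move=> y _; rewrite lee_fin.
- by apply/measurable_EFinP; exact: measurable_funTS.
- by move=> y Fy; rewrite lee_fin gc.
Qed.

End partition_sums.

Section bins.
Context {R : realType}.
Variables (eps h : R).
Hypotheses (eps0 : 0 <= eps) (h0 : 0 < h).

Definition bin (j : nat) : set R := `[eps + j%:R * h, eps + j.+1%:R * h[%classic.

Lemma trivIset_bin (k : nat) : trivIset setT (fun i : 'I_k => bin i).
Proof.
apply/trivIsetP => i j _ _ ij; apply/seteqP; split=> // x [].
rewrite /bin /= !in_itv/= => /andP[i1 i2] /andP[j1 j2].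
have := le_lt_trans i1 j2; rewrite ltrD2l ltr_pM2r// ltr_nat ltnS => lij.
have := le_lt_trans j1 i2; rewrite ltrD2l ltr_pM2r// ltr_nat ltnS => lji.
by move: ij; rewrite -val_eqE/= eqn_leq lij lji.
Qed.

Lemma bin_cover (k : nat) x : eps <= x < eps + k%:R * h ->
  exists i : 'I_k, bin i x.
Proof.
move=> /andP[x1 x2]; have y0 : 0 <= (x - eps) / h.
  by rewrite divr_ge0 ?subr_ge0// ltW.
have /andP[j1 j2] := truncn_itv y0; set j := Num.truncn _ in j1 j2.
have jx : eps + j%:R * h <= x by rewrite -lerBrDl -ler_pdivlMr.
have xj : x < eps + j.+1%:R * h by rewrite -ltrBlDl -ltr_pdivrMr.
have jk : (j < k)%N.
  by have := le_lt_trans jx x2; rewrite ltrD2l ltr_pM2r// ltr_nat.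
by exists (Ordinal jk); rewrite /bin /= in_itv/= jx.
Qed.

Context (d : measure_display) (T : measurableType d).
Variables (mu : {measure set T -> \bar R}) (A : set T) (f : T -> R) (k : nat).
Hypotheses (mA : measurable A) (mf : measurable_fun setT f).
Hypotheses (Af : forall y, A y -> eps <= f y < eps + k%:R * h).

Definition binned (j : nat) : set T := A `&` f @^-1` bin j.

Lemma measurable_binned j : measurable (binned j).
Proof.
apply: measurableI => //; rewrite -[X in measurable X]setTI; apply: mf => //.
exact: measurable_itv.
Qed.

Lemma trivIset_binned : trivIset setT (fun i : 'I_k => binned i).
Proof.
apply/trivIsetP => i j _ _ ij; apply/seteqP; split=> // y [[_ yi] [_ yj]].
have /trivIsetP/(_ i j Logic.I Logic.I ij) := @trivIset_bin k.
by rewrite -subset0; apply; split; [exact: yi|exact: yj].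
Qed.

Lemma binned_cover : A = \bigcup_(i : 'I_k) binned i.
Proof.
apply/seteqP; split=> [y Ay|y [i _ []//]].
by have [i yi] := bin_cover (Af Ay); exists i.
Qed.

Lemma mu_binned_fin (i : nat) : (mu A < +oo)%E -> mu (binned i) \is a fin_num.
Proof.
move=> Afin; rewrite ge0_fin_numE// (le_lt_trans _ Afin)//.
by apply: le_measure; rewrite ?inE//; [exact: measurable_binned|move=> y []].
Qed.

(** The measure is arbitrary because the same bins serve both the random measure [N w] and the Levy
    measure. *)
Lemma bin_sum_sandwich : (mu A < +oo)%E ->
  let s := (\sum_(i < k) (eps + i%:R * h) * fine (mu (binned i)))%R in
  [/\ (\int[mu]_(y in A) (f y)%:E < +oo)%E,
      s <= \int[mu]_(y in A) f y &
      \int[mu]_(y in A) f y <= s + h * fine (mu A)].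
Proof.
move=> Afin s.
(* [g] agrees with [f] on A and is nonnegative everywhere, as the comparison of integrals
   requires. *)
pose g y := Num.max 0 (f y).
have mg : measurable_fun setT g by apply: measurable_maxr.
have g0 y : 0 <= g y by rewrite le_max lexx.
have fg y : A y -> f y = g y.
  by move=> /Af /andP[+ _] => h1; rewrite /g max_r// (le_trans eps0).
have Efg : (\int[mu]_(y in A) (f y)%:E = \int[mu]_(y in A) (g y)%:E)%E.
  by apply: eq_integral => y; rewrite inE => /fg ->.
have c0 (i : 'I_k) : 0 <= eps + i%:R * h.
  by rewrite addr_ge0// mulr_ge0// ltW.
have lo : (s%:E <= \int[mu]_(y in A) (f y)%:E)%E.
  rewrite Efg; apply: (@le_trans _ _
    (\sum_(i < k) (eps + i%:R * h)%:E * mu (binned i))%E).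
    rewrite /s -sumEFin lee_sum// => i _.
    by rewrite EFinM fineK//; exact: mu_binned_fin.
  apply: sum_le_integral => //.
  - by move=> i; exact: measurable_binned.
  - exact: trivIset_binned.
  - by move=> i y [].
  - by move=> i y [Ay]; rewrite -fg// /bin /= in_itv/= => /andP[].
have hi : (\int[mu]_(y in A) (f y)%:E <= (s + h * fine (mu A))%:E)%E.
  rewrite Efg; apply: (@le_trans _ _
    (\sum_(i < k) (eps + i.+1%:R * h)%:E * mu (binned i))%E).
    apply: integral_le_sum => //.
    - by move=> i; exact: measurable_binned.
    - exact: trivIset_binned.
    - exact: binned_cover.
    - by move=> i y [Ay]; rewrite -fg// /bin /= in_itv/= => /andP[_ /ltW].
  have -> : mu A = (\sum_(i < k) fine (mu (binned i)))%:E.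
    rewrite [in LHS]binned_cover measure_partition//.
    + rewrite -sumEFin; apply: eq_bigr => i _; rewrite fineK//.
      exact: mu_binned_fin.
    + by move=> i; exact: measurable_binned.
    + exact: trivIset_binned.
  rewrite /= mulr_sumr -big_split/= -sumEFin lee_sum// => i _.
  rewrite -[X in (_ * X)%E](fineK (@mu_binned_fin i Afin)) -EFinM lee_fin.
  by rewrite -natr1 le_eqVlt; apply/orP; left; apply/eqP; ring.
have fin : ((\int[mu]_(y in A) (f y)%:E)%E \is a fin_num).
  rewrite fin_numE; apply/andP; split.
    by rewrite gt_eqF// (lt_le_trans _ lo)// ltNyr.
  by rewrite lt_eqF// (le_lt_trans hi)// ltry.
split; first by rewrite (le_lt_trans hi)// ltry.
- by rewrite -lee_fin /Rintegral fineK.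
- by rewrite -lee_fin /Rintegral fineK.
Qed.

End bins.

Lemma le_measure_set d (T : measurableType d) (R : realType)
  (mu : {measure set T -> \bar R}) (A B : set T) :
  measurable A -> measurable B -> A `<=` B -> (mu A <= mu B)%E.
Proof. by move=> mA mB AB; apply: le_measure; rewrite ?inE. Qed.

(** Counts are almost surely finite, so the events of having at least k points decrease to a null
    set. *)
Lemma prm_tail d (Omega : measurableType d) (R : realType)
    (P : probability Omega R)
    (mean : set (measurableTypeR R * measurableTypeR R) -> \bar R)
    (N : R.-ker Omega ~> (measurableTypeR R * measurableTypeR R)%type) A eta :
  (forall B, 0 <= mean B)%E -> poisson_random_measure P mean N ->
  measurable A -> (mean A < +oo)%E -> 0 < eta ->
  \forall k \near \oo, (P [set w | k%:R%:E <= N w A] <= eta%:E)%E.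
Proof.
move=> mean0 NP mA Afin eta0.
have mN : measurable_fun setT (fun w => N w A) by exact: measurable_kernel.
pose F k := [set w | (k%:R%:E <= N w A)%E].
have mF k : measurable (F k).
  rewrite -[X in measurable X]setTI.
  exact: emeasurable_fun_c_infty.
have cF : P (F k) @[k --> \oo] --> P (\bigcap_k F k).
  apply: nonincreasing_cvg_mu => //.
  - by rewrite (le_lt_trans (probability_le1 _ _)) ?ltry.
  - exact: bigcapT_measurable.
  - move=> i j ij; apply/subsetPset => w; rewrite /F /=; apply: le_trans.
    by rewrite lee_fin ler_nat.
have PF0 : P (\bigcap_k F k) = 0%E.
  apply/eqP; rewrite -measure_le0 -(prm_nat_valued mean0 NP mA Afin).
  apply: le_measure_set.
  - exact: bigcapT_measurable.
  - apply: measurableC; apply: bigcupT_measurable => k.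
    by rewrite -[X in measurable X]setTI; exact: mN.
  - move=> w Fw [k _ /= wk]; have := Fw k.+1 Logic.I.
    by rewrite /F /= wk lee_fin ler_nat ltnn.
rewrite PF0 in cF.
have /cF : nbhs (0%E : \bar R) [set y | (y <= eta%:E)%E].
  apply: (@filterS _ _ _ [set y | (y < eta%:E)%E]) => [y /ltW//|].
  apply: open_nbhs_nbhs; split; last by rewrite /= lte_fin.
  exact: open_ereal_lt_ereal.
by [].
Qed.

(** * Tails of the components of a Levy process *)

Section jump_intensity.
Context {R : realType}.
Variable nu : {sigma_finite_measure set (measurableTypeR R) -> \bar R}.

Lemma jump_intensity_ge0 A : (0 <= jump_intensity nu A)%E.
Proof. exact: measure_ge0. Qed.

Lemma jump_intensity_box (I E : set R) : measurable I -> measurable E ->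
  I `<=` `[0, +oo[ ->
  jump_intensity nu (I `*` E) = (@lebesgue_measure R I * nu E)%E.
Proof.
move=> mI mE I0; rewrite /jump_intensity -setXI setIT setIidl//.
exact: product_measure1E.
Qed.

Lemma jump_intensity_itv (t : R) (E : set R) : 0 <= t -> measurable E ->
  jump_intensity nu (`[0, t] `*` E) = (t%:E * nu E)%E.
Proof.
move=> t0 mE; rewrite jump_intensity_box//; last first.
  by move=> x /=; rewrite !in_itv/= => /andP[->].
rewrite lebesgue_measure_itv/= lte_fin; case: ltP => t0'; first by rewrite sube0.
by have -> : t = 0 by apply/eqP; rewrite eq_le t0 t0'.
Qed.

Hypothesis nu_levy : levy_measure nu.

(** It controls the variance of the jumps up to a level L >= 1, through y^2 <= L^2 min(1, y^2) for
    |y| <= L. *)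
Definition levy_mass : R := \int[nu]_x (Num.min 1 (`|x| ^+ 2)).

Let mmin : measurable_fun setT (fun x : R => Num.min 1 (`|x| ^+ 2)).
Proof.
apply: measurable_minr => //; apply: measurable_funX.
exact: normr_measurable.
Qed.

Let min0 (x : R) : 0 <= Num.min 1 (`|x| ^+ 2).
Proof. by rewrite le_min ler01 exprn_ge0. Qed.

Lemma levy_massE : (\int[nu]_x (Num.min 1 (`|x| ^+ 2))%:E = levy_mass%:E)%E.
Proof.
rewrite /levy_mass /Rintegral fineK// ge0_fin_numE; first by case: nu_levy.
by apply: integral_ge0 => x _; rewrite lee_fin.
Qed.

Lemma levy_mass_ge0 : 0 <= levy_mass.
Proof. exact: Rintegral_ge0. Qed.

(** Markov's inequality for min(1, x^2), which is at least [c] on E. *)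
Lemma levy_measure_away0 (eps : R) (E : set R) : 0 < eps -> measurable E ->
  (forall x, E x -> eps <= `|x|) -> (nu E < +oo)%E.
Proof.
move=> eps0 mE Eeps; pose c := Num.min 1 (eps ^+ 2).
have c0 : 0 < c by rewrite lt_min ltr01 exprn_gt0.
have : (c%:E * nu E <= levy_mass%:E)%E.
  rewrite -levy_massE -integral_cst//.
  apply: (@le_trans _ _ (\int[nu]_(x in E) (Num.min 1 (`|x| ^+ 2))%:E)%E).
    apply: ge0_le_integral => //.
    - by move=> x _; rewrite lee_fin ltW.
    - by apply/measurable_EFinP; exact: measurable_funTS.
    - move=> x /Eeps xe; rewrite lee_fin /c le_min !ge_min lexx/=.
      by rewrite ler_pXn2r ?xe ?orbT// nnegrE ltW// (lt_le_trans eps0).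
  by apply: ge0_subset_integral => //; exact/measurable_EFinP.
have [nuE|nuE _] := eqVneq (nu E) +oo%E; last by rewrite ltey.
by rewrite nuE gt0_muley ?lte_fin.
Qed.

End jump_intensity.

(** From exp(- x) >= 1 - x one gets exp(x) (1 - x) <= 1, while (1 + x + 2 x^2) (1 - x) = 1 + x^2 (1
    - 2 x) >= 1. *)
Lemma expR_sub1_le (R : realType) (x : R) : x <= 2^-1 ->
  expR x - 1 - x <= 2 * x ^+ 2.
Proof.
move=> x2; have y0 : 0 < 1 - x by lra.
have : expR x * (1 - x) <= 1.
  have := expR_ge1Dx (- x); rewrite expRN => h.
  by rewrite mulrC -ler_pdivlMr ?expR_gt0// div1r.
have : 1 <= (1 + x + 2 * x ^+ 2) * (1 - x).
  have x20 : 0 <= x ^+ 2 by rewrite sqr_ge0.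
  have -> : (1 + x + 2 * x ^+ 2) * (1 - x) = 1 + x ^+ 2 * (1 - 2 * x) by ring.
  by rewrite lerDl mulr_ge0//; lra.
by move=> h1 h2; have := le_trans h2 h1; rewrite ler_pM2r//; lra.
Qed.

(** [S1], [S2] are the integrals against the random measure and the Levy measure, [s1], [s2] their
    lower sums of mesh [h], and [n], [v] the total masses. The two errors have opposite signs, so
    the difference changes by at most [h * k]. This need not be small: the factor [theta] makes it
    at most 1 / 2. *)
Lemma discretization_error (R : realFieldType) (theta t h k u s1 s2 S1 S2 n v : R) :
  0 <= t -> 0 <= h -> `|theta| * (h * k) <= 2^-1 ->
  s1 <= S1 -> S1 <= s1 + h * n -> s2 <= S2 -> S2 <= s2 + h * v ->
  t * v <= k -> n <= k -> u <= theta * (S1 - t * S2) ->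
  u - 1 <= theta * (s1 - t * s2).
Proof.
move=> t0 h0 thk n1 n2 v1 v2 vk nk uS.
have d1 : S1 - t * S2 - (s1 - t * s2) <= h * k.
  have : h * n <= h * k by rewrite ler_wpM2l.
  have : t * s2 <= t * S2 by rewrite ler_wpM2l.
  lra.
have d2 : - (h * k) <= S1 - t * S2 - (s1 - t * s2).
  have : h * (t * v) <= h * k by rewrite ler_wpM2l.
  have : t * S2 <= t * (s2 + h * v) by rewrite ler_wpM2l.
  rewrite mulrDr (mulrCA t); lra.
have : theta * (S1 - t * S2 - (s1 - t * s2)) <= 2^-1.
  apply: le_trans thk; apply: le_trans (ler_norm _) _; rewrite normrM.
  by rewrite ler_wpM2l// ler_norml d2 d1.
rewrite mulrBr; lra.
Qed.

Lemma measurable_kernel_Rintegral d d' (X : measurableType d)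
    (Y : measurableType d') (R : realType) (N : R.-ker X ~> Y)
    (A : set Y) (f : Y -> R) :
  measurable A -> measurable_fun setT f ->
  measurable_fun setT (fun w => \int[N w]_(y in A) f y).
Proof.
move=> mA mf; rewrite /Rintegral.
apply: (measurableT_comp (fine_measurable _)) => //=.
have mfA : measurable_fun setT ((EFin \o f) \_ A).
  apply/(measurable_restrictT _ _).1 => //.
  by apply/measurable_EFinP; exact: measurable_funTS.
under eq_fun do rewrite integral_mkcond integralE.
apply: emeasurable_funB; apply: measurable_fun_integral_kernel => //.
- by move=> U mU; exact: measurable_kernel.
- exact: measurable_funepos.
- by move=> U mU; exact: measurable_kernel.
- exact: measurable_funeneg.
Qed.

(** * Chernoff bound for compensated sums of bounded jumps *)

Section compensated_chernoff.
Context (d : measure_display) (Omega : measurableType d) (R : realType).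
Variable P : probability Omega R.
Variable nu : {sigma_finite_measure set (measurableTypeR R) -> \bar R}.
Variable N : R.-ker Omega ~> (measurableTypeR R * measurableTypeR R)%type.
Hypothesis nu_levy : levy_measure nu.
Hypothesis NP : poisson_random_measure P (jump_intensity nu) N.

Definition sizes (eps L : R) : set R := [set x | eps <= `|x| < L].

Lemma measurable_sizes eps L : measurable (sizes eps L).
Proof.
rewrite (_ : sizes eps L = Num.norm @^-1` `[eps, L[%classic); last first.
  by apply/seteqP; split=> x; rewrite /sizes /= in_itv.
rewrite -[X in measurable X]setTI; apply: normr_measurable => //.
Qed.

Variables (t eps L : R).
Hypotheses (t0 : 0 <= t) (eps0 : 0 < eps) (epsL : eps < L) (L1 : 1 <= L).
Let A : set (measurableTypeR R * measurableTypeR R) := `[0, t] `*` sizes eps L.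

(** Absolute values keep both integrands nonnegative; without negative jumps they change nothing
    almost surely. *)
Definition compensated_sum w : R :=
  \int[N w]_(z in A) `|z.2| - t * \int[nu]_(x in sizes eps L) `|x|.

Let mA : measurable A.
Proof. by apply: measurableX => //; exact: measurable_sizes. Qed.

Lemma measurable_compensated_sum : measurable_fun setT compensated_sum.
Proof.
apply: measurable_funB => //; apply: measurable_kernel_Rintegral => //.
by apply: measurableT_comp => //; exact: normr_measurable.
Qed.

Variables (C : bool -> set (measurableTypeR R * measurableTypeR R)).
Variable S : bool -> set (\bar R).
Hypotheses (mC : forall b, measurable (C b)) (mS : forall b, measurable (S b))
  (C_fin : forall b, (jump_intensity nu (C b) < +oo)%E)
  (tC : trivIset setT C) (AC : forall b, A `&` C b = set0).

Let event := [set w | forall b, S b (N w (C b))].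

(** [prm_chernoff] is applied to the counts of the bins, with [u - 1] to pay for the discretization.
    Too many jumps for this is an event of probability at most [eta], with [eta] arbitrary. *)
Lemma compensated_chernoff (theta u : R) : `|theta| * L <= 2^-1 ->
  (P ([set w | (u <= theta * compensated_sum w)%R] `&` event) <=
   (expR (1 - u + 2 * theta ^+ 2 * t * L ^+ 2 * levy_mass nu))%:E * P event)%E.
Proof.
move=> thL.
have nuB : (nu (sizes eps L) < +oo)%E.
  by apply: (levy_measure_away0 nu_levy eps0) => [|x /andP[]//]; exact: measurable_sizes.
have A_fin : (jump_intensity nu A < +oo)%E.
  rewrite jump_intensity_itv//; last exact: measurable_sizes.
  by rewrite lte_mul_pinfty ?lee_fin.
have mevent : measurable event by exact: measurable_count_event.
have mU : measurable [set w | u <= theta * compensated_sum w].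
  rewrite -[X in measurable X]setTI; apply: measurable_fun_le => //.
  by apply: measurable_funM => //; exact: measurable_compensated_sum.
apply/lee_addgt0Pr => eta eta0.
have ji0 := @jump_intensity_ge0 R nu.
have tail := prm_tail ji0 NP mA A_fin eta0.
(* [k] is both the number of bins and a bound on the masses, so that mesh times mass is at most
   [L - eps]. *)
have [k [k0 ktail tk]] : exists k : nat, [/\ (0 < k)%N,
    (P [set w | k%:R%:E <= N w A] <= eta%:E)%E & t * fine (nu (sizes eps L)) <= k%:R].
  near \oo => k; exists k; split.
  - by near: k; exact: nbhs_infty_gt.
  - by near: k.
  - by near: k; exact: nbhs_infty_ger.
pose h := (L - eps) / k%:R.
have kR : 0 < k%:R :> R by rewrite ltr0n.
have h0 : 0 < h by rewrite divr_gt0// subr_gt0.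
have kh : eps + k%:R * h = L by rewrite /h mulrC divfK ?gt_eqF// addrC subrK.
pose x (i : nat) := eps + i%:R * h.
pose B i := binned eps h (sizes eps L) Num.norm i.
pose Ai (i : 'I_k) : set (measurableTypeR R * measurableTypeR R) := `[0, t] `*` B i.
have sizesE y : sizes eps L y -> eps <= `|y| < eps + k%:R * h by rewrite kh.
have mnorm : measurable_fun [set: R] (Num.norm : R -> R) by exact: normr_measurable.
have mB i : measurable (B i) by apply: measurable_binned => //; exact: measurable_sizes.
have mAi i : measurable (Ai i) by apply: measurableX => //; exact: mB.
have msz := measurable_sizes eps L.
have nuB_fin i : nu (B i) \is a fin_num by exact: mu_binned_fin.
have meanAi i : jump_intensity nu (Ai i) = (t * fine (nu (B i)))%:E.
  by rewrite jump_intensity_itv// EFinM fineK.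
have AiE (i : 'I_k) : Ai i = binned eps h A (fun z => `|z.2|) i.
  apply/seteqP; split=> z; rewrite /Ai /B /binned /A /=.
    by move=> [z1 [z2 z3]].
  by move=> [[z1 z2] z3].
have tAC : trivIset setT
    (fun j : 'I_k + bool => match j with inl i => Ai i | inr b => C b end).
  have AiA i : Ai i `<=` A by rewrite AiE => z [].
  apply/trivIsetP => -[i|b] [j|b'] _ _ ij.
  - have ij' : i != j by apply: contra ij => /eqP ->.
    have /trivIsetP/(_ i j Logic.I Logic.I ij') := @trivIset_binned R eps h h0
      _ _ A (fun z => `|z.2|) k.
    by rewrite !AiE.
  - by apply/seteqP; split => // z [/AiA Az Cz]; rewrite -(AC b').
  - by apply/seteqP; split => // z [Cz /AiA Az]; rewrite -(AC b).
  - by move/trivIsetP : tC; apply => //; apply: contra ij => /eqP ->.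
have Ai_fin i : (jump_intensity nu (Ai i) < +oo)%E by rewrite meanAi ltry.
have chern := prm_chernoff ji0 NP mAi mC mS Ai_fin C_fin tAC
  (fun i => theta * x i) (u - 1).
pose bad := [set w | (k%:R%:E <= N w A)%E].
have mNA : measurable_fun setT (fun w => N w A) by exact: measurable_kernel.
have mbad : measurable bad.
  by rewrite -[X in measurable X]setTI; exact: emeasurable_fun_c_infty.
pose U' := [set w | u - 1 <= \sum_(i < k) theta * x i *
  (fine (N w (Ai i)) - fine (jump_intensity nu (Ai i)))].
have mU' : measurable U'.
  rewrite -[X in measurable X]setTI; apply: measurable_fun_le => //.
  apply: measurable_sum => i; apply: measurable_funM => //.
  apply: measurable_funB => //; apply: (measurableT_comp (fine_measurable _)) => //.
  exact: measurable_kernel.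
have eps0' := ltW eps0.
have sub : [set w | u <= theta * compensated_sum w] `&` event `<=` (U' `&` event) `|` bad.
  move=> w [uw ew]; have [bw|bw] := leP k%:R%:E (N w A); first by right.
  left; split => //; rewrite /U' /=.
  have NA_fin : (N w A < +oo)%E by rewrite (lt_trans bw)// ltry.
  have [_ n1 n2] := bin_sum_sandwich eps0' h0 (mu := N w) (k := k) (f := fun z => `|z.2|)
    mA (measurableT_comp mnorm (@measurable_snd _ _ _ _)) (fun z Az => sizesE _ Az.2) NA_fin.
  have [_ v1 v2] := bin_sum_sandwich eps0' h0 (mu := nu) (k := k)
    msz mnorm sizesE nuB.
  have NAk : fine (N w A) <= k%:R.
    rewrite -lee_fin fineK; first exact: ltW.
    by rewrite ge0_fin_numE.
  have -> : \sum_(i < k) theta * x i * (fine (N w (Ai i)) - fine (jump_intensity nu (Ai i))) =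
     theta * (\sum_(i < k) x i * fine (N w (binned eps h A (fun z => `|z.2|) i)) -
       t * \sum_(i < k) x i * fine (nu (B i))).
    rewrite mulrBr !mulr_sumr -sumrB; apply: eq_bigr => i _.
    by rewrite meanAi AiE/=; ring.
  have vk : t * fine (nu (sizes eps L)) <= k%:R by [].
  have uw' : u <= theta * (\int[N w]_(z in A) `|z.2| -
    t * \int[nu]_(x in sizes eps L) `|x|) := uw.
  move: n1 n2 v1 v2 uw' vk NAk.
  set s1 := \sum_(i < k) _; set s2 := \sum_(i < k) _; set SN := Rintegral _ _ _.
  set Sv := Rintegral _ _ _; set v := fine (nu _); set NA := fine _.
  rewrite -/(x _) => n1 n2 v1 v2 uw' vk NAk.
  apply: (discretization_error t0 (ltW h0) _ n1 n2 v1 v2 vk NAk uw').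
  apply: le_trans thL; rewrite ler_wpM2l// mulrC -kh lerDr; exact: ltW.
(* On the i-th bin [x i] is at most |y| and at most L; as L >= 1, its square is at most L^2 min(1,
   y^2). *)
have sumB : \sum_(i < k) x i ^+ 2 * fine (nu (B i)) <= L ^+ 2 * levy_mass nu.
  rewrite -lee_fin -sumEFin EFinM -levy_massE//.
  have mm : measurable_fun setT (fun x : R => Num.min 1 (`|x| ^+ 2)).
    by apply: measurable_minr => //; exact: measurable_funX.
  have m0 (y : R) : 0 <= Num.min 1 (`|y| ^+ 2) by rewrite le_min ler01 exprn_ge0.
  rewrite -ge0_integralZl//; last 2 first.
  - exact/measurable_EFinP.
  - by rewrite lee_fin sqr_ge0.
  rewrite (eq_bigr (fun i : 'I_k => ((x i) ^+ 2)%:E * nu (B i))%E); last first.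
    by move=> i _; rewrite EFinM fineK.
  under eq_integral do rewrite -EFinM.
  apply: sum_le_integral => //.
  - by move=> i; exact: mB.
  - exact: trivIset_binned.
  - exact: measurable_funM.
  - by move=> y; rewrite mulr_ge0// sqr_ge0.
  - by move=> i; rewrite sqr_ge0.
  move=> i y [/andP[_ yL]]; rewrite /bin /= in_itv/= => /andP[xy _].
  have x0 : 0 <= x i by rewrite /x addr_ge0// mulr_ge0// ltW.
  have xL : x i <= L by rewrite (le_trans xy)// ltW.
  have L0 : 0 <= L := le_trans x0 xL.
  rewrite minr_pMr ?sqr_ge0// le_min mulr1 lerXn2r ?nnegrE//=.
  apply: (@le_trans _ _ (`|y| ^+ 2)); first by rewrite lerXn2r ?nnegrE.
  by rewrite ler_peMl ?sqr_ge0// expr_ge1.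
apply: (@le_trans _ _ (P ((U' `&` event) `|` bad))).
  apply: le_measure_set => //; first exact: measurableI.
  by apply: measurableU => //; exact: measurableI.
apply: (@le_trans _ _ (P (U' `&` event) + P bad)%E).
  by apply: measureU2 => //; exact: measurableI.
rewrite leeD//; apply: le_trans chern _.
rewrite lee_wpmul2r// lee_fin ler_expR opprB lerD2l.
have x0 (i : nat) : 0 <= x i by rewrite /x addr_ge0// mulr_ge0// ltW.
have xL (i : 'I_k) : x i <= L.
  by rewrite -kh lerD2l ler_pM2r// ler_nat ltnW.
apply: (@le_trans _ _ (\sum_(i < k) (2 * theta ^+ 2 * t) * (x i ^+ 2 * fine (nu (B i))))).
  apply: ler_sum => i _; rewrite meanAi/=.
  have -> : 2 * theta ^+ 2 * t * (x i ^+ 2 * fine (nu (B i))) =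
      t * fine (nu (B i)) * (2 * (theta * x i) ^+ 2) by ring.
  rewrite ler_wpM2l ?mulr_ge0 ?fine_ge0//; apply: expR_sub1_le.
  apply: le_trans thL; apply: le_trans (ler_norm _) _.
  by rewrite normrM ler_wpM2l// ger0_norm.
rewrite -mulr_sumr -[X in _ <= X]mulrA ler_wpM2l//.
by apply: mulr_ge0 => //; apply: mulr_ge0 => //; exact: sqr_ge0.
Unshelve. all: by end_near.
Qed.
End compensated_chernoff.

(* On {x m >= m^2} the centered density is at most exp(- m^2 / (2 v)) times the
   density with mean m; use this for m = u and m = - u. *)
Lemma normal_prob_tail (R : realType) (v u : R) : 0 < v -> 0 <= u ->
  (normal_prob 0 (Num.sqrt v) [set x : R | (u <= `|x|)%R] <=
   (2 * expR (- (u ^+ 2 / (2 * v))))%:E)%E.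
Proof.
move=> v0 u0; pose s := Num.sqrt v.
have s0 : s != 0 by rewrite gt_eqF// sqrtr_gt0.
have s2 : s ^+ 2 = v by rewrite sqr_sqrtr// ltW.
pose q := expR (- (u ^+ 2 / (2 * v))).
have mpdf m : measurable_fun setT (fun x => (normal_pdf m s x)%:E).
  by apply/measurable_EFinP; exact: measurable_normal_pdf.
have pdf0 m x : (0 <= (normal_pdf m s x)%:E)%E by rewrite lee_fin normal_pdf_ge0.
have tail (m : R) (E : set R) : measurable E ->
    (forall x, E x -> m ^+ 2 <= x * m) -> m ^+ 2 = u ^+ 2 ->
    (normal_prob 0 s E <= q%:E)%E.
  move=> mE Em mu; rewrite /normal_prob.
  apply: (@le_trans _ _ (\int[lebesgue_measure]_(x in E) (q%:E * (normal_pdf m s x)%:E))%E).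
    apply: ge0_le_integral => //.
    - exact: measurable_funTS (mpdf _).
    - by apply: measurable_funeM; exact: measurable_funTS (mpdf _).
    - move=> x Ex; rewrite -EFinM lee_fin !normal_pdfE// mulrCA ler_wpM2l ?normal_peak_ge0//.
      rewrite /normal_fun /q -expRD ler_expR s2 -mu.
      rewrite -mulr_natl subr0 -[- (_ / _)]mulNr -mulrDl ler_pM2r ?invr_gt0 ?mulr_gt0//.
      have := Em x Ex; nra.
  rewrite ge0_integralZl//; last 2 first.
  - exact: measurable_funTS (mpdf _).
  - by rewrite lee_fin expR_ge0.
  rewrite -[leRHS]mule1 lee_wpmul2l ?lee_fin ?expR_ge0//.
  by rewrite -(integral_normal_pdf m s); apply: ge0_subset_integral => //; exact: mpdf.
have mge := measurable_ge u; have mle := measurable_le (- u).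
apply: (@le_trans _ _ (normal_prob 0 s ([set x : R | u <= x] `|` [set x : R | x <= - u]))).
  apply: le_measure_set.
  - exact: measurable_large.
  - exact: measurableU.
  - move=> x /=; case: (ger0P x) => [x0 h|x0 h]; first by left.
    by right; rewrite lerNr.
apply: (le_trans (measureU2 (normal_prob 0 s) mge mle)).
rewrite mulrDl mul1r EFinD leeD//; [apply: (tail u)|apply: (tail (- u))] => //.
- by move=> x /= ux; rewrite expr2 ler_wpM2r.
- move=> x /= ux; nra.
- by rewrite sqrrN.
Qed.

Lemma Rintegral_normr_id d (T : measurableType d) (R : realType)
    (mu : {measure set T -> \bar R}) (A : set T) (f : T -> R) :
  measurable A -> measurable_fun setT f -> mu (A `&` [set y | f y < 0]) = 0%E ->
  \int[mu]_(y in A) f y = \int[mu]_(y in A) `|f y|.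
Proof.
move=> mA mf A0; congr fine; apply: ae_eq_integral => //.
- by apply/measurable_EFinP; exact: measurable_funTS.
- apply/measurable_EFinP; apply: measurableT_comp => //.
  exact: measurable_funTS.
exists (A `&` [set y | f y < 0]); split => //.
  apply: measurableI => //; rewrite -[X in measurable X]setTI.
  exact: (mf measurableT _ (measurable_lt 0)).
move=> y /= /not_implyP[Ay yf]; split => //=; rewrite ltNge; apply/negP => y0.
by apply: yf; rewrite ger0_norm.
Qed.

(** * Compensated small jumps *)

Section levy_tails.
Context (d : measure_display) (Omega : measurableType d) (R : realType).
Variable P : probability Omega R.
Variable nu : {sigma_finite_measure set (measurableTypeR R) -> \bar R}.
Local Notation plane := (measurableTypeR R * measurableTypeR R)%type.
Variable N : R.-ker Omega ~> plane.
Hypothesis nu_levy : levy_measure nu.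
Hypothesis nu_neg : nu [set x : R | x < 0] = 0%E.
Hypothesis NP : poisson_random_measure P (jump_intensity nu) N.

Let ji0 := @jump_intensity_ge0 R nu.

Let mneg : measurable [set x : R | x < 0] := measurable_lt 0.

Lemma prm_null_ae (A : set plane) : measurable A -> jump_intensity nu A = 0%E ->
  P (~` [set w | N w A = 0%E]) = 0%E.
Proof.
move=> mA A0; have mN : measurable [set w | N w A = 0%E].
  rewrite -[X in measurable X]setTI.
  by apply: (measurable_kernel N A mA measurableT [set 0%E]).
rewrite probability_setC//.
by rewrite (prm_count0 ji0 NP mA) A0//= oppr0 expR0 subee.
Qed.

Lemma no_negative_jumps (t : R) : 0 <= t ->
  P (~` [set w | N w (`[0, t] `*` [set x | x < 0]) = 0%E]) = 0%E.
Proof.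
move=> t0; apply: prm_null_ae; first exact: measurableX.
by rewrite jump_intensity_itv// nu_neg mule0.
Qed.

Lemma jumps_normr (t : R) (E : set R) w : 0 <= t -> measurable E ->
  N w (`[0, t] `*` [set x | x < 0]) = 0%E ->
  \int[N w]_(z in `[0, t] `*` E) z.2 = \int[N w]_(z in `[0, t] `*` E) `|z.2|.
Proof.
move=> t0 mE Nw; apply: Rintegral_normr_id.
- exact: measurableX.
- exact: measurable_snd.
have mAn : measurable (`[0, t] `*` [set x : R | x < 0] : set plane).
  exact: measurableX.
apply/eqP; rewrite -measure_le0 -Nw; apply: le_measure_set => //.
  have -> : (`[0, t] `*` E) `&` [set y : R * R | y.2 < 0] =
      `[0, t] `*` (E `&` [set x | x < 0]).
    by apply/seteqP; split=> z /= => [[[]]|[? []]].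
  by apply: measurableX => //; exact: measurableI.
by move=> z [[z1 _] z2].
Qed.

Lemma nu_normr (E : set R) : measurable E ->
  \int[nu]_(x in E) x = \int[nu]_(x in E) `|x|.
Proof.
move=> mE; apply: (@Rintegral_normr_id _ _ R nu E (fun x : R => x)) => //.
apply/eqP; rewrite -measure_le0 -nu_neg; apply: le_measure_set => //.
  exact: measurableI.
Qed.

Definition count_event (C : bool -> set plane) (S : bool -> set (\bar R)) :=
  [set w | forall b, S b (N w (C b))].

(** The regions avoid all the jumps that build the small-jump part up to time t, so an event on
    their counts factors out of its Chernoff bound. *)
Definition away_from_small_jumps (t : R) (C : bool -> set plane)
    (S : bool -> set (\bar R)) : Prop :=
  [/\ forall b, measurable (C b), forall b, measurable (S b),
      forall b, (jump_intensity nu (C b) < +oo)%E, trivIset setT C &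
      forall b, (`[0, t] `*` [set x | `|x| < 1]) `&` C b = set0].

(** Truncating at a small [e] changes [J] by 1 or more only with probability at most [eta], by
    Chebyshev. The event is fixed while [eta] tends to 0, so the factor survives. A change below 1
    costs at most 1 in the exponent, and the discretization another 1. *)
Lemma small_jumps_tail (t : R) (J : {RV P >-> R}) C S (theta u : R) : 0 <= t ->
  compensated_small_jumps nu N t J -> away_from_small_jumps t C S ->
  `|theta| <= 2^-1 ->
  (P ([set w | (u <= theta * J w)%R] `&` count_event C S) <=
   (expR (2 - u + 2 * theta ^+ 2 * t * levy_mass nu))%:E * P (count_event C S))%E.
Proof.
move=> t0 Jc [mC mS C_fin tC AC] th.
have mev : measurable (count_event C S) by exact: measurable_count_event.
apply/lee_addgt0Pr => eta eta0.
pose small (e : R) := [set x : measurableTypeR R | e <= `|x| < 1].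
pose D e w := \int[N w]_(z in `[0%R, t] `*` small e) z.2 -
                t * \int[nu]_(x in small e) x - J w.
have [e [e0 e1 De]] : exists e : R, [/\ 0 < e, e < 1 &
    (\int[P]_w ((D e w) ^+ 2)%:E <= eta%:E)%E].
  have /Jc : nbhs (0%E : \bar R) [set y | (y <= eta%:E)%E].
    apply: (@filterS _ _ _ [set y | (y < eta%:E)%E]) => [y /ltW//|].
    apply: open_nbhs_nbhs; split; last by rewrite /= lte_fin.
    exact: open_ereal_lt_ereal.
  move=> near0.
  near (0 : R)^'+ => e; exists e; split; near: e.
  - exact: nbhs_right_gt.
  - exact: nbhs_right_lt.
  - exact: near0.
have msm : measurable (small e) by exact: measurable_sizes.
have mD : measurable_fun setT (D e).
  apply: measurable_funB => //; apply: measurable_funB => //.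
  apply: measurable_kernel_Rintegral; last exact: measurable_snd.
  exact: measurableX.
pose far := [set w | 1 <= `|D e w|].
have mfar : measurable far.
  rewrite -[X in measurable X]setTI; apply: measurable_fun_le => //.
  by apply: measurableT_comp => //; exact: normr_measurable.
have Pfar : (P far <= eta%:E)%E.
  apply: le_trans De; rewrite -[X in P X]setIT -integral_indic//.
  apply: ge0_le_integral => //.
  - by apply/measurable_EFinP; exact: measurable_indic.
  - by apply/measurable_EFinP; exact: measurable_funX.
  - move=> w _; rewrite lee_fin indicE; case: (boolP (w \in far)); last by rewrite sqr_ge0.
    by rewrite inE /far/= => h; rewrite -real_normK ?num_real// expr_ge1.
pose neg := ~` [set w | N w (`[0, t] `*` [set x | x < 0]) = 0%E].
have mAn : measurable (`[0, t] `*` [set x : R | x < 0] : set plane).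
  exact: measurableX.
have mneg' : measurable neg.
  apply: measurableC; rewrite -[X in measurable X]setTI.
  by apply: (measurable_kernel N _ mAn measurableT [set 0%E]).
have Pneg : P neg = 0%E by exact: no_negative_jumps.
have AC' b : (`[0, t] `*` sizes e 1) `&` C b = set0.
  rewrite -subset0 -(AC b); apply: setSI => z [z1 /andP[_ z2]].
  by split.
have chern := @compensated_chernoff _ _ _ P nu N nu_levy NP t e 1 t0 e0 e1 (lexx _)
  C S mC mS C_fin tC AC' theta (u - 1).
rewrite mulr1 in chern; have {chern} := chern th.
set U := [set w | _ <= _ * compensated_sum _ _ _ _ _ _] => chern.
have mU : measurable U.
  rewrite -[X in measurable X]setTI; apply: measurable_fun_le => //.
  by apply: measurable_funM => //; exact: measurable_compensated_sum.
have mUJ : measurable [set w | u <= theta * J w].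
  rewrite -[X in measurable X]setTI; apply: measurable_fun_le => //.
  exact: measurable_funM.
have sub : [set w | u <= theta * J w] `&` count_event C S `<=`
    (U `&` count_event C S) `|` (far `|` neg).
  move=> w [uw ew]; have [nw|nw] := pselect (neg w); first by right; right.
  have [fw|fw] := pselect (far w); first by right; left.
  left; split => //; rewrite /U /=.
  have Dw : `|D e w| < 1 by rewrite ltNge; apply/negP.
  have -> : compensated_sum nu N t e 1 w = D e w + J w.
    rewrite /D subrK /compensated_sum; congr (_ - t * _).
      by rewrite jumps_normr//; exact: contrapT.
    by rewrite nu_normr.
  have : - (theta * D e w) <= 1.
    rewrite -mulrN; apply: (le_trans (ler_norm _)); rewrite normrM normrN.
    rewrite -[leRHS]mulr1 ler_pM// ?ltW//; lra.
  have uw' : u <= theta * J w := uw.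
  rewrite (mulrDr theta (D e w) (J w)); move: uw'.
  set x := theta * J w; set y := theta * D e w.
  by move=> uw' yy; lra.
apply: (@le_trans _ _ (P (U `&` count_event C S) + (P far + P neg))%E).
  have mUc : measurable (U `&` count_event C S) by exact: measurableI.
  have mfn : measurable (far `|` neg) by exact: measurableU.
  apply: (@le_trans _ _ (P ((U `&` count_event C S) `|` (far `|` neg)))).
    by apply: le_measure_set => //; [exact: measurableI|exact: measurableU].
  apply: (le_trans (measureU2 P mUc mfn)); rewrite leeD2l//.
  exact: measureU2.
rewrite Pneg adde0 leeD//; apply: (le_trans chern).
rewrite lee_wpmul2r// lee_fin ler_expR expr1n mulr1 lerD2r; lra.
Unshelve. all: by end_near. Qed.

End levy_tails.

(** * Gaussian part together with small jumps *)

Section gaussian_and_small_jumps.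
Context (d : measure_display) (Omega : measurableType d) (R : realType).
Variable P : probability Omega R.
Variable nu : {sigma_finite_measure set (measurableTypeR R) -> \bar R}.
Local Notation plane := (measurableTypeR R * measurableTypeR R)%type.
Variable N : R.-ker Omega ~> plane.
Hypothesis nu_levy : levy_measure nu.
Hypothesis nu_neg : nu [set x : R | x < 0] = 0%E.
Hypothesis NP : poisson_random_measure P (jump_intensity nu) N.
Variables (a : R) (B J : R -> {RV P >-> R}).
Hypothesis B_brownian : brownian_motion B.
Hypothesis BN : independent_sigma P (generated_by `[0, +oo[ B)
  (generated_by measurable (fun A w => N w A)).
Hypothesis J_small : forall t, 0 <= t -> compensated_small_jumps nu N t (J t).

Lemma count_event_generated C S : (forall b, measurable (C b)) ->
  (forall b, measurable (S b)) ->
  generated_by measurable (fun A w => N w A) (count_event N C S).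
Proof.
move=> mC mS; rewrite /generated_by; set G := [set _ | _].
have GC b : G ((fun w => N w (C b)) @^-1` S b) by exists (C b), (S b).
have mG b : (G.-sigma).-measurable
    (((fun w => N w (C b)) @^-1` S b) : set (g_sigma_algebraType G)).
  exact: sub_sigma_algebra.
suff : (G.-sigma).-measurable (count_event N C S : set (g_sigma_algebraType G)).
  by [].
have -> : count_event N C S = \bigcap_(b in setT) ((fun w => N w (C b)) @^-1` S b).
  by apply/seteqP; split=> w wS b; [move=> _|]; exact: wS.
exact: fin_bigcap_measurable.
Qed.

Lemma brownian_tail (t v : R) C S : 0 < t -> 0 <= v ->
  (forall b, measurable (C b)) -> (forall b, measurable (S b)) ->
  (P ([set w | (v <= `|B t w|)%R] `&` count_event N C S) <=
   (2 * expR (- (v ^+ 2 / (2 * t))))%:E * P (count_event N C S))%E.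
Proof.
move=> t0 v0 mC mS; case: B_brownian => B0 _ _ Bn.
pose E := [set x : R | v <= `|x|].
have mE : measurable E by exact: measurable_large.
rewrite BN; last 2 first.
- apply: sub_sigma_algebra; exists t, E; split => //.
  by rewrite /= in_itv/= andbT ltW.
- exact: count_event_generated.
rewrite lee_wpmul2r//.
(* The Gaussian law is given for increments, and [B 0 = 0] holds only almost surely. *)
pose inc w := B t w - B 0 w.
have minc : measurable_fun setT inc by exact: measurable_funB.
have m0 : measurable [set w | B 0 w != 0].
  rewrite (_ : [set _ | _] = ~` (setT `&` B 0 @^-1` [set 0])).
    by apply: measurableC; exact: (measurable_funP (B 0)).
  by rewrite setTI; apply/seteqP; split=> w /eqP.
have P0 : P [set w | B 0 w != 0] = 0%E.
  apply/negligibleP => //; apply: negligibleS B0 => w /= /eqP Bw0 h.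
  by apply: Bw0; exact: h.
have mincE : measurable [set w | E (inc w)].
  by rewrite -[X in measurable X]setTI; exact: minc.
have mBE : measurable [set w | E (B t w)].
  by rewrite -[X in measurable X]setTI; exact: (measurable_funP (B t)).
apply: (@le_trans _ _ (P ([set w | E (inc w)] `|` [set w | B 0 w != 0]))).
  apply: le_measure_set => //; first exact: measurableU.
  move=> w Ew; have [B0w|B0w] := eqVneq (B 0 w) 0; last by right.
  by left; rewrite /= /inc B0w subr0.
apply: (@le_trans _ _ (P [set w | E (inc w)] + P [set w | B 0 w != 0%R])%E).
  exact: measureU2.
rewrite P0 adde0.
rewrite Bn ?lexx//= subr0; exact: normal_prob_tail.
Qed.

(** The constant [c] is uniform in the event, whose probability may be arbitrarily small; [s]
    selects the upper or the lower tail. *)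
Lemma gaussian_small_jumps_tail (delta : R) : 0 < delta ->
  exists2 c, 0 < c & forall t, 0 < t -> forall C S,
    away_from_small_jumps nu t C S -> forall s : bool,
    (P ([set w | (delta * t <= (-1) ^+ s * (a * B t w + J t w))%R] `&`
        count_event N C S) <=
     ((expR 2 + 2) * expR (- (c * t)))%:E * P (count_event N C S))%E.
Proof.
move=> d0; have V0 := levy_mass_ge0 nu; set V := levy_mass nu in V0.
(* This makes the quadratic term 2 theta^2 t V at most half of the linear term theta (delta / 2)
   t. *)
pose theta := Num.min 2^-1 (delta / (8 * (V + 1))).
have th0 : 0 < theta by rewrite lt_min invr_gt0 ltr0n/= divr_gt0//; lra.
have th2 : theta <= 2^-1 by rewrite ge_min lexx.
have thV : theta * (8 * (V + 1)) <= delta.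
  by rewrite -ler_pdivlMr; [rewrite ge_min lexx orbT|lra].
(* As long as |B| < k t, the Gaussian part is at most delta t / 2; the + 1 covers a = 0. *)
pose k := delta / (2 * (`|a| + 1)).
have a1 : 0 < 2 * (`|a| + 1) by have := normr_ge0 a; lra.
have k0 : 0 < k by rewrite divr_gt0.
have ka : k * (2 * (`|a| + 1)) = delta by rewrite divfK// gt_eqF.
pose c := Num.min (theta * delta / 4) (k ^+ 2 / 2).
exists c; first by rewrite lt_min !divr_gt0 ?mulr_gt0 ?exprn_gt0.
move=> t t0 C S adm s.
have [mC mS C_fin tC AC] := adm.
set ev := count_event N C S.
have mev : measurable ev by exact: measurable_count_event.
pose sJ := [set w | theta * (delta / 2 * t) <= ((-1) ^+ s * theta) * J t w].
pose sB := [set w | k * t <= `|B t w|].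
have mB : measurable sB.
  rewrite -[X in measurable X]setTI; apply: measurable_fun_le => //.
  by apply: measurableT_comp => //; exact: normr_measurable.
have mJ : measurable sJ.
  rewrite -[X in measurable X]setTI; apply: measurable_fun_le => //.
  exact: measurable_funM.
have mU : measurable [set w | delta * t <= (-1) ^+ s * (a * B t w + J t w)].
  rewrite -[X in measurable X]setTI; apply: measurable_fun_le => //.
  apply: measurable_funM => //; apply: measurable_funD => //.
  exact: measurable_funM.
have PJ : (P (sJ `&` ev) <= (expR 2 * expR (- (c * t)))%:E * P ev)%E.
  apply: (le_trans (small_jumps_tail nu_levy nu_neg NP _ (ltW t0) (J_small (ltW t0)) adm _)).
    by rewrite normrM normr_sign mul1r gtr0_norm.
  rewrite lee_wpmul2r// lee_fin -expRD ler_expR.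
  have -> : ((-1) ^+ s * theta) ^+ 2 = theta ^+ 2 by rewrite exprMn sqrr_sign mul1r.
  rewrite -addrA lerD2l -/V.
  have ct : c * t <= theta * delta / 4 * t by apply: ler_wpM2r; [exact: ltW|rewrite ge_min lexx].
  suff : 2 * theta ^+ 2 * t * V <= theta * delta / 4 * t.
    have -> : theta * (delta / 2 * t) = 2 * (theta * delta / 4 * t) by field.
    move: ct; set x := theta * delta / 4 * t; set y := c * t; set z := _ * V.
    by move=> ct zx; lra.
  have -> : 2 * theta ^+ 2 * t * V = (theta * t / 4) * (8 * (theta * V)) by field.
  have -> : theta * delta / 4 * t = (theta * t / 4) * delta by ring.
  rewrite ler_wpM2l; [by []| |nra].
  by rewrite divr_ge0// mulr_ge0// ltW.
have PB : (P (sB `&` ev) <= (2 * expR (- (c * t)))%:E * P ev)%E.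
  apply: (le_trans (brownian_tail t0 _ mC mS)); first by rewrite mulr_ge0// ltW.
  rewrite lee_wpmul2r// lee_fin ler_pM2l// ler_expR lerN2.
  have -> : (k * t) ^+ 2 / (2 * t) = k ^+ 2 / 2 * t by field; rewrite gt_eqF.
  by apply: ler_wpM2r; [exact: ltW|rewrite ge_min lexx orbT].
apply: (@le_trans _ _ (P ((sJ `&` ev) `|` (sB `&` ev)))).
  apply: le_measure_set.
  - exact: measurableI.
  - by apply: measurableU; exact: measurableI.
  move=> w [/= uw ew].
  have [Bw|Bw] := leP (k * t) `|B t w|; first by right.
  left; split => //; rewrite /sJ /= [(-1) ^+ s * _]mulrC -[leRHS]mulrA.
  apply: ler_wpM2l; first exact: ltW.
  have : (-1) ^+ s * (a * B t w) <= delta / 2 * t.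
    apply: (le_trans (ler_norm _)); rewrite !normrM normr_sign mul1r.
    have -> : delta / 2 * t = (`|a| + 1) * (k * t) by rewrite -ka; field.
    apply: ler_pM => //; [lra|exact: ltW].
  move: uw; rewrite mulrDr.
  set x := (-1) ^+ s * (a * _); set y := _ * J t w; move=> uw xx.
  lra.
apply: (le_trans (measureU2 P _ _)); try exact: measurableI.
rewrite (mulrDl (expR 2)) EFinD ge0_muleDl ?lee_fin ?mulr_ge0 ?expR_ge0//.
exact: leeD.
Qed.

End gaussian_and_small_jumps.

(** * Growth of log^gamma and the lognormal-type tail *)

Section lognormal_tail.
Context {R : realType}.

Lemma ln_near_ge (y : R) : \forall x \near +oo, y <= ln x.
Proof.
near=> x.
have xy : expR y <= x by near: x; apply: nbhs_pinfty_ge; exact: num_real.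
by rewrite -[y]expRK ler_ln ?posrE ?(lt_le_trans _ xy) ?expR_gt0.
Unshelve. all: by end_near. Qed.

(** log^gamma is log^(gamma - 1) times log; beyond [Y] the first factor exceeds |K| / lam. *)
Lemma ln_le_ln_powR (K lam gamma : R) : 0 < lam -> 1 < gamma ->
  \forall x \near +oo, K * ln x <= lam * ln x `^ gamma.
Proof.
move=> lam0 g1; have g0 : 0 < gamma - 1 by rewrite subr_gt0.
pose Y := (`|K| / lam) `^ (gamma - 1)^-1.
near=> x.
have x1 : 1 <= ln x by near: x; exact: ln_near_ge.
have xY : Y <= ln x by near: x; exact: ln_near_ge.
have l0 : 0 <= ln x by exact: le_trans x1.
have -> : ln x `^ gamma = ln x `^ (gamma - 1) * ln x.
  rewrite -{3}[ln x]powRr1// -powRD ?subrK//.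
  by apply/implyP => _; rewrite gt_eqF// (lt_le_trans _ x1).
rewrite mulrA ler_wpM2r// (le_trans (ler_norm _))// -ler_pdivrMl// mulrC.
have -> : `|K| / lam = Y `^ (gamma - 1).
  by rewrite /Y -powRrM mulVf ?gt_eqF// powRr1// divr_ge0// ltW.
by rewrite ge0_ler_powR ?nnegrE ?powR_ge0// ltW.
Unshelve. all: by end_near. Qed.

Lemma ln_powR_sublinear (K c gamma : R) : 0 < c -> 0 < gamma ->
  \forall x \near +oo, K * ln x `^ gamma <= c * x.
Proof.
(* With this exponent, ln x <= x^p / p yields (ln x)^gamma <= Q sqrt(x). *)
move=> c0 g0; pose p := (2 * gamma)^-1.
have p0 : 0 < p by rewrite invr_gt0 mulr_gt0.
pose Q := p^-1 `^ gamma.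
near=> x.
have x1 : 1 <= x by near: x; apply: nbhs_pinfty_ge; exact: num_real.
have x0 : 0 < x by exact: lt_le_trans x1.
have lnx : 0 <= ln x by exact: ln_ge0.
have lp : ln x <= p^-1 * x `^ p.
  rewrite -(ler_pM2l p0) mulrA divff ?gt_eqF// mul1r -ln_powR ltW//.
  by rewrite ln_sublinear// powR_gt0.
have h1 : ln x `^ gamma <= Q * x `^ (2^-1).
  apply: (@le_trans _ _ ((p^-1 * x `^ p) `^ gamma)).
    apply: (ge0_ler_powR (ltW g0)) => //; rewrite nnegrE.
    exact: le_trans lp.
  have p1 : 0 <= p^-1 by rewrite invr_ge0 ltW.
  have -> : 2^-1 = p * gamma by rewrite /p; field; rewrite gt_eqF.
  by rewrite powRM ?powR_ge0// powRrM.
have h2 : `|K| * Q <= c * x `^ (2^-1).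
  rewrite powR12_sqrt ?(ltW x0)// -ler_pdivrMl//.
  rewrite -[leLHS]ger0_norm; last first.
    by rewrite mulr_ge0 ?invr_ge0 ?(ltW c0)// mulr_ge0// powR_ge0.
  rewrite -sqrtr_sqr ler_wsqrtr//.
have xx : x = x `^ (2^-1) * x `^ (2^-1).
  by rewrite powR12_sqrt ?(ltW x0)// -expr2 sqr_sqrtr// ltW.
apply: (@le_trans _ _ (`|K| * (Q * x `^ (2^-1)))).
  apply: (@le_trans _ _ (`|K| * ln x `^ gamma)).
    by rewrite ler_wpM2r ?powR_ge0// ler_norm.
  by rewrite ler_wpM2l.
by rewrite [in leRHS]xx !mulrA ler_wpM2r ?powR_ge0.
Unshelve. all: by end_near. Qed.

Variables (c beta lam gamma : R).
Hypotheses (c0 : 0 < c) (lam0 : 0 < lam) (g1 : 1 < gamma).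

Lemma ln_lognormal_tail (x : R) : 0 < x ->
  ln (c * x `^ beta * expR (- (lam * ln x `^ gamma))) =
  ln c + beta * ln x - lam * ln x `^ gamma.
Proof.
move=> x0; have xb : 0 < x `^ beta by rewrite powR_gt0.
by rewrite !lnM ?posrE ?mulr_gt0 ?expR_gt0// expRK ln_powR.
Qed.

(** This crude bound gives a finite mean of the large jumps and makes a jump of size 3 n^2 before
    time n unlikely. *)
Lemma lognormal_tail_le :
  \forall x \near +oo, c * x `^ beta * expR (- (lam * ln x `^ gamma)) <= x ^- 2.
Proof.
near=> x.
have x0 : 0 < x by near: x; apply: nbhs_pinfty_gt; exact: num_real.
have l1 : 1 <= ln x by near: x; exact: ln_near_ge.
rewrite -ler_ln ?posrE ?invr_gt0 ?exprn_gt0//; last first.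
  by rewrite !mulr_gt0 ?powR_gt0 ?expR_gt0.
rewrite ln_lognormal_tail// lnV ?posrE ?exprn_gt0// lnXn//.
have : (`|ln c| + beta + 2) * ln x <= lam * ln x `^ gamma.
  by near: x; exact: ln_le_ln_powR.
have : ln c <= `|ln c| * ln x.
  by rewrite (le_trans (ler_norm _))// ler_peMr.
rewrite -mulr_natl !mulrDl; set u := `|_| * _; set v := beta * _; set z := lam * _.
lra.
Unshelve. all: by end_near. Qed.

End lognormal_tail.

(** * Mean of the jumps of size at least 1 *)

Section jump_mean.
Context {R : realType}.
Variable nu : {sigma_finite_measure set (measurableTypeR R) -> \bar R}.
Hypothesis nu_levy : levy_measure nu.
Hypothesis nu_neg : nu [set x : R | x < 0] = 0%E.
Hypothesis nu_tail_le :
  \forall x \near +oo, (nu [set y : R | (x <= y)%R] <= (x ^- 2)%:E)%E.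
Hypothesis nu_tail_gt0 :
  \forall x \near +oo, (0 < nu [set y : R | (x <= y)%R])%E.

Let mneg : measurable [set x : R | x < 0] := measurable_lt 0.

Lemma nu_large_le : \forall x \near +oo, (nu (large x) <= (x ^- 2)%:E)%E.
Proof.
near=> x.
apply: (@le_trans _ _ (nu [set y : R | (x <= y)%R] + nu [set y : R | (y < 0)%R])%E).
  apply: (@le_trans _ _ (nu ([set y : R | x <= y] `|` [set y : R | y < 0]))).
    apply: le_measure_set.
    - exact: measurable_large.
    - by apply: measurableU => //; exact: measurable_ge.
    - move=> y; rewrite /large /=; case: (ger0P y) => [y0 h|]; first by left.
      by right.
  by apply: measureU2 => //; exact: measurable_ge.
by rewrite nu_neg adde0; near: x.
Unshelve. all: by end_near. Qed.

Let mnorm (D : set R) : measurable_fun D (fun x : R => (`|x|%:E : \bar R)).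
Proof. by apply/measurable_EFinP; exact: normr_measurable. Qed.

Let norm0 (x : R) : (0 <= (`|x|%:E : \bar R))%E.
Proof. by rewrite lee_fin. Qed.

Lemma dyadic_floor (M x : R) : 1 <= M -> M <= x ->
  exists k : nat, 2 ^+ k * M <= x < 2 ^+ k.+1 * M.
Proof.
move=> M1 Mx.
have ex : exists k : nat, x < 2 ^+ k.+1 * M.
  exists (Num.truncn x); apply: (@lt_le_trans _ _ (Num.truncn x).+1%:R).
    exact: truncnS_gt.
  apply: (@le_trans _ _ (2 ^+ (Num.truncn x).+1)).
    by rewrite -natrX ler_nat ltnW// ltn_expl.
  by rewrite ler_peMr// exprn_ge0.
exists (ex_minn ex); case: ex_minnP => -[|k] xk kmin; rewrite xk andbT.
  by rewrite expr0 mul1r.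
by rewrite leNgt; apply/negP => /kmin; rewrite ltnn.
Qed.

(* |x| <= M + sum_k 2^(k+1) M 1{|x| >= 2^k M}. *)
Lemma mean_large_fin : (\int[nu]_(x in large 1) (`|x|)%:E < +oo)%E.
Proof.
have [M [M1 tail]] : exists M : R, 1 <= M /\
    forall x, M <= x -> (nu (large x) <= (x ^- 2)%:E)%E.
  have [M [_ tail]] := nu_large_le; exists (Num.max 1 (M + 1)); split.
    by rewrite le_max lexx.
  by move=> x; rewrite ge_max => /andP[_ Mx]; apply: tail; lra.
have M0 : 0 < M by lra.
have nu1 : (nu (large 1) < +oo)%E.
  by apply: (levy_measure_away0 nu_levy ltr01) => //; exact: measurable_large.
pose f k (x : R) : \bar R := (2 ^+ k.+1 * M * \1_(large (2 ^+ k * M)) x)%:E.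
have f0 k x : (0 <= f k x)%E.
  by rewrite lee_fin mulr_ge0// mulr_ge0// ?ltW// exprn_gt0.
have mf k D : measurable_fun D (f k).
  apply/measurable_EFinP; apply: measurable_funM => //; apply: measurable_indic.
  exact: measurable_large.
have mS D : measurable D -> measurable_fun D (fun x => \sum_(k <oo) f k x)%E.
  by move=> mD; apply: ge0_emeasurable_sum.
have S0 x : (0 <= \sum_(k <oo) f k x)%E by exact: nneseries_ge0.
apply: (@le_lt_trans _ _ (\int[nu]_(x in large 1) (M%:E + \sum_(k <oo) f k x))%E).
  apply: ge0_le_integral => //; first exact: measurable_large.
  - exact: mnorm.
  - apply: emeasurable_funD => //; apply: mS; exact: measurable_large.
  - move=> x _; have [Mx|xM] := leP M `|x|; last first.
      by rewrite -[leLHS]adde0 leeD// lee_fin ltW.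
    have [k /andP[kx xk]] := dyadic_floor M1 Mx.
    rewrite (nneseriesD1 (n := k))// addeCA.
    apply: (@le_trans _ _ (f k x)).
      by rewrite /f lee_fin indicE mem_set// mulr1 ltW.
    rewrite leeDl// adde_ge0//; first by rewrite lee_fin ltW.
    by apply: nneseries_ge0.
rewrite ge0_integralD//; last 3 first.
- exact: measurable_large.
- by move=> x _; rewrite lee_fin ltW.
- by apply: mS; exact: measurable_large.
rewrite integral_cst; last exact: measurable_large.
rewrite lte_add_pinfty//.
  by rewrite lte_mul_pinfty// lee_fin ltW.
rewrite integral_nneseries//; [|exact: measurable_large|by move=> k; exact: mf].
(* The k-th term is at most 2^(k+1) M (2^k M)^(-2) = (4 / M) / 2^(k+1). *)
apply: (@le_lt_trans _ _ (\sum_(k <oo) (4 / M / (2 ^ k.+1)%:R)%:E)%E); last first.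
  apply: (le_lt_trans (epsilon_trick0 xpredT _)); last exact: ltry.
  by rewrite divr_ge0// ltW.
apply: lee_nneseries => [k _ _|k _]; first exact: integral_ge0.
have mk := measurable_large (2 ^+ k * M).
rewrite /f; under eq_integral do rewrite EFinM.
rewrite ge0_integralZl_EFin//; last 3 first.
- exact: measurable_large.
- exact/measurable_EFinP/measurable_indic.
- by rewrite mulr_ge0 ?exprn_ge0// ltW.
rewrite integral_indic//; last exact: measurable_large.
have k1 : M <= 2 ^+ k * M by rewrite ler_peMl ?(ltW M0)// exprn_ege1// ler1n.
apply: (@le_trans _ _ ((2 ^+ k.+1 * M)%:E * ((2 ^+ k * M) ^- 2)%:E)%E).
  rewrite lee_wpmul2l ?lee_fin ?mulr_ge0 ?exprn_ge0 ?(ltW M0)//.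
  apply: le_trans (tail _ k1); apply: le_measure_set => //.
  by apply: measurableI => //; exact: measurable_large.
rewrite -EFinM lee_fin natrX exprS le_eqVlt; apply/orP; left; apply/eqP.
by field; rewrite !gt_eqF ?exprn_gt0.
Unshelve. all: by end_near. Qed.

Definition jump_mean : R := \int[nu]_(x in [set x : R | 1 <= `|x|]) x.

Lemma jump_meanE : jump_mean%:E = (\int[nu]_(x in large 1) (`|x|)%:E)%E.
Proof.
rewrite /jump_mean (nu_normr nu_neg) ?/Rintegral ?fineK//.
- rewrite ge0_fin_numE; first exact: mean_large_fin.
  exact: integral_ge0.
- exact: measurable_large.
Qed.

(** Positivity makes the dip possible: in the absence of large jumps the compensator pulls the
    centred process down at this rate. *)
Lemma jump_mean_gt0 : 0 < jump_mean.
Proof.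
near (pinfty_nbhs R) => x.
have x1 : 1 <= x by near: x; apply: nbhs_pinfty_ge; exact: num_real.
rewrite -lte_fin jump_meanE.
apply: (@lt_le_trans _ _ (x%:E * nu [set y : R | (x <= y)%R])%E).
  by apply: mule_gt0; [rewrite lte_fin; lra|near: x].
have mx := measurable_ge x.
rewrite -integral_cst//.
apply: (@le_trans _ _ (\int[nu]_(y in [set y : R | (x <= y)%R]) (`|y|)%:E)%E).
  apply: ge0_le_integral => //.
  - by move=> y _; rewrite lee_fin; lra.
  - exact: mnorm.
  - by move=> y /= xy; rewrite lee_fin (le_trans xy)// ler_norm.
apply: ge0_subset_integral => //; [exact: measurable_large|exact: mnorm|].
by move=> y /= xy; rewrite /large/= (le_trans x1)// (le_trans xy)// ler_norm.
Unshelve. all: by end_near. Qed.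

(** Monotone convergence in the level; the Chernoff bound applies only to bounded jumps. *)
Lemma truncated_mean (delta : R) : 0 < delta -> exists2 L : R, 1 < L &
  jump_mean - \int[nu]_(x in sizes 1 L) `|x| <= delta.
Proof.
move=> d0.
have msz (i : nat) : measurable (sizes 1 i%:R : set R) by exact: measurable_sizes.
have E : \bigcup_i sizes 1 i%:R = large (1 : R).
  apply/seteqP; split=> x; rewrite /sizes /large /=; first by move=> [i _ /andP[]].
  move=> x1; exists (Num.truncn `|x|).+1 => //=; rewrite x1/=.
  exact: truncnS_gt.
have cv : (\int[nu]_(x in sizes 1 i%:R) (`|x|)%:E)%E @[i --> \oo] --> jump_mean%:E.
  rewrite jump_meanE -E; apply: ge0_nondecreasing_set_cvg_integral => //; last by move=> i; exact: mnorm.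
  move=> i j ij; apply/subsetPset => x.
  rewrite /sizes /= => /andP[-> xi]/=; apply: (lt_le_trans xi).
  by rewrite ler_nat.
have /cv : nbhs (jump_mean%:E : \bar R) [set y | ((jump_mean - delta)%:E < y)%E].
  apply: open_nbhs_nbhs; split; last by rewrite /= lte_fin ltrBlDr ltrDl.
  exact: open_ereal_gt_ereal.
move=> cv'; near \oo => k; exists k%:R.
  by near: k; exact: nbhs_infty_gtr.
have szL : sizes 1 k%:R `<=` large (1 : R) by move=> x /andP[].
have fink : (\int[nu]_(x in sizes 1 k%:R) (`|x|)%:E)%E \is a fin_num.
  rewrite ge0_fin_numE; last exact: integral_ge0.
  apply: (le_lt_trans _ mean_large_fin); apply: ge0_subset_integral => //.
  - exact: measurable_sizes.
  - exact: measurable_large.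
  - exact: mnorm.
rewrite lerBlDr addrC -lerBlDr -lee_fin /Rintegral fineK//; apply: ltW.
by near: k.
Unshelve. all: by end_near. Qed.

End jump_mean.

(** * Sum of the large jumps *)

Section large_jumps.
Context (d : measure_display) (Omega : measurableType d) (R : realType).
Variable P : probability Omega R.
Variable nu : {sigma_finite_measure set (measurableTypeR R) -> \bar R}.
Local Notation plane := (measurableTypeR R * measurableTypeR R)%type.
Variable N : R.-ker Omega ~> plane.
Hypothesis nu_levy : levy_measure nu.
Hypothesis nu_neg : nu [set x : R | x < 0] = 0%E.
Hypothesis nu_tail_le :
  \forall x \near +oo, (nu [set y : R | (x <= y)%R] <= (x ^- 2)%:E)%E.
Hypothesis NP : poisson_random_measure P (jump_intensity nu) N.

Let ji0 := @jump_intensity_ge0 R nu.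

Definition jump_box (t L : R) : set plane := `[0, t] `*` large L.

Definition large_jumps (t : R) (w : Omega) : R :=
  \int[N w]_(z in jump_box t 1) z.2.

Lemma measurable_jump_box t L : measurable (jump_box t L).
Proof. by apply: measurableX => //; exact: measurable_large. Qed.

Lemma measurable_large_jumps t : measurable_fun setT (large_jumps t).
Proof.
apply: measurable_kernel_Rintegral; last exact: measurable_snd.
exact: measurable_jump_box.
Qed.

Let mN A : measurable A -> measurable_fun setT (fun w => N w A).
Proof. by move=> mA; exact: measurable_kernel. Qed.

Let mNE A E : measurable A -> measurable E -> measurable [set w | E (N w A)].
Proof. by move=> mA mE; rewrite -[X in measurable X]setTI; exact: mN. Qed.

Let mnorm2 (D : set plane) : measurable_fun D (fun z : plane => (`|z.2|%:E : \bar R)).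
Proof.
apply: measurable_funTS; apply/measurable_EFinP.
apply: measurableT_comp; first exact: normr_measurable.
exact: measurable_snd.
Qed.

Lemma prm_neq0_le (A : set plane) : measurable A -> (jump_intensity nu A < +oo)%E ->
  (P (~` [set w | N w A = 0%E]) <= jump_intensity nu A)%E.
Proof.
move=> mA Afin; rewrite probability_setC; last exact: (mNE (E := [set 0%E])).
rewrite (prm_count0 ji0 NP mA Afin) -[leRHS]fineK ?ge0_fin_numE// -EFinB lee_fin.
by rewrite lerBlDr -lerBlDl -[leLHS]/(1 - _) expR_ge1Dx.
Qed.

Lemma prm_infty A : measurable A -> (jump_intensity nu A < +oo)%E ->
  P [set w | N w A = +oo%E] = 0%E.
Proof.
move=> mA Afin; apply/eqP; rewrite -measure_le0.
rewrite -(prm_nat_valued ji0 NP mA Afin); apply: le_measure_set.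
- exact: (mNE (E := [set +oo%E])).
- apply: measurableC; apply: bigcupT_measurable => k.
  exact: (mNE (E := [set k%:R%:E])).
- by move=> w /= Nw [k _ /=]; rewrite Nw.
Qed.

Lemma jump_box_fin t L : 0 <= t -> 0 < L -> (jump_intensity nu (jump_box t L) < +oo)%E.
Proof.
move=> t0 L0; rewrite jump_intensity_itv//; last exact: measurable_large.
rewrite lte_mul_pinfty ?lee_fin//.
by apply: (levy_measure_away0 nu_levy L0) => //; exact: measurable_large.
Qed.

Definition large_jumps_abs t w : \bar R := (\int[N w]_(z in jump_box t 1) (`|z.2|)%:E)%E.

Lemma measurable_large_jumps_abs t : measurable_fun setT (large_jumps_abs t).
Proof.
rewrite /large_jumps_abs; under eq_fun do rewrite integral_mkcond.
apply: measurable_fun_integral_kernel.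
- by move=> U mU; exact: measurable_kernel.
- by move=> y; rewrite erestrict_ge0// => z _; rewrite lee_fin.
- by apply/(measurable_restrictT _ _).1 => //; exact: measurable_jump_box.
Qed.

Let minfty t : measurable [set w | large_jumps_abs t w = +oo%E].
Proof.
rewrite -[X in measurable X]setTI.
exact: (measurable_large_jumps_abs t measurableT (emeasurable_set1 +oo%E)).
Qed.

(** For large L, no jump reaches L with probability at least 1 - t / L^2, and then the sum is at
    most L times the almost surely finite number of jumps. *)
Lemma large_jumps_abs_fin t : 0 <= t -> P [set w | large_jumps_abs t w = +oo%E] = 0%E.
Proof.
move=> t0; apply/eqP; rewrite -measure_le0; apply/lee_addgt0Pr => eta eta0.
rewrite add0e; near (pinfty_nbhs R) => L.
have L1 : 1 <= L by near: L; apply: nbhs_pinfty_ge; exact: num_real.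
have L0 : 0 < L by lra.
have nuL : (nu (large L) <= (L ^- 2)%:E)%E by near: L; exact: nu_large_le.
have tL : t / eta <= L by near: L; apply: nbhs_pinfty_ge; exact: num_real.
pose bad := ~` [set w | N w (jump_box t L) = 0%E].
pose inf := [set w | N w (jump_box t 1) = +oo%E].
have mb1 := measurable_jump_box t 1; have mbL := measurable_jump_box t L.
have mbad : measurable bad.
  by apply: measurableC; exact: (mNE (E := [set 0%E])).
have minf : measurable inf by exact: (mNE (E := [set +oo%E])).
apply: (@le_trans _ _ (P (bad `|` inf))).
  apply: le_measure_set.
  - exact: minfty.
  - exact: measurableU.
  - move=> w; rewrite /= => Sw.
    have [Nw0|//] := pselect (N w (jump_box t L) = 0%E); last by left.
    have [//|Nw1] := pselect (N w (jump_box t 1) = +oo%E); first by right.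
    exfalso; move: Sw; apply/eqP; rewrite lt_eqF//.
    rewrite /large_jumps_abs (ge0_negligible_integral mbL)//.
    have mD : measurable (jump_box t 1 `\` jump_box t L) by exact: measurableD.
    apply: (@le_lt_trans _ _ (\int[N w]_(z in jump_box t 1 `\` jump_box t L) L%:E)%E).
      apply: ge0_le_integral => //.
      move=> z [[z1 z2] z3]; rewrite lee_fin leNgt; apply/negP => Lz.
      by apply: z3; split => //; exact: ltW.
    rewrite integral_cst// lte_mul_pinfty ?lee_fin ?(ltW L0)//.
    apply: (@le_lt_trans _ _ (N w (jump_box t 1))).
      by apply: le_measure_set => //; exact: subDsetl.
    by rewrite ltey; apply/eqP.
apply: (@le_trans _ _ (P bad + P inf)%E); first exact: measureU2.
rewrite [X in (_ + X)%E]prm_infty ?adde0//; last by apply: jump_box_fin; lra.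
apply: (le_trans (prm_neq0_le mbL (jump_box_fin t0 L0))).
rewrite jump_intensity_itv//; last exact: measurable_large.
apply: (@le_trans _ _ (t%:E * (L ^- 2)%:E)%E); first by rewrite lee_wpmul2l ?lee_fin.
rewrite -EFinM lee_fin ler_pdivrMr ?exprn_gt0//.
have : t <= eta * L by rewrite -ler_pdivrMl// mulrC.
move=> h; apply: (le_trans h); rewrite ler_pM2l// expr2 ler_peMl//; lra.
Unshelve. all: by end_near. Qed.

(* A null set.  Outside it, [large_jumps] really is the sum of the jumps, all
   nonnegative, and not the junk value 0 of a divergent [Rintegral]. *)
Definition irregular t : set Omega :=
  [set w | large_jumps_abs t w = +oo%E] `|`
  ~` [set w | N w (`[0, t] `*` [set x | x < 0]) = 0%E].

Let mneg : measurable [set x : R | x < 0] := measurable_lt 0.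

Lemma measurable_irregular t : measurable (irregular t).
Proof.
apply: measurableU.
  exact: minfty.
apply: measurableC; apply: (mNE (E := [set 0%E])) => //.
exact: measurableX.
Qed.

Lemma irregular_null t : 0 <= t -> P (irregular t) = 0%E.
Proof.
move=> t0; apply/eqP; rewrite -measure_le0.
apply: (@le_trans _ _ (P [set w | large_jumps_abs t w = +oo%E] +
  P (~` [set w | N w (`[0%R, t] `*` [set x | (x < 0)%R]) = 0%E]))%E).
  apply: measureU2.
    exact: minfty.
  apply: measurableC; apply: (mNE (E := [set 0%E])) => //.
  exact: measurableX.
by rewrite large_jumps_abs_fin// (no_negative_jumps nu_neg NP t0) adde0.
Qed.

Lemma large_jumpsE t w : 0 <= t -> ~ irregular t w ->
  (large_jumps t w)%:E = large_jumps_abs t w.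
Proof.
move=> t0 /not_orP[/= Sfin /contrapT Nneg].
rewrite /large_jumps jumps_normr//; last exact: measurable_large.
rewrite /Rintegral fineK// ge0_fin_numE; first by rewrite ltey; apply/eqP.
by apply: integral_ge0 => z _; rewrite lee_fin.
Qed.

Lemma large_jumps_ge_truncated t L w : 0 <= t -> ~ irregular t w ->
  \int[N w]_(z in `[0, t] `*` sizes 1 L) `|z.2| <= large_jumps t w.
Proof.
move=> t0 rw; rewrite -lee_fin large_jumpsE//.
have Sfin : (large_jumps_abs t w < +oo)%E by rewrite -large_jumpsE// ltry.
have le : (\int[N w]_(z in `[0%R, t] `*` sizes 1 L) (`|z.2|)%:E <= large_jumps_abs t w)%E.
  apply: ge0_subset_integral => //.
  - by apply: measurableX => //; exact: measurable_sizes.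
  - exact: measurable_jump_box.
  - by move=> z [z1 /andP[z2 _]].
rewrite /Rintegral fineK// ge0_fin_numE; first exact: le_lt_trans Sfin.
by apply: integral_ge0 => z _; rewrite lee_fin.
Qed.

Lemma large_jumps_ge_jump (t x : R) (I : set R) w : 0 <= t -> 1 <= x ->
  measurable I -> I `<=` `[0, t] -> ~ irregular t w ->
  (1 <= N w (I `*` [set y | (x <= y)%R]))%E -> x <= large_jumps t w.
Proof.
move=> t0 x1 mI It rw Nw; rewrite -lee_fin large_jumpsE//.
have mB : measurable (I `*` [set y : R | x <= y] : set plane).
  by apply: measurableX => //; exact: measurable_ge.
apply: (@le_trans _ _ (x%:E * N w (I `*` [set y | (x <= y)%R]))%E).
  rewrite -[leLHS]mule1 lee_wpmul2l// lee_fin; lra.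
rewrite -integral_cst//.
apply: (@le_trans _ _ (\int[N w]_(z in I `*` [set y | (x <= y)%R]) (`|z.2|)%:E)%E).
  apply: ge0_le_integral => //.
  - by move=> z _; rewrite lee_fin; lra.
  - by move=> z [_ /= xz]; rewrite lee_fin (le_trans xz)// ler_norm.
apply: ge0_subset_integral => //; first exact: measurable_jump_box.
move=> z [/It z1 /= xz]; split => //; rewrite /large /=.
by rewrite (le_trans x1)// (le_trans xz)// ler_norm.
Qed.

End large_jumps.

(** By exp(2 K) >= 2 K. The time 2 K / c is the one at which the dip is sought. *)
Lemma expR_small (R : realType) (K c : R) : 0 < K -> 0 < c ->
  K * expR (- (c * (2 * K / c))) <= 2^-1.
Proof.
move=> K0 c0; rewrite expRN -lef_pV2 ?posrE ?invr_gt0//; last first.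
  by rewrite mulr_gt0 ?invr_gt0 ?expR_gt0.
rewrite invrK invfM invrK.
have -> : c * (2 * K / c) = 2 * K by rewrite mulrC divfK// gt_eqF.
rewrite mulrC ler_pdivlMr//; apply: le_trans (expR_ge1Dx _).
by rewrite lerDr.
Qed.

(** [e] is the probability of the calm-then-jump event. The half of it lost to deviations at time T
    moves to the left, which turns 1 / 2 into 1 / 4. *)
Lemma half_absorb (R : realFieldType) (q v e g r : R) :
  q * (1 / 2 * v) <= e -> e <= g + 2^-1 * e + r -> q / 4 * v <= g + r.
Proof. lra. Qed.

(** For a tail mass [v], the chance of a jump between T and n is 1 - exp(- y) with
    [y = (n - T) * v]. By [expR_sub1_le] it is at least y - 2 y^2, and v <= y <= 1 / 9. *)
Lemma half_le_oneB_expRN (R : realType) (T n v : R) : 0 < T -> T + 1 <= n ->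
  0 <= v -> v <= (3 * n ^+ 2) ^- 2 -> 1 / 2 * v <= 1 - expR (- ((n - T) * v)).
Proof.
move=> T0 nT v0; rewrite -[_ ^- 2]div1r ler_pdivlMr; last first.
  by rewrite !exprn_gt0// mulr_gt0// exprn_gt0//; lra.
move=> vx.
have n1 : 1 <= n by lra.
have n2 : n <= n ^+ 2 by rewrite expr2 ler_peMl//; lra.
have n4 : n ^+ 2 <= (n ^+ 2) ^+ 2.
  by rewrite [leRHS]expr2 ler_peMl//; [exact: sqr_ge0|exact: le_trans n2].
have vn : 9 * (v * n) <= 1.
  apply: le_trans vx; have -> : v * (3 * n ^+ 2) ^+ 2 = 9 * (v * (n ^+ 2) ^+ 2).
    by ring.
  by rewrite ler_pM2l// ler_wpM2l// (le_trans n2).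
pose y := (n - T) * v.
have y1 : v <= y by rewrite /y ler_peMl//; lra.
have y9 : y <= v * n by rewrite /y mulrC ler_wpM2l//; lra.
have hy : - y <= 2^-1 by lra.
have := expR_sub1_le hy; rewrite sqrrN -/y; nra.
Qed.

(** * Lower tail of the centred process, and the dip *)

Section levy_tail.
Context (d : measure_display) (Omega : measurableType d) (R : realType).
Variable P : probability Omega R.
Variable nu : {sigma_finite_measure set (measurableTypeR R) -> \bar R}.
Local Notation plane := (measurableTypeR R * measurableTypeR R)%type.
Variable N : R.-ker Omega ~> plane.
Hypothesis nu_levy : levy_measure nu.
Hypothesis nu_neg : nu [set x : R | x < 0] = 0%E.
Hypothesis nu_tail_le :
  \forall x \near +oo, (nu [set y : R | (x <= y)%R] <= (x ^- 2)%:E)%E.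
Hypothesis nu_tail_gt0 :
  \forall x \near +oo, (0 < nu [set y : R | (x <= y)%R])%E.
Hypothesis NP : poisson_random_measure P (jump_intensity nu) N.
Variables (a b : R) (B J X : R -> {RV P >-> R}).
Hypothesis B_brownian : brownian_motion B.
Hypothesis BN : independent_sigma P (generated_by `[0, +oo[ B)
  (generated_by measurable (fun A w => N w A)).
Hypothesis J_small : forall t, 0 <= t -> compensated_small_jumps nu N t (J t).
Hypothesis X_ito : forall t, 0 <= t -> {ae P, forall w,
  X t w = b * t + a * B t w + J t w +
    \int[N w]_(z in `[0, t] `*` [set x | 1 <= `|x|]) z.2}.

Let ji0 := @jump_intensity_ge0 R nu.
Let m := jump_mean nu.

(** A sure event, which specializes the bounds carrying an event to unconditional ones. *)
Let Cnone : bool -> set plane := fun=> set0.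
Let Sall : bool -> set (\bar R) := fun=> setT.

Let away_none t : away_from_small_jumps nu t Cnone Sall.
Proof.
split.
- by move=> b'; exact: measurable0.
- by move=> b'; exact: measurableT.
- by move=> b'; rewrite /Cnone /jump_intensity set0I measure0.
- by apply/trivIsetP => b1 b2 _ _ _; rewrite /Cnone setI0.
- by move=> b'; rewrite /Cnone setI0.
Qed.

Let eventT : count_event N Cnone Sall = setT.
Proof. by apply/seteqP; split. Qed.

Definition centered t w := X t w - b * t - t * m.

Let mcentered t : measurable_fun setT (centered t).
Proof. by apply: measurable_funB => //; exact: measurable_funB. Qed.

(* Truncating the jumps at a level L only lowers their sum, and makes Chernoff's
   bound available. *)
Lemma large_jumps_lower_tail (delta : R) : 0 < delta -> exists2 c, 0 < c &
  forall t, 0 < t -> (P [set w | (large_jumps N t w - t * m <= - (delta * t))%R] <=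
    (expR 1 * expR (- (c * t)))%:E)%E.
Proof.
move=> d0; have d2 : 0 < delta / 2 by rewrite divr_gt0.
have [L L1 Lm] := truncated_mean nu_levy nu_neg nu_tail_le d2.
rewrite -/m in Lm; set mL := \int[nu]_(x in _) _ in Lm.
have V0 := levy_mass_ge0 nu; set V := levy_mass nu in V0.
have L0 : 0 < L by lra.
have den : 0 < 8 * L ^+ 2 * (V + 1) by rewrite !mulr_gt0 ?exprn_gt0//; lra.
(* The first bound is the range of [compensated_chernoff], the second makes the quadratic term at
   most half of the linear one. *)
pose theta := Num.min (2 * L)^-1 (delta / (8 * L ^+ 2 * (V + 1))).
have th0 : 0 < theta by rewrite lt_min invr_gt0 mulr_gt0//= divr_gt0.
have thL : theta * L <= 2^-1.
  apply: (@le_trans _ _ ((2 * L)^-1 * L)); first by rewrite ler_pM2r// ge_min lexx.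
  by rewrite invfM -mulrA mulVf ?mulr1// gt_eqF.
have thV : theta * (8 * L ^+ 2 * (V + 1)) <= delta.
  by rewrite -ler_pdivlMr// ge_min lexx orbT.
exists (theta * delta / 4); first by rewrite divr_gt0// mulr_gt0.
move=> t t0.
have mU : measurable [set w | large_jumps N t w - t * m <= - (delta * t)].
  rewrite -[X in measurable X]setTI; apply: measurable_fun_le => //.
  by apply: measurable_funB => //; exact: measurable_large_jumps.
have [mC mS C_fin tC _] := away_none t.
have AC b' : (`[0, t] `*` sizes 1 L) `&` Cnone b' = set0 by rewrite /Cnone setI0.
have thL' : `|- theta| * L <= 2^-1 by rewrite normrN gtr0_norm.
have := compensated_chernoff nu_levy NP (ltW t0) ltr01 L1 (ltW L1)
  mC mS C_fin tC AC (theta * (delta / 2 * t)) thL'.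
rewrite -/(count_event N Cnone Sall) eventT setIT probability_setT mule1.
set U := [set w | _ <= _ * compensated_sum _ _ _ _ _ _] => chern.
have mUc : measurable U.
  rewrite -[X in measurable X]setTI; apply: measurable_fun_le => //.
  by apply: measurable_funM => //; exact: measurable_compensated_sum.
have mirr := measurable_irregular N t.
apply: (@le_trans _ _ (P (U `|` irregular N t))).
  apply: le_measure_set => //; first exact: measurableU.
  move=> w Sw; have [|rw] := pselect (irregular N t w); first by right.
  have Sw' : large_jumps N t w - t * m <= - (delta * t) := Sw.
  left; rewrite /U /= mulNr -mulrN; apply: ler_wpM2l; first exact: ltW.
  have := large_jumps_ge_truncated L (ltW t0) rw.
  rewrite /compensated_sum -/mL.
  (* Half of [delta] pays for the mean of the discarded jumps, the other half is the deviation. *)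
  have : t * (m - mL) <= t * (delta / 2) by rewrite ler_pM2l.
  rewrite mulrBr; set s := Rintegral _ _ _; move=> h1 h2; lra.
apply: (@le_trans _ _ (P U + P (irregular N t))%E); first exact: measureU2.
rewrite (irregular_null nu_levy nu_neg nu_tail_le NP (ltW t0)) adde0.
apply: (le_trans chern); rewrite lee_fin -expRD ler_expR sqrrN -/V.
rewrite -addrA lerD2l.
suff : 2 * theta ^+ 2 * t * L ^+ 2 * V <= theta * delta / 4 * t.
  have -> : theta * (delta / 2 * t) = 2 * (theta * delta / 4 * t) by field.
  set y := theta * delta / 4 * t; set z := _ * V; move=> ?; lra.
have -> : 2 * theta ^+ 2 * t * L ^+ 2 * V =
  (theta * t / 4) * (theta * (8 * L ^+ 2 * V)) by field.
have -> : theta * delta / 4 * t = (theta * t / 4) * delta by ring.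
apply: ler_wpM2l; first by rewrite divr_ge0// mulr_ge0// ltW.
apply: le_trans thV; rewrite ler_pM2l// ler_wpM2l ?lerDl// mulr_ge0//.
exact: sqr_ge0.
Qed.

Lemma gaussian_small_jumps_tailT (delta : R) : 0 < delta -> exists2 c, 0 < c &
  forall t, 0 < t ->
    (P [set w | (delta * t <= - (a * B t w + J t w))%R] <=
     ((expR 2 + 2) * expR (- (c * t)))%:E)%E.
Proof.
move=> d0.
have [c c0 tail] := gaussian_small_jumps_tail nu_levy nu_neg NP a
  B_brownian BN J_small d0.
exists c => // t t0; have := tail t t0 _ _ (away_none t) true.
rewrite eventT setIT probability_setT mule1; apply: le_trans.
under eq_set do rewrite -mulN1r.
exact: lexx.
Qed.

(** One of the two components must account for half of the deviation, so a union bound suffices. *)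
Lemma levy_lower_tail (delta : R) : 0 < delta -> exists c K, [/\ 0 < c, 0 < K &
  forall t, 0 < t ->
    (P [set w | (centered t w <= - (delta * t))%R] <= (K * expR (- (c * t)))%:E)%E].
Proof.
move=> d0; have d2 : 0 < delta / 2 by rewrite divr_gt0.
have [c1 c10 tail1] := large_jumps_lower_tail d2.
have [c2 c20 tail2] := gaussian_small_jumps_tailT d2.
exists (Num.min c1 c2), (expR 1 + (expR 2 + 2)); split.
- by rewrite lt_min c10.
- by rewrite !addr_gt0 ?expR_gt0.
move=> t t0; have := tail1 t t0; have := tail2 t t0.
set U2 := [set w | _]; set U1 := [set w | _] => P2 P1.
have [F [mF PF subF]] := X_ito (ltW t0).
have mU1 : measurable U1.
  rewrite -[X in measurable X]setTI; apply: measurable_fun_le => //.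
  by apply: measurable_funB => //; exact: measurable_large_jumps.
have mU2 : measurable U2.
  rewrite -[X in measurable X]setTI; apply: measurable_fun_le => //.
  apply: measurableT_comp => //; apply: measurable_funD => //.
  exact: measurable_funM.
apply: (@le_trans _ _ (P (U1 `|` (U2 `|` F)))).
  apply: le_measure_set.
  - by rewrite -[X in measurable X]setTI; apply: measurable_fun_le.
  - by apply: measurableU => //; exact: measurableU.
  move=> w Xw; have Xw' : centered t w <= - (delta * t) := Xw.
  have [|Fw] := pselect (F w); first by right; right.
  have Xw2 : X t w = b * t + a * B t w + J t w + large_jumps N t w.
    by apply: contrapT => h; apply: Fw; exact: subF.
  move: Xw'; rewrite /centered Xw2 => Xw'.
  have [|h] := pselect (U2 w); first by right; left.
  left; rewrite /U1 /=; move/negP : h; rewrite -ltNge.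
  move: Xw'; set s := large_jumps _ _ _; set y := a * _; set z := J t w.
  set v := t * m; set bt := b * t; move=> h1 h2; lra.
have mU2F : measurable (U2 `|` F) by exact: measurableU.
apply: (@le_trans _ _ (P U1 + P (U2 `|` F))%E); first exact: measureU2.
rewrite mulrDl EFinD leeD//.
  apply: (le_trans P1); rewrite lee_fin ler_pM2l ?expR_gt0// ler_expR lerN2.
  by rewrite ler_pM2r// ge_min lexx.
apply: (@le_trans _ _ (P U2 + P F)%E); first exact: measureU2.
rewrite PF adde0; apply: (le_trans P2); rewrite lee_fin ler_pM2l.
  by rewrite ler_expR lerN2 ler_pM2r// ge_min lexx orbT.
by rewrite addr_gt0 ?expR_gt0.
Qed.

(** The interval is open at T so that the boxes are disjoint. Neither meets the small jumps before
    T: one by size, the other by time. *)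
Definition calm_then_jump_boxes (T n x : R) (i : bool) : set plane :=
  if i then jump_box T 1 else `]T, n] `*` [set y : R | x <= y].

Definition calm_then_jump_counts (i : bool) : set (\bar R) :=
  if i then [set 0%E] else ~` [set 0%E].

Section calm_then_jump.
Variables (T n x : R).
Hypotheses (T0 : 0 < T) (Tn : T < n) (x1 : 1 <= x).
Let C := calm_then_jump_boxes T n x.
Let E := count_event N C calm_then_jump_counts.
Let tail := nu [set y : R | x <= y].

Let calm_intensity : jump_intensity nu (C true) = (T%:E * nu (large 1))%E.
Proof. by rewrite jump_intensity_itv ?ltW//; exact: measurable_large. Qed.

Let jump_intensityE : jump_intensity nu (C false) = ((n - T)%:E * tail)%E.
Proof.
rewrite /C /= jump_intensity_box//; [|exact: measurable_ge|].
  by rewrite lebesgue_measure_itv/= lte_fin Tn EFinB.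
move=> y /=; rewrite !in_itv/= => /andP[Ty _]; rewrite andbT.
by rewrite ltW// (lt_trans T0).
Qed.

Let large1_fin : (nu (large 1) < +oo)%E.
Proof.
by apply: (levy_measure_away0 nu_levy ltr01) => //; exact: measurable_large.
Qed.

Lemma tail_fin : tail \is a fin_num.
Proof.
rewrite ge0_fin_numE; last exact: measure_ge0.
apply: (levy_measure_away0 nu_levy ltr01); first exact: measurable_ge.
by move=> y /= xy; rewrite (le_trans x1)// (le_trans xy)// ler_norm.
Qed.

Lemma away_calm_then_jump : away_from_small_jumps nu T C calm_then_jump_counts.
Proof.
have timeF (s : R) : s \in `[0, T] -> s \in `]T, n] -> False.
  rewrite !in_itv/= => /andP[_ sT] /andP[Ts _].
  by have := lt_le_trans Ts sT; rewrite ltxx.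
split.
- case; first exact: measurable_jump_box.
  by apply: measurableX => //; exact: measurable_ge.
- by case => //=; apply: measurableC; exact: emeasurable_set1.
- case; first by rewrite calm_intensity lte_mul_pinfty ?lee_fin ?(ltW T0).
  by rewrite jump_intensityE -(fineK tail_fin) -EFinM ltry.
- apply/trivIsetP => -[] [] // _ _ _; apply/seteqP; split => // z /=.
    by move=> [[z1 _] [z2 _]]; exact: (timeF z.1).
  by move=> [[z2 _] [z1 _]]; exact: (timeF z.1).
- case; apply/seteqP; split => // z /=.
    by move=> [[_ h1] [_ h2]]; have := le_lt_trans h2 h1; rewrite ltxx.
  by move=> [[z1 _] [z2 _]]; exact: (timeF z.1).
Qed.

Lemma prob_calm_then_jump : T + 1 <= n -> x = 3 * n ^+ 2 ->
  (tail <= (x ^- 2)%:E)%E ->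
  ((expR (- (T * fine (nu (large 1)))))%:E * ((1 / 2)%:E * tail) <= P E)%E.
Proof.
move=> Tn1 xE tailx.
have [mC mS C_fin tC _] := away_calm_then_jump.
have -> : P E = (P [set w | N w (C true) = 0%E] *
    P (~` [set w | N w (C false) = 0%E]))%E.
  have := prm_independent NP mC tC mS; rewrite big_bool /= => <-.
  by congr (P _); apply/seteqP; split=> w wS i; [move=> _|]; exact: wS.
have mf : measurable [set w | N w (C false) = 0%E].
  rewrite -[X in measurable X]setTI.
  exact: (measurable_kernel N _ (mC false) measurableT [set 0%E] (emeasurable_set1 _)).
rewrite probability_setC// (prm_count0 ji0 NP (mC true) (C_fin true)).
rewrite (prm_count0 ji0 NP (mC false) (C_fin false)).
rewrite calm_intensity jump_intensityE -(fineK tail_fin).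
rewrite fineM//; last by rewrite ge0_fin_numE.
rewrite -!EFinM [fine T%:E]/= [fine (_ * _)%:E]/= lee_fin ler_pM2l ?expR_gt0//.
apply: half_le_oneB_expRN => //; first by apply: fine_ge0; exact: measure_ge0.
by rewrite -xE -lee_fin fineK//; exact: tail_fin.
Qed.

End calm_then_jump.

(* No jump of size at least 1 before T lets the negative drift show at T, while
   a single jump of size at least 3 n^2 between T and n makes the value at n
   large; the two requirements involve disjoint sets of jumps. *)
Lemma dip_and_large_value : exists T kappa p K c : R,
  [/\ 0 < T, 0 < kappa, 0 < p & 0 < c] /\
  \forall n \near +oo,
    (p%:E * nu [set y : R | (3 * n ^+ 2 <= y)%R] <=
     P ([set w | (centered T w <= - kappa)%R] `&` [set w | (n ^+ 2 <= centered n w)%R])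
     + (K * expR (- (c * n)))%:E)%E.
Proof.
have m0 : 0 < m by exact: jump_mean_gt0.
have m2 : 0 < m / 2 by rewrite divr_gt0.
have [c1 c10 tail1] := gaussian_small_jumps_tail nu_levy nu_neg NP a
  B_brownian BN J_small m2.
have [c c0 tail2] := gaussian_small_jumps_tailT ltr01.
pose K : R := expR 2 + 2.
have K0 : 0 < K by rewrite addr_gt0 ?expR_gt0.
(* At this time the unwanted deviation removes at most half of the calm-then-jump event, by
   [expR_small]. *)
pose T := 2 * K / c1.
have T0 : 0 < T by rewrite divr_gt0 // mulr_gt0.
pose q := expR (- (T * fine (nu (large 1)))).
have q0 : 0 < q by exact: expR_gt0.
exists T, (T * m / 2), (q / 4), K, c; split.
  by split; [exact: T0|rewrite divr_gt0// mulr_gt0|rewrite divr_gt0|exact: c0].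
near=> n.
have n1 : 1 <= n by near: n; apply: nbhs_pinfty_ge; exact: num_real.
have nm : m <= n by near: n; apply: nbhs_pinfty_ge; exact: num_real.
have nT : T + 1 <= n by near: n; apply: nbhs_pinfty_ge; exact: num_real.
have nu_n : (nu [set y : R | (3 * n ^+ 2 <= y)%R] <= ((3 * n ^+ 2) ^- 2)%:E)%E.
  near: n.
  have [M [_ hM]] := nu_tail_le.
  exists (Num.max 1 M); split; first exact: num_real.
  move=> n; rewrite gt_max => /andP[n1 nM]; apply: hM.
  by apply: (lt_le_trans nM); nra.
have n0 : 0 < n := lt_le_trans ltr01 n1.
have nn2 : n <= n ^+ 2 by rewrite expr2 ler_peMl// ltW.
have Tn : T < n by apply: lt_le_trans nT; rewrite ltrDl.
(* One n^2 for the target, one for the compensator n m <= n^2, and one for a deviation of at most n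
   <= n^2 of the Gaussian and small-jump part. *)
pose x := 3 * n ^+ 2; rewrite -/x in nu_n *.
have x1 : 1 <= x by rewrite (le_trans n1)// (le_trans nn2)// /x ler_peMl ?sqr_ge0// ler1n.
set nux := nu _ in nu_n *.
have nux_fin : nux \is a fin_num by exact: tail_fin.
pose C := calm_then_jump_boxes T n x.
pose S := calm_then_jump_counts.
have adm : away_from_small_jumps nu T C S by exact: away_calm_then_jump.
have [mC mS C_fin tC _] := adm.
set E := count_event N C S.
have mE : measurable E by exact: measurable_count_event.
have PE : (q%:E * ((1 / 2)%:E * nux) <= P E)%E by exact: prob_calm_then_jump.
(* Without large jumps before T, the centred value is this Gaussian and small-jump part minus m T;
   off U it is below - T m / 2. *)
pose U := [set w | m / 2 * T <= (-1) ^+ false * (a * B T w + J T w)].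
pose V := [set w | 1 * n <= - (a * B n w + J n w)].
pose G := [set w | centered T w <= - (T * m / 2)] `&` [set w | n ^+ 2 <= centered n w].
have PU : (P (U `&` E) <= (2^-1)%:E * P E)%E.
  apply: (le_trans (tail1 T T0 C S adm false)); rewrite lee_wpmul2r// lee_fin.
  exact: expR_small.
have PV : (P V <= (K * expR (- (c * n)))%:E)%E by exact: tail2.
have [F1 [mF1 PF1 subF1]] := X_ito (ltW T0).
have [F2 [mF2 PF2 subF2]] := X_ito (ltW n0).
(* The event only says that the second count is nonzero; off this null set it is a natural number,
   hence at least 1. *)
pose F3 := ~` \bigcup_k (fun w => N w (C false)) @^-1` [set k%:R%:E].
have mF3 : measurable F3.
  apply: measurableC; apply: bigcupT_measurable => k.
  rewrite -[X in measurable X]setTI.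
  exact: (measurable_kernel N _ (mC false) measurableT [set k%:R%:E] (emeasurable_set1 _)).
have PF3 : P F3 = 0%E by exact: (prm_nat_valued ji0 NP (mC false) (C_fin false)).
have mirr := measurable_irregular N n.
have Pirr := irregular_null nu_levy nu_neg nu_tail_le NP (ltW n0).
pose bad := F1 `|` (F2 `|` (F3 `|` irregular N n)).
have null2 (A A' : set Omega) : measurable A -> measurable A' ->
    P A = 0%E -> P A' = 0%E -> P (A `|` A') = 0%E.
  move=> mA mA' PA PA'; apply/eqP; rewrite -measure_le0.
  by apply: (@le_trans _ _ (P A + P A')%E); [exact: measureU2|rewrite PA PA' adde0].
have mF3i : measurable (F3 `|` irregular N n) by exact: measurableU.
have mF23i : measurable (F2 `|` (F3 `|` irregular N n)) by exact: measurableU.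
have mbad : measurable bad by exact: measurableU.
have PF3i := null2 _ _ mF3 mirr PF3 Pirr.
have PF23i := null2 _ _ mF2 mF3i PF2 PF3i.
have Pbad : P bad = 0%E := null2 _ _ mF1 mF23i PF1 PF23i.
have mU : measurable U.
  rewrite -[X in measurable X]setTI; apply: measurable_fun_le => //.
  apply: measurable_funM => //; apply: measurable_funD => //.
  exact: measurable_funM.
have mV : measurable V.
  rewrite -[X in measurable X]setTI; apply: measurable_fun_le => //.
  apply: measurableT_comp => //; apply: measurable_funD => //.
  exact: measurable_funM.
have mG : measurable G.
  by apply: measurableI; rewrite -[X in measurable X]setTI; apply: measurable_fun_le.
have mUE : measurable (U `&` E) by exact: measurableI.
have sub : E `<=` (G `|` (U `&` E)) `|` (V `|` bad).
  move=> w Ew.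
  have [|/not_orP[F1w /not_orP[F2w /not_orP[F3w rw]]]] := pselect (bad w).
    by right; right.
  have [|Vw] := pselect (V w); first by right; left.
  have [|Uw] := pselect (U w); first by left; right.
  left; left.
  have XT : X T w = b * T + a * B T w + J T w + large_jumps N T w.
    by apply: contrapT => h; apply: F1w; exact: subF1.
  have Xn : X n w = b * n + a * B n w + J n w + large_jumps N n w.
    by apply: contrapT => h; apply: F2w; exact: subF2.
  have ST : large_jumps N T w = 0.
    rewrite /large_jumps /Rintegral null_set_integral//.
    - exact: measurable_jump_box.
    - by apply/measurable_EFinP; apply: measurable_funTS; exact: measurable_snd.
    - exact: (Ew true).
  have Sn : x <= large_jumps N n w.
    apply: (large_jumps_ge_jump (I := `]T, n]%classic) (ltW n0) x1 _ _ rw) => //.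
      move=> y /=; rewrite !in_itv/= => /andP[h1 ->]; rewrite andbT.
      by rewrite ltW// (lt_trans T0).
    move/contrapT : F3w => [[|k] _ Nk]; last first.
      have -> : N w (`]T, n] `*` [set y | (x <= y)%R]) = k.+1%:R%:E by exact: Nk.
      by rewrite lee_fin ler1n.
    by have := Ew false.
  split; rewrite /= /centered.
    move/negP : Uw; rewrite -ltNge expr0 mul1r XT ST => Uw.
    have -> : b * T + a * B T w + J T w + 0 - b * T - T * m =
        (a * B T w + J T w) - T * m by ring.
    rewrite lerBlDr (le_trans (ltW Uw))// le_eqVlt; apply/orP; left.
    by apply/eqP; field.
  move/negP : Vw; rewrite -ltNge mul1r Xn ltrNl => Vw.
  have -> : b * n + a * B n w + J n w + large_jumps N n w - b * n - n * m =
      (a * B n w + J n w) + large_jumps N n w - n * m by ring.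
  have nm2 : n * m <= n ^+ 2 by rewrite expr2 ler_pM2l.
  rewrite lerBrDr; apply: le_trans (lerD (ltW Vw) Sn).
  rewrite [leRHS]addrC lerBrDr; apply: le_trans (lerD (lerD (lexx _) nm2) nn2) _.
  by rewrite /x le_eqVlt; apply/orP; left; apply/eqP; ring.
have PEle : (P E <= P G + (2^-1)%:E * P E + (K * expR (- (c * n)))%:E)%E.
  apply: (@le_trans _ _ (P ((G `|` (U `&` E)) `|` (V `|` bad)))).
    apply: le_measure_set => //.
    by apply: measurableU; exact: measurableU.
  apply: (@le_trans _ _ (P (G `|` (U `&` E)) + P (V `|` bad))%E).
    by apply: measureU2; exact: measurableU.
  apply: leeD.
    apply: (@le_trans _ _ (P G + P (U `&` E))%E); first exact: measureU2.
    by rewrite leeD2l.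
  apply: (@le_trans _ _ (P V + P bad)%E); first exact: measureU2.
  by rewrite Pbad adde0.
rewrite -/G.
have PGfin : P G \is a fin_num by exact: fin_num_measure.
have PEfin : P E \is a fin_num by exact: fin_num_measure.
move: PE PEle; rewrite -(fineK PGfin) -(fineK PEfin) -(fineK nux_fin).
rewrite -!EFinM -!EFinD !lee_fin.
exact: half_absorb.
Unshelve. all: by end_near. Qed.

End levy_tail.

(** * Events on the path space *)

Section path_events.
Context {R : realType}.

Lemma path_right_cvg (xi : skorokhod R) t : 0 <= t < 1 ->
  sample_path xi x @[x --> t^'+] --> sample_path xi t.
Proof. by case: (set_valP xi) => + _ _; apply. Qed.

Lemma path_rational_lt (xi : skorokhod R) (t r c : R) : 0 <= t < 1 -> t < r ->
  sample_path xi t < c -> exists q : rat, t < ratr q < r /\ sample_path xi (ratr q) < c.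
Proof.
move=> t01 tr xc.
have /(path_right_cvg t01) : nbhs (sample_path xi t) [set y | y < c] by exact: lt_nbhsl.
rewrite /at_right /within /= => /nbhs_ballP[e /= e0 eA].
have th : t < Num.min r (t + e) by rewrite lt_min tr ltrDl.
have [q] := rat_in_itvoo th; rewrite in_itv/= lt_min => /and3P[tq qr qe].
exists q; rewrite tq qr; split => //; apply: eA => //.
by rewrite /ball /= ltr_norml; lra.
Qed.

Lemma path_rational_gt (xi : skorokhod R) (t r c : R) : 0 <= t < 1 -> t < r ->
  c < sample_path xi t -> exists q : rat, t < ratr q < r /\ c < sample_path xi (ratr q).
Proof.
move=> t01 tr xc.
have /(path_right_cvg t01) : nbhs (sample_path xi t) [set y | c < y] by exact: lt_nbhsr.
rewrite /at_right /within /= => /nbhs_ballP[e /= e0 eA].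
have th : t < Num.min r (t + e) by rewrite lt_min tr ltrDl.
have [q] := rat_in_itvoo th; rewrite in_itv/= lt_min => /and3P[tq qr qe].
exists q; rewrite tq qr; split => //; apply: eA => //.
by rewrite /ball /= ltr_norml; lra.
Qed.

Lemma dips_rational (kappa : R) (xi : skorokhod R) : 0 < kappa ->
  dips kappa xi <-> 1 <= sample_path xi 1 /\ forall k : nat, exists q : rat,
    (ratr q : R) \in `[0, 1] /\
    sample_path xi (ratr q) * sample_path xi 1 < k.+1%:R^-1 - kappa.
Proof.
move=> k0; split=> -[x1 xe]; split=> //; [move=> k|move=> e e0].
  pose e : R := Num.min k.+1%:R^-1 kappa.
  have e0 : 0 < e by rewrite lt_min invr_gt0 ltr0n k0.
  have [t t01 xt] := xe e e0.
  have ek : e <= k.+1%:R^-1 by rewrite ge_min lexx.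
  have ekap : e <= kappa by rewrite ge_min lexx orbT.
  (* At 1 the product is a square, while [e <= kappa] makes it negative. Right-continuity is thus
     available at [t] and gives a rational before 1. *)
  have t1 : t != 1 by apply/eqP => tE; move: xt; rewrite tE; nra.
  have t01' : 0 <= t < 1.
    by move: t01; rewrite in_itv/= => /andP[-> t1']; rewrite lt_neqAle t1.
  have x0 : 0 < sample_path xi 1 by lra.
  have : sample_path xi t < (e - kappa) / sample_path xi 1.
    by rewrite ltr_pdivlMr.
  have [_ t1'] := andP t01'; move=> /(path_rational_lt t01' t1')[q [/andP[tq q1] xq]].
  exists q; split.
    by rewrite in_itv/= (ltW q1) andbT; have [t0 _] := andP t01'; lra.
  by rewrite -ltr_pdivlMr// (lt_le_trans xq)// ler_pM2r ?invr_gt0// lerB.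
have [k _ /(_ k (leqnn k)) /= ke] := near_infty_natSinv_lt (PosNum e0).
have [q [q01 xq]] := xe k; exists (ratr q) => //.
have {}ke : k.+1%:R^-1 < e := ke.
by apply: (lt_trans xq); rewrite ltrD2r.
Qed.

Lemma negative_around_rational (t1 delta : R) (xi : skorokhod R) : 0 < delta ->
  negative_around t1 delta xi <-> exists k : nat, forall q : rat,
    `|ratr q - t1| < k.+1%:R^-1 -> sample_path xi (ratr q) <= - delta - k.+1%:R^-1.
Proof.
move=> d0; split=> -[k xk]; exists k; [by move=> q; exact: xk|move=> s].
set r := k.+1%:R^-1 in xk *.
have r0 : 0 < r by rewrite invr_gt0.
rewrite ltr_norml => /andP[s1 s2]; rewrite leNgt; apply/negP => xs.
have zero (q : rat) : `|ratr q - t1| < r -> (ratr q : R) \notin `[0, 1] -> False.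
  by move=> /xk xq /path_outside x0; move: xq; rewrite x0; lra.
have [s0|s0] := ltP s 0.
  have sm : s < Num.min 0 (t1 + r) by rewrite lt_min s0; lra.
  have [q] := rat_in_itvoo sm; rewrite in_itv/= lt_min => /and3P[sq q0 qr].
  apply: (zero q); first by rewrite ltr_norml; lra.
  by rewrite in_itv/= negb_and -ltNge q0.
(* The zero extension need not be right-continuous at 1, but a window containing some s >= 1 also
   contains rationals beyond 1, where the path is 0. *)
have [s3|s3] := ltP s 1; last first.
  have sm : s < t1 + r by lra.
  have [q] := rat_in_itvoo sm; rewrite in_itv/= => /andP[sq qr].
  apply: (zero q); first by rewrite ltr_norml; lra.
  by rewrite in_itv/= negb_and -!ltNge (le_lt_trans s3 sq) orbT.
have s01 : 0 <= s < 1 by rewrite s0.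
have sr : s < t1 + r by lra.
have [q [/andP[sq qr] xq]] := path_rational_gt s01 sr xs.
have /xk : `|ratr q - t1| < r by rewrite ltr_norml; lra.
by rewrite leNgt xq.
Qed.

(** * Measurability of the two path events *)

Section measurable_path_events.
Context (d : measure_display) (Omega : measurableType d).
Variable Y : Omega -> skorokhod R.
Hypothesis mY : forall t, measurable_fun setT (fun w => sample_path (Y w) t).

Lemma measurable_dips kappa : 0 < kappa -> measurable (Y @^-1` dips kappa).
Proof.
move=> k0.
have -> : Y @^-1` dips kappa = [set w | 1 <= sample_path (Y w) 1] `&`
  \bigcap_k \bigcup_(q : rat) (if ratr q \in `[(0 : R), 1] then
    [set w | sample_path (Y w) (ratr q) * sample_path (Y w) 1 < k.+1%:R^-1 - kappa]
    else set0).
  apply/seteqP; split=> w /=.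
    move=> /(dips_rational _ k0)[y1 yk]; split => // k _.
    by have [q [q01 yq]] := yk k; exists q => //; rewrite q01.
  move=> [y1 yk]; apply/(dips_rational _ k0); split => // k.
  by have [q _] := yk k Logic.I; case: ifP => // q01 yq; exists q.
apply: measurableI.
  by rewrite -[X in measurable X]setTI; apply: measurable_fun_le.
apply: bigcapT_measurable => k; apply: bigcupT_measurable_rat => q.
case: ifP => // _; pose c : R := k.+1%:R^-1 - kappa.
rewrite (_ : [set _ | _] = setT `&` (fun w => sample_path (Y w) (ratr q) *
    sample_path (Y w) 1) @^-1` `]-oo, c[%classic).
  by apply: measurable_funM => //; exact: measurable_itv.
by rewrite setTI; apply/seteqP; split=> w /=; rewrite in_itv.
Qed.

Lemma measurable_negative_around t1 delta : 0 < delta ->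
  measurable (Y @^-1` negative_around t1 delta).
Proof.
move=> d0.
have -> : Y @^-1` negative_around t1 delta =
  \bigcup_k \bigcap_(q in [set q : rat | `|ratr q - t1| < k.+1%:R^-1])
    [set w | sample_path (Y w) (ratr q) <= - delta - k.+1%:R^-1].
  apply/seteqP; split=> w /=.
    by move=> /(negative_around_rational _ _ d0)[k yk]; exists k.
  by move=> [k _ yk]; apply/(negative_around_rational _ _ d0); exists k.
apply: bigcupT_measurable => k.
rewrite -[X in measurable X]setCK setC_bigcap; apply: measurableC.
rewrite bigcup_mkcond; apply: bigcupT_measurable_rat => q; case: ifP => // _.
by apply: measurableC; rewrite -[X in measurable X]setTI; apply: measurable_fun_le.
Qed.

End measurable_path_events.
End path_events.

Lemma limn_esup_ge (R : realType) (u : (\bar R)^nat) (l : \bar R) :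
  (\forall n \near \oo, (l <= u n)%E) -> (l <= limn_esup u)%E.
Proof.
move=> ul; apply: le_ereal_inf_tmp => _ [V ooV <-].
have [n [Vn ln]] : exists n, V n /\ (l <= u n)%E.
  near \oo => n; exists n; split; near: n; [exact: ooV|exact: ul].
by apply: (le_trans ln); apply: ereal_sup_ubound; exists n.
Unshelve. all: by end_near. Qed.

(* A rate function I is +oo on [dips kappa] because the neighbourhoods
   [negative_around] are too unlikely; this contradicts the upper bound. *)
Lemma not_LDP_of_dips (R : realType) (d : measure_display)
    (Omega : measurableType d) (P : probability Omega R)
    (dist : skorokhod R -> skorokhod R -> \bar R) (speed : nat -> R)
    (Y : nat -> Omega -> skorokhod R) (kappa : R) :
  graph_close dist -> 0 < kappa ->
  (-oo < limn_esup (fun n => ((speed n)^-1)%:E * lne (P (Y n @^-1` dips kappa))))%E ->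
  (forall t1 delta, 0 < t1 < 1 -> 0 < delta ->
    limn_einf (fun n => ((speed n)^-1)%:E *
      lne (P (Y n @^-1` negative_around t1 delta)))%E = -oo%E) ->
  ~ LDP P (Y : nat -> Omega -> metric_space dist) speed.
Proof.
move=> close k0 upper lower [I [_ _ openI closedI]].
have Idips xi : dips kappa xi -> I xi = +oo%E.
  move=> /(dips_negative_around k0)[t1 [delta [t01 d0 xi_neg]]].
  have := openI _ (negative_around_open close (t1 := t1) d0).
  rewrite (lower _ _ t01 d0) leeNy_eq eqe_oppLR/= => /eqP inf_oo.
  apply/eqP; rewrite -leye_eq -inf_oo; apply: ereal_inf_lbound.
  by exists xi.
have := closedI _ (dips_closed close k0).
have -> : ereal_inf (I @` (dips kappa)) = +oo%E.
  apply/eqP; rewrite -leye_eq; apply: le_ereal_inf_tmp => _ [xi /Idips -> <-].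
  by rewrite leey.
by rewrite leeNy_eq => /eqP h; move: upper; rewrite h ltxx.
Qed.

Lemma ln_ge_norm (R : realType) (p g : R) : 1 <= g -> - (`|ln p| * g) <= ln p.
Proof.
move=> g1; rewrite lerNl; apply: (@le_trans _ _ `|ln p|).
  by rewrite -normrN ler_norm.
by rewrite ler_peMr.
Qed.

(** With [g] = log^gamma n and [y] of order n, the exponential error is absorbed by the main term;
    the factor [K] is bounded by exp(|K| g). *)
Lemma expR_dominated (R : realType) (A K p g y : R) : 0 < p -> 1 <= g ->
  (`|ln p| + A + `|K|) * g <= y -> K * expR (- y) <= p * expR (- (A * g)).
Proof.
move=> p0 g1 gy.
have pE : p * expR (- (A * g)) = expR (ln p - A * g) by rewrite expRD lnK.
have hK : K <= expR (`|K| * g).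
  apply: (le_trans (ler_norm _)); apply: (@le_trans _ _ (`|K| * g)).
    by rewrite ler_peMr.
  by apply: le_trans (expR_ge1Dx _); rewrite lerDr.
apply: (@le_trans _ _ (expR (`|K| * g) * expR (- y))).
  by rewrite ler_wpM2r ?expR_ge0.
rewrite pE -expRD ler_expR; move: gy (ln_ge_norm p g1); rewrite !mulrDl; lra.
Qed.

(** * Comparison of the speed and the tail with log^gamma *)

Section lognormal_speed.
Context {R : realType}.
Variables (c beta lam gamma : R).
Hypotheses (c0 : 0 < c) (lam0 : 0 < lam) (g1 : 1 < gamma).

Definition lognormal_tail (x : R) : R :=
  c * x `^ beta * expR (- (lam * ln x `^ gamma)).

Definition lognormal_speed (x : R) : R := lam * ln x `^ gamma - ln (c * x `^ beta).

Lemma lognormal_tail_gt0 x : 0 < x -> 0 < lognormal_tail x.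
Proof. by move=> x0; rewrite !mulr_gt0 ?powR_gt0 ?expR_gt0. Qed.

Lemma ln_le_powR : \forall x \near +oo, 1 <= ln x /\ ln x <= ln x `^ gamma.
Proof.
near=> x.
have x1 : 1 <= ln x by near: x; exact: ln_near_ge.
split => //; rewrite -[leLHS]powRr1; last by lra.
by apply: ler_powR => //; exact: ltW.
Unshelve. all: by end_near. Qed.

(** Since gamma > 1, ln c + beta ln x is of lower order than log^gamma x. *)
Lemma lognormal_speed_bounds : \forall x \near +oo,
  lam / 2 * ln x `^ gamma <= lognormal_speed x <= 2 * lam * ln x `^ gamma.
Proof.
near=> x.
have x0 : 0 < x by near: x; apply: nbhs_pinfty_gt; exact: num_real.
have [l1 lg] : 1 <= ln x /\ ln x <= ln x `^ gamma by near: x; exact: ln_le_powR.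
have h : (`|ln c| + `|beta|) * ln x <= lam / 2 * ln x `^ gamma.
  by near: x; apply: ln_le_ln_powR => //; rewrite divr_gt0.
rewrite /lognormal_speed lnM ?posrE ?powR_gt0// ln_powR.
have cb : `|ln c + beta * ln x| <= (`|ln c| + `|beta|) * ln x.
  apply: (le_trans (ler_normD _ _)); rewrite mulrDl lerD//.
    by rewrite ler_peMr.
  by rewrite normrM (ger0_norm (x := ln x))//; lra.
have := le_trans cb h; rewrite ler_norml => /andP[].
have : 0 <= lam * ln x `^ gamma by rewrite mulr_ge0 ?powR_ge0// ltW.
rewrite -[2 * lam * _]mulrA [lam / 2]mulrC -[2^-1 * lam * _]mulrA.
set u := lam * _; set v := ln c + _; move=> *; apply/andP; split; lra.
Unshelve. all: by end_near. Qed.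

(** For x >= 3, ln(3 x^2) <= 3 ln x, so a quadratic argument multiplies log^gamma by at most
    3^gamma. *)
Lemma lognormal_tail_square : exists2 A, 0 < A & \forall x \near +oo,
  expR (- (A * ln x `^ gamma)) <= lognormal_tail (3 * x ^+ 2).
Proof.
pose A := `|ln c| + 3 * `|beta| + lam * 3 `^ gamma.
exists A; first by rewrite ltr_wpDl ?addr_ge0 ?mulr_ge0 ?mulr_gt0 ?powR_gt0.
near=> x.
have x3 : 3 <= x by near: x; apply: nbhs_pinfty_ge; exact: num_real.
have x0 : 0 < x by lra.
have [l1 lg] : 1 <= ln x /\ ln x <= ln x `^ gamma by near: x; exact: ln_le_powR.
have y0 : 0 < 3 * x ^+ 2 by rewrite mulr_gt0// exprn_gt0.
have y1 : 1 <= 3 * x ^+ 2 by nra.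
have ly0 : 0 <= ln (3 * x ^+ 2) by exact: ln_ge0.
have ly : ln (3 * x ^+ 2) <= 3 * ln x.
  have -> : 3 * ln x = ln (x ^+ 3) by rewrite lnXn// mulr_natl.
  by rewrite ler_ln ?posrE ?exprn_gt0//  [leRHS]exprS ler_pM2r ?exprn_gt0.
have g0 : 0 <= gamma by apply: ltW; apply: lt_trans g1; exact: ltr01.
have lyg : ln (3 * x ^+ 2) `^ gamma <= 3 `^ gamma * ln x `^ gamma.
  rewrite -powRM//; last lra.
  by apply: ge0_ler_powR => //; rewrite nnegrE ?mulr_ge0//; lra.
rewrite -ler_ln ?posrE ?expR_gt0 ?lognormal_tail_gt0// expRK ln_lognormal_tail//.
have h1 : - (`|ln c| * ln x `^ gamma) <= ln c.
  rewrite lerNl; apply: (@le_trans _ _ `|ln c|); first by rewrite -normrN ler_norm.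
  by rewrite ler_peMr//; lra.
have h2 : - (3 * `|beta| * ln x `^ gamma) <= beta * ln (3 * x ^+ 2).
  rewrite lerNl; apply: (le_trans (ler_norm _)).
  rewrite normrN normrM (ger0_norm ly0) [3 * `|beta|]mulrC -mulrA ler_wpM2l//.
  by rewrite (le_trans ly)// ler_pM2l.
have h3 : lam * ln (3 * x ^+ 2) `^ gamma <= lam * 3 `^ gamma * ln x `^ gamma.
  by rewrite -mulrA ler_pM2l.
have -> : A * ln x `^ gamma = `|ln c| * ln x `^ gamma +
    3 * `|beta| * ln x `^ gamma + lam * 3 `^ gamma * ln x `^ gamma.
  by rewrite /A; ring.
move: h1 h2 h3; set z1 := `|ln c| * _; set z2 := 3 * `|beta| * _.
set z3 := lam * 3 `^ gamma * _; set z4 := lam * _; set z5 := beta * _.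
by move=> h1 h2 h3; lra.
Unshelve. all: by end_near. Qed.

End lognormal_speed.

(** * The scaled process *)

Section scaled_levy.
Context (R : realType) (d : measure_display) (Omega : measurableType d).
Variables (P : probability Omega R) (a b : R).
Variable nu : {sigma_finite_measure set (measurableTypeR R) -> \bar R}.
Variable X : R -> {RV P >-> R}.
Hypothesis X_levy : levy_process a b nu X.
Hypothesis nu_neg : nu [set x : R | x < 0] = 0%E.
Variables (c beta lam gamma : R).
Hypotheses (c0 : 0 < c) (lam0 : 0 < lam) (g1 : 1 < gamma).
Hypothesis nu_tail : \forall x \near +oo,
  nu [set y : R | x <= y] = (lognormal_tail c beta lam gamma x)%:E.

Let Xbar := scaled_process X_levy.
Let speed (n : nat) := lognormal_speed c beta lam gamma n%:R.
Let cent := centered nu b X.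

Let tail_le :
  \forall x \near +oo, (nu [set y : R | (x <= y)%R] <= (x ^- 2)%:E)%E.
Proof.
near=> x; have -> : nu [set y : R | x <= y] = (lognormal_tail c beta lam gamma x)%:E.
  by near: x.
rewrite lee_fin; near: x; exact: lognormal_tail_le.
Unshelve. all: by end_near. Qed.

Let tail_gt0 : \forall x \near +oo, (0 < nu [set y : R | (x <= y)%R])%E.
Proof.
near=> x; have -> : nu [set y : R | x <= y] = (lognormal_tail c beta lam gamma x)%:E.
  by near: x.
by rewrite lte_fin lognormal_tail_gt0.
Unshelve. all: by end_near. Qed.

Let pathE n w : sample_path (Xbar n w) = scaled_fun b nu X n w \_ `[0, 1].
Proof. by []. Qed.

Lemma sample_path_scaled n w t : t \in `[0, 1] -> (0 < n)%N ->
  sample_path (Xbar n w) t = n%:R^-1 * cent (n%:R * t) w.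
Proof.
move=> t01 n0; rewrite pathE patchE mem_setE t01.
rewrite /scaled_fun /cent /centered; congr (_ * _).
by rewrite -[\int[nu]_(x in _) x]/(jump_mean nu); ring.
Qed.

Lemma measurable_sample_path n t :
  measurable_fun setT (fun w => sample_path (Xbar n w) t).
Proof.
have [t01|t01] := boolP (t \in `[0, 1]); last first.
  under eq_fun do rewrite path_outside//.
  exact: measurable_cst.
have E w : sample_path (Xbar n w) t = scaled_fun b nu X n w t.
  by rewrite pathE patchE mem_setE t01.
under eq_fun do rewrite E.
rewrite /scaled_fun; apply: measurable_funM => //.
by apply: measurable_funB => //; exact: measurable_funB.
Qed.

Let near_nat (Q : R -> Prop) : (\forall x \near +oo, Q x) ->
  \forall n \near \oo, Q n%:R.
Proof. by move=> hQ; exact: (cvgr_idn hQ). Qed.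

Lemma negative_around_superexponential t1 delta : 0 < t1 < 1 -> 0 < delta ->
  limn_einf (fun n => ((speed n)^-1)%:E *
    lne (P (Xbar n @^-1` negative_around t1 delta)))%E = -oo%E.
Proof.
move=> /andP[t0 t1'] d0.
case: X_levy => nu_levy _ [B [N [J [Bm NP BN Js Xi]]]].
(* The scaled level [delta] at [t1] is the slope [delta / t1] for the unscaled process at time n
   t1. *)
have dt0 : 0 < delta / t1 by rewrite divr_gt0.
have [k [K [k0 K0 low]]] := levy_lower_tail nu_levy nu_neg tail_le NP Bm BN Js Xi dt0.
set u := (fun _ => _).
suff /cvgNy_limn_einf_sup[] : u n @[n --> \oo] --> -oo%E by [].
apply/cvgeNyPle => A; rewrite /u {u}.
have kt0 : 0 < k * t1 by rewrite mulr_gt0.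
have g0 : 0 < gamma := lt_trans ltr01 g1.
have nspeed := near_nat (lognormal_speed_bounds beta c0 lam0 g1).
have nln := near_nat (ln_le_powR g1).
(* Chosen so that ln K - k t1 n is at most A times the speed, for either sign of A. *)
have nsub := near_nat (ln_powR_sublinear (`|ln K| + 2 * lam * `|A|) kt0 g0).
near=> n.
have n0 : (0 < n)%N by near: n; exact: nbhs_infty_gt.
have nR : 0 < n%:R :> R by rewrite ltr0n.
have [l1 lg] : 1 <= ln (n%:R : R) /\ ln n%:R <= ln n%:R `^ gamma :> R by near: n.
have /andP[s1 s2] : lam / 2 * ln n%:R `^ gamma <= speed n <= 2 * lam * ln n%:R `^ gamma.
  by near: n.
have sub : (`|ln K| + 2 * lam * `|A|) * ln n%:R `^ gamma <= k * t1 * n%:R by near: n.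
set g := ln n%:R `^ gamma in lg s1 s2 sub.
have g_ge1 : 1 <= g := le_trans l1 lg.
have sp0 : 0 < speed n.
  apply: lt_le_trans s1; apply: mulr_gt0; first exact: divr_gt0.
  exact: lt_le_trans g_ge1.
have PG : (P (Xbar n @^-1` negative_around t1 delta) <=
    (K * expR (- (k * (n%:R * t1))))%:E)%E.
  apply: le_trans (low (n%:R * t1) (mulr_gt0 nR t0)).
  apply: le_measure_set.
  - by apply: measurable_negative_around => // t; exact: measurable_sample_path.
  - rewrite -[X in measurable X]setTI; apply: measurable_fun_le => //.
    by apply: measurable_funB => //; exact: measurable_funB.
  move=> w [j /(_ t1)]; rewrite subrr normr0 invr_gt0 ltr0n => /(_ isT).
  rewrite sample_path_scaled// ?in_itv/= ?(ltW t0) ?(ltW t1')// => h.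
  have {}h : n%:R^-1 * cent (n%:R * t1) w <= - delta.
    by apply: (le_trans h); rewrite lerBlDr lerDl invr_ge0.
  move: h; rewrite ler_pdivrMl// => h; apply: (le_trans h).
  rewrite le_eqVlt; apply/orP; left; apply/eqP; field; by rewrite gt_eqF.
have KE : 0 < K * expR (- (k * (n%:R * t1))) by rewrite mulr_gt0 ?expR_gt0.
have lnP : (lne (P (Xbar n @^-1` negative_around t1 delta)) <=
    (ln K - k * (n%:R * t1))%:E)%E.
  have -> : ln K - k * (n%:R * t1) = ln (K * expR (- (k * (n%:R * t1)))).
    by rewrite lnM ?posrE ?expR_gt0// expRK.
  rewrite -lne_EFin//; move: PG; set p := P _.
  have p0 : (0 <= p)%E by exact: measure_ge0.
  case: p p0 => [r| |]// r0 rK.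
  (* At probability 0 the value of [lne] is -oo, so this case is separate. *)
  rewrite /lne; case: ifPn => [|rp]; first by rewrite leNye.
  rewrite -ltNge in rp; rewrite ifF; last by rewrite leNgt KE.
  by rewrite lee_fin ler_ln ?posrE// -lee_fin.
apply: (@le_trans _ _ ((speed n)^-1%:E * (ln K - k * (n%:R * t1))%:E)%E).
  by apply: lee_wpmul2l => //; rewrite lee_fin invr_ge0 ltW.
rewrite -EFinM lee_fin ler_pdivrMl//.
have h1 : ln K <= `|ln K| * g.
  by rewrite (le_trans (ler_norm _))// ler_peMr.
have h2 : - (speed n * A) <= 2 * lam * `|A| * g.
  apply: (le_trans (ler_norm _)); rewrite normrN normrM gtr0_norm//.
  by rewrite mulrAC ler_wpM2r.
have -> : k * (n%:R * t1) = k * t1 * n%:R by ring.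
rewrite lerBlDl; apply: (le_trans h1).
rewrite -lerBlDr; apply: le_trans sub.
by rewrite [leRHS]mulrDl lerD2l.
Unshelve. all: by end_near. Qed.

Lemma dips_probable : exists kappa, 0 < kappa /\
  (-oo < limn_esup (fun n => ((speed n)^-1)%:E * lne (P (Xbar n @^-1` dips kappa))))%E.
Proof.
case: (X_levy) => nu_levy _ [B [N [J [Bm NP BN Js Xi]]]].
have [T [kappa [p [K [k [[T0 kap0 p0 k0] low]]]]]] :=
  dip_and_large_value nu_levy nu_neg tail_le tail_gt0 NP Bm BN Js Xi.
exists kappa; split => //.
have [A A0 nA] := lognormal_tail_square beta c0 lam0 g1.
have g0 : 0 < gamma := lt_trans ltr01 g1.
(* Half of [p] absorbs the error [K * expR (- (k * n%:R))]. The remaining exponent is at most [D]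
   log^gamma n, and the speed at least (lam / 2) log^gamma n. *)
pose D := `|ln (p / 2)| + A.
apply: (@lt_le_trans _ _ (- (D / (lam / 2)))%:E); first exact: ltNyr.
apply: limn_esup_ge.
have nlow := near_nat low.
have {}nA := near_nat nA.
have nspeed := near_nat (lognormal_speed_bounds beta c0 lam0 g1).
have nln := near_nat (ln_le_powR g1).
have nsub := near_nat (ln_powR_sublinear (`|ln (p / 2)| + A + `|K|) k0 g0).
have ntail : \forall n \near \oo, nu [set y : R | 3 * n%:R ^+ 2 <= y] =
    (lognormal_tail c beta lam gamma (3 * n%:R ^+ 2))%:E.
  have [M [_ hM]] := nu_tail; near=> n; apply: hM.
  have n1 : 1 <= n%:R :> R by rewrite ler1n; near: n; exact: nbhs_infty_gt.
  have : M < n%:R by near: n; exact: nbhs_infty_gtr.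
  by move=> Mn; apply: (lt_le_trans Mn); nra.
near=> n.
have n0 : (0 < n)%N by near: n; exact: nbhs_infty_gt.
have nR : 0 < n%:R :> R by rewrite ltr0n.
have nT : T <= n%:R by near: n; exact: nbhs_infty_ger.
have n1 : 1 <= n%:R :> R by rewrite ler1n.
have [l1 lg] : 1 <= ln (n%:R : R) /\ ln n%:R <= ln n%:R `^ gamma :> R by near: n.
have /andP[s1 s2] : lam / 2 * ln n%:R `^ gamma <= speed n <= 2 * lam * ln n%:R `^ gamma.
  by near: n.
have sub : (`|ln (p / 2)| + A + `|K|) * ln n%:R `^ gamma <= k * n%:R by near: n.
have tailA : expR (- (A * ln n%:R `^ gamma)) <=
  lognormal_tail c beta lam gamma (3 * n%:R ^+ 2) by near: n.
have lown : (p%:E * nu [set y : R | (3 * n%:R ^+ 2 <= y)%R] <=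
     P ([set w | (cent T w <= - kappa)%R] `&` [set w | (n%:R ^+ 2 <= cent n%:R w)%R])
     + (K * expR (- (k * n%:R)))%:E)%E by near: n.
have tailE : nu [set y : R | 3 * n%:R ^+ 2 <= y] =
    (lognormal_tail c beta lam gamma (3 * n%:R ^+ 2))%:E by near: n.
set g := ln n%:R `^ gamma in lg s1 s2 sub tailA.
have g_ge1 : 1 <= g := le_trans l1 lg.
have sp0 : 0 < speed n.
  apply: lt_le_trans s1; apply: mulr_gt0; first exact: divr_gt0.
  exact: lt_le_trans g_ge1.
set G := _ `&` _ in lown.
have mcent t : measurable_fun setT (cent t).
  by apply: measurable_funB => //; exact: measurable_funB.
have mG : measurable G.
  by apply: measurableI; rewrite -[X in measurable X]setTI; apply: measurable_fun_le.
have GF : (P G <= P (Xbar n @^-1` dips kappa))%E.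
  apply: le_measure_set => //.
    by apply: measurable_dips => // t; exact: measurable_sample_path.
  move=> w [wT wn].
  have i1 : (1 : R) \in `[0, 1] by rewrite in_itv/= ler01 lexx.
  have iT : T / n%:R \in `[0, 1].
    have q0 : 0 <= T / n%:R by apply: divr_ge0; exact: ltW.
    by rewrite in_itv/= q0/= ler_pdivrMr// mul1r.
  have Y1 : n%:R <= sample_path (Xbar n w) 1.
    by rewrite sample_path_scaled// mulr1 ler_pdivlMl// -expr2.
  split; first exact: le_trans Y1.
  move=> e e0; exists (T / n%:R) => //.
  (* The depth kappa / n at time T / n is compensated by an end value of at least n. *)
  have YT : sample_path (Xbar n w) (T / n%:R) <= - (kappa / n%:R).
    rewrite sample_path_scaled// mulrCA divff ?gt_eqF// mulr1 mulrC -mulNr.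
    by rewrite ler_pM2r ?invr_gt0.
  have : sample_path (Xbar n w) (T / n%:R) * sample_path (Xbar n w) 1 <= - kappa.
    apply: (@le_trans _ _ (- (kappa / n%:R) * sample_path (Xbar n w) 1)).
      by rewrite ler_wpM2r// (le_trans _ Y1).
    rewrite mulNr lerN2 -[leLHS](divfK (x := n%:R)) ?gt_eqF// ler_wpM2l//.
    by rewrite divr_ge0// ltW.
  lra.
have PF : ((p / 2 * expR (- (A * g)))%:E <= P (Xbar n @^-1` dips kappa))%E.
  apply: le_trans GF.
  have PGfin : P G \is a fin_num by exact: fin_num_measure.
  move: lown; rewrite tailE -(fineK PGfin) -EFinM -EFinD !lee_fin => h.
  have h1 : p * expR (- (A * g)) <= p * lognormal_tail c beta lam gamma (3 * n%:R ^+ 2).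
    by rewrite ler_pM2l.
  have p20 : 0 < p / 2 by rewrite divr_gt0.
  have h2 : K * expR (- (k * n%:R)) <= p / 2 * expR (- (A * g)).
    exact: expR_dominated.
  have -> : p / 2 * expR (- (A * g)) = p * expR (- (A * g)) - p / 2 * expR (- (A * g)).
    by field.
  rewrite lerBlDr; apply: (le_trans h1); apply: (le_trans h).
  by rewrite lerD2l.
have pe0 : 0 < p / 2 * expR (- (A * g)) by rewrite mulr_gt0 ?divr_gt0 ?expR_gt0.
have lnP : ((ln (p / 2) - A * g)%:E <= lne (P (Xbar n @^-1` dips kappa)))%E.
  have -> : ln (p / 2) - A * g = ln (p / 2 * expR (- (A * g))).
    by rewrite [RHS]lnM ?posrE ?expR_gt0 ?divr_gt0// expRK.
  move: PF; set q := P _; case: q => [r| |]//; last by move=> _; exact: leey.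
  rewrite lee_fin => pr; have r0 : 0 < r by exact: lt_le_trans pr.
  by rewrite lne_EFin// lee_fin ler_ln ?posrE.
apply: (@le_trans _ _ ((speed n)^-1%:E * (ln (p / 2) - A * g)%:E)%E); last first.
  by apply: lee_wpmul2l => //; rewrite lee_fin invr_ge0 ltW.
rewrite -EFinM lee_fin ler_pdivlMl//.
have l20 : 0 < lam / 2 by rewrite divr_gt0.
have D0 : 0 <= D by rewrite addr_ge0// ltW.
have h1 : D * g <= speed n * (D / (lam / 2)).
  apply: (@le_trans _ _ (lam / 2 * g * (D / (lam / 2)))).
    rewrite le_eqVlt; apply/orP; left; apply/eqP; field.
    by rewrite gt_eqF.
  by rewrite ler_wpM2r// divr_ge0// ltW.
have h2 : - (`|ln (p / 2)| * g) <= ln (p / 2).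
  exact: ln_ge_norm.
rewrite mulrN lerNl opprB; apply: le_trans h1.
by rewrite /D mulrDl addrC lerD2r lerNl.
Unshelve. all: by end_near. Qed.

End scaled_levy.

Theorem theorem3p6 (R : realType) (d : measure_display)
  (Omega : measurableType d) (P : probability Omega R)
  (a b : R) (nu : {sigma_finite_measure set (measurableTypeR R) -> \bar R})
  (X : R -> {RV P >-> R}) (X_levy : levy_process a b nu X)
  (nu_support : nu [set x : R | x < 0] = 0%E)
  (c beta lam gamma : R) (c_gt0 : 0 < c) (lam_gt0 : 0 < lam)
  (gamma_gt1 : 1 < gamma)
  (nu_tail : \forall x \near +oo,
     nu [set y : R | x <= y] = (c * x `^ beta * expR (- (lam * ln x `^ gamma)))%:E) :
  let r_log (x : R) := lam * ln x `^ gamma - ln (c * x `^ beta) in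
  let speed (n : nat) := r_log n%:R in
  let Xbar : nat -> Omega -> skorokhod R := scaled_process X_levy in
  [/\ ~ LDP P (Xbar : nat -> Omega -> D_M1' R) speed,
      exists F : set (D_M1' R), <<s [set G : set (D_M1' R) | open G] >> F /\
        (limn_esup (fun n => ((speed n)^-1)%:E * lne (P (Xbar n @^-1` F))) >
         - ereal_inf (@rate_M1' R @` closure F))%E &
      ~ LDP P (Xbar : nat -> Omega -> D_J1 R) speed].
Proof.
move=> r_log speed Xbar.
have [kappa [k0 probable]] :=
  dips_probable X_levy nu_support c_gt0 lam_gt0 gamma_gt1 nu_tail.
have rare := negative_around_superexponential X_levy nu_support
  c_gt0 lam_gt0 gamma_gt1 nu_tail.
have closedF := dips_closed (@dist_M1'_close R) k0.
split.
- exact: not_LDP_of_dips (@dist_M1'_close R) k0 probable rare.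
(* Borel as the complement of an open set, and equal to its closure, on which the rate is infinite;
   any finite lower bound is then strictly larger. *)
- exists (dips kappa); split.
    rewrite -[X in <<s _ >> X]setCK -setTD; apply: sigma_algebraCD.
    by apply: sub_sigma_algebra; exact: closed_openC.
  rewrite -(closure_id _).1//.
  suff -> : ereal_inf (@rate_M1' R @` dips kappa) = +oo%E by [].
  apply/eqP; rewrite -leye_eq; apply: le_ereal_inf_tmp => _ [xi /(dips_rate k0) -> <-].
  by rewrite leey.
- exact: not_LDP_of_dips (@dist_J1_close R) k0 probable rare.
Qed.
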